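(* Let $L$ be a positive-definite even lattice of rank $\ge1$ in a Euclidean space $E$, let $B\le L$ be a Borel-type submonoid, with $B\subset P^{\ge0}(\gamma)$ where $P(\gamma)$ is the unique hyperplane that defines $B$, and let $P\le L$ be a parabolic-type submonoid containing $B$ such that $P\subset P^{\ge0}(\gamma)$. Then $V_P$ is not simple and not rational. In particular, Borel-type subVOAs of $V_L$ are not simple and not rational.
   Context: $L$ is a positive-definite even lattice spanned over $\mathbb{Z}$ by an $\mathbb{R}$-basis of the Euclidean space $(E,(\cdot|\cdot))$. For $0\ne\gamma\in E$ put $P(\gamma)=\{v\in E:(\gamma|v)=0\}$ and $P^{\ge0}(\gamma)=\{v\in E:(\gamma|v)\ge0\}$. A submonoid of $L$ is a subset containing $0$ and closed under addition. A submonoid $B\le L$ is of Borel-type if $B\cup(-B)=L$, $B\cap(-B)=\{0\}$, and there is a hyperplane $P(\gamma)\subset E$ with $B\subset P^{\ge0}(\gamma)$ (this hyperplane is unique). A submonoid $P\le L$ is of parabolic-type if it contains a Borel-type submonoid. Lattice VOA. Put $\mathfrak{h}=\mathbb{C}\otimes_{\mathbb{Z}}L$ with the $\mathbb{C}$-bilinear extension of $(\cdot|\cdot)$, and $\hat{\mathfrak{h}}=\mathfrak{h}\otimes\mathbb{C}[t,t^{-1}]\oplus\mathbb{C}K$ with $K$ central, $h(m)=h\otimes t^m$, $[h_1(m),h_2(n)]=m\delta_{m+n,0}(h_1|h_2)K$. For $\lambda\in\mathfrak{h}$, $M_{\hat{\mathfrak{h}}}(1,\lambda)=U(\hat{\mathfrak{h}})\otimes_{U(\hat{\mathfrak{h}}_{\ge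 0})}\mathbb{C}e^\lambda$, where $\hat{\mathfrak{h}}_{\ge 0}=\mathfrak{h}\otimes\mathbb{C}[t]\oplus\mathbb{C}K$ acts by $K=1$, $h(0)e^\lambda=(h|\lambda)e^\lambda$, $h(n)e^\lambda=0$ for $n>0$. Let $\epsilon:L\times L\to\{\pm1\}$ be a 2-cocycle with $\epsilon(\alpha,\beta)\epsilon(\beta,\alpha)=(-1)^{(\alpha|\beta)}$ and $\epsilon(0,\alpha)=\epsilon(\alpha,0)=1$. The lattice VOA is $V_L=\bigoplus_{\alpha\in L}M_{\hat{\mathfrak{h}}}(1,\alpha)=M_{\hat{\mathfrak{h}}}(1,0)\otimes\mathbb{C}^\epsilon[L]$ with vacuum $\mathbf{1}=e^0$, $Y(h(-1)\mathbf{1},z)=\sum_{n}h(n)z^{-n-1}$, $Y(e^\alpha,z)=\exp\big(\sum_{n>0}\frac{\alpha(-n)}{n}z^n\big)\exp\big(-\sum_{n>0}\frac{\alpha(n)}{n}z^{-n}\big)e_\alpha z^\alpha$, where $e_\alpha(w\otimes e^\beta)=\epsilon(\alpha,\beta)w\otimes e^{\alpha+\beta}$ and $z^\alpha$ acts on $M_{\hat{\mathfrak{h}}}(1,\beta)$ as $z^{(\alpha|\beta)}$; $Y$ of a general $h_1(-n_1-1)\cdots h_k(-n_k-1)e^\alpha$ is the normally ordered product of the $\frac{1}{n_i!}\partial_z^{n_i}h_i(z)$ and $Y(e^\alpha,z)$. The Virasoro element is $\omega=\frac12\sum_i u_i(-1)^2\mathbf{1}$ for an orthonormal basis $\{u_i\}$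 of $\mathfrak{h}$. For a submonoid $M\le L$, $V_M=\bigoplus_{\gamma\in M}M_{\hat{\mathfrak{h}}}(1,\gamma)$ is a subVOA of $V_L$ with the same vacuum and Virasoro element; $V_B$ with $B$ of Borel-type is called a Borel-type subVOA. A VOA is rational if every admissible (i.e. $\mathbb{Z}_{\ge0}$-graded) module is semisimple (a direct sum of irreducible admissible modules); it is simple if it has no nonzero proper ideal. *)

(* Defs.v *)
From HB Require Import structures.
From mathcomp Require Import all_boot all_order all_algebra.
From mathcomp Require Import finmap multiset monalg complex.
From mathcomp Require Import boolp classical_sets fsbigop reals.

Set Implicit Arguments.
Unset Strict Implicit.
Unset Printing Implicit Defensive.

Import Order.TTheory GRing.Theory Num.Theory.

Local Open Scope classical_set_scope.
Local Open Scope ring_scope.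

Definition binz (K : numFieldType) (x : int) (j : nat) : K :=
  (\prod_(i < j) (x - i%:Z)%:~R) / j`!%:R.

Definition subspace (K : numFieldType) (M : lmodType K) (S : M -> Prop) : Prop :=
  S 0 /\ forall c x y, S x -> S y -> S (c *: x + y).

Definition is_direct_sum (K : numFieldType) (M : lmodType K) (I : choiceType)
    (W : I -> M -> Prop) : Prop :=
  [/\ forall i, subspace (W i),
      forall w, exists (s : seq I) (f : I -> M),
        (forall i, W i (f i)) /\ w = \sum_(i <- s) f i
    & forall (s : seq I) (f : I -> M), uniq s -> (forall i, W i (f i)) ->
        \sum_(i <- s) f i = 0 -> forall i, i \in s -> f i = 0].

(* The structure maps of a VOA: [vop a n] is the mode a_n, that is, the
   coefficient of z^(-n-1) in Y(a, z).  The notions below only depend on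
   these maps. *)
Record voa_data (K : numFieldType) := VoaData {
  carrier :> lmodType K;
  vop : carrier -> int -> carrier -> carrier;
  vac : carrier;
  conf : carrier
}.

(* [wm_jacobi] is the Jacobi identity read off coefficientwise (Borcherds'
   identity); the sums are finite by [wm_trunc] and by a_n b = 0 for n >> 0
   in V. *)
Record weak_module (K : numFieldType) (V : voa_data K) := WeakModule {
  wm_carrier :> lmodType K;
  wm_op : V -> int -> wm_carrier -> wm_carrier;
  wm_linl : forall n w, linear (fun a => wm_op a n w);
  wm_linr : forall a n, linear (wm_op a n);
  wm_trunc : forall a w, exists N : int, forall n, N <= n -> wm_op a n w = 0;
  wm_vac : forall n w, wm_op (vac V) n w = if n == -1 then w else 0;
  wm_jacobi : forall (a b : V) (l m n : int) (w : wm_carrier),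
    \sum_(j \in [set: nat])
      binz K m j *: wm_op (vop a (l + j%:Z) b) (m + n - j%:Z) w =
    \sum_(j \in [set: nat])
      ((-1) ^+ j * binz K l j) *:
        (wm_op a (m + l - j%:Z) (wm_op b (n + j%:Z) w)
         - (-1) ^ l *: wm_op b (n + l - j%:Z) (wm_op a (m + j%:Z) w))
}.

(* a is homogeneous of weight d: L(0) a = d a, where L(0) = omega_1. *)
Definition has_weight (K : numFieldType) (V : voa_data K) (a : V) (d : int) :=
  vop (conf V) 1 a = d%:~R *: a.

Record admissible_module (K : numFieldType) (V : voa_data K) :=
  AdmissibleModule {
  am_module :> weak_module V;
  am_gr : nat -> am_module -> Prop;
  am_direct : is_direct_sum am_gr;
  am_degree : forall (a : V) (d m : int) (k : nat) (w : am_module),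
    has_weight a d -> am_gr k w ->
    (forall k' : nat, k'%:Z = k%:Z + d - m - 1 -> am_gr k' (wm_op a m w)) /\
    (k%:Z + d - m - 1 < 0 -> wm_op a m w = 0)
}.

Definition admissible_submodule (K : numFieldType) (V : voa_data K)
    (M : admissible_module V) (S : M -> Prop) : Prop :=
  [/\ subspace S,
      forall (a : V) n w, S w -> S (wm_op a n w)
    & forall (s : seq nat) (f : nat -> M), uniq s ->
        (forall k, am_gr k (f k)) -> S (\sum_(k <- s) f k) ->
        forall k, k \in s -> S (f k)].

Definition irreducible_module (K : numFieldType) (V : voa_data K)
    (M : admissible_module V) : Prop :=
  (exists w : M, w <> 0) /\
  forall S : M -> Prop, admissible_submodule S ->
    (forall w, S w -> w = 0) \/ (forall w, S w).

(* M is isomorphic, as a weak module, to a direct sum of irreducible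
   admissible modules N i. *)
Definition semisimple_module (K : numFieldType) (V : voa_data K)
    (M : admissible_module V) : Prop :=
  exists (I : choiceType) (N : I -> admissible_module V)
         (iota : forall i, N i -> M),
    [/\ forall i, irreducible_module (N i),
        forall i, linear (iota i) /\ injective (iota i),
        forall i (a : V) n w, iota i (wm_op a n w) = wm_op a n (iota i w)
      & is_direct_sum (fun i w => exists x, w = iota i x)].

Definition rational_voa (K : numFieldType) (V : voa_data K) : Prop :=
  forall M : admissible_module V, semisimple_module M.

Definition ideal (K : numFieldType) (V : voa_data K) (I : V -> Prop) : Prop :=
  subspace I /\
  forall (a v : V) n, I v -> I (vop a n v) /\ I (vop v n a).

Definition simple_voa (K : numFieldType) (V : voa_data K) : Prop :=
  forall I : V -> Prop, ideal I ->
    (forall v, I v -> v = 0) \/ (forall v, I v).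

Definition dot (R : realType) (n : nat) (u v : 'rV[R]_n) : R :=
  \sum_i u 0 i * v 0 i.

(* E is R^n with its standard inner product.  An element of L is given by its
   integer coordinates in the R-basis of E formed by the rows of [lbasis]. *)
Record even_lattice (R : realType) (n : nat) := EvenLattice {
  lbasis : 'M[R]_n;
  lbasis_unit : lbasis \in unitmx;
  lbasis_even : forall a : 'rV[int]_n,
    let v := map_mx intr a *m lbasis in
    exists k : int, dot v v = (2 * k)%:~R
}.

Definition lvec (R : realType) (n : nat) (L : even_lattice R n)
    (a : 'rV[int]_n) : 'rV[R]_n := map_mx intr a *m lbasis L.

(* (a|b) as an integer; it is one since L is even, so the floor is exact. *)
Definition ldot (R : realType) (n : nat) (L : even_lattice R n)
    (a b : 'rV[int]_n) : int := Num.floor (dot (lvec L a) (lvec L b)).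

Record submonoid (A : zmodType) := Submonoid {
  sm_mem :> A -> Prop;
  sm_mem0 : sm_mem 0;
  sm_memD : forall a b, sm_mem a -> sm_mem b -> sm_mem (a + b)
}.

Definition halfspace (R : realType) (n : nat) (g : 'rV[R]_n) : set 'rV[R]_n :=
  [set v | 0 <= dot g v].

Definition in_halfspace (R : realType) (n : nat) (L : even_lattice R n)
    (B : submonoid 'rV[int]_n) (g : 'rV[R]_n) : Prop :=
  forall a, B a -> halfspace g (lvec L a).

Definition borel_type (R : realType) (n : nat) (L : even_lattice R n)
    (B : submonoid 'rV[int]_n) : Prop :=
  [/\ forall a, B a \/ B (- a),
      forall a, B a -> B (- a) -> a = 0
    & exists g : 'rV[R]_n, g <> 0 /\ in_halfspace L B g].

Definition parabolic_type (R : realType) (n : nat) (L : even_lattice R n)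
    (P : submonoid 'rV[int]_n) : Prop :=
  exists B : submonoid 'rV[int]_n,
    borel_type L B /\ forall a, B a -> P a.

Record cocycle (R : realType) (n : nat) (L : even_lattice R n) := Cocycle {
  eps :> 'rV[int]_n -> 'rV[int]_n -> int;
  eps_sign : forall a b, eps a b = 1 \/ eps a b = -1;
  eps_cocycle : forall a b c,
    eps a b * eps (a + b) c = eps b c * eps a (b + c);
  eps_comm : forall a b, eps a b * eps b a = (-1) ^ ldot L a b;
  eps_0l : forall a, eps 0 a = 1;
  eps_0r : forall a, eps a 0 = 1
}.

Section OperatorSeries.
Variables (K : numFieldType) (V : lmodType K).

(* [f p] is the coefficient of z^p. *)
Definition opser := nat -> V -> V.

Definition opser_one : opser := fun p v => if p is 0 then v else 0.

Definition opser_mul (f g : opser) : opser :=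
  fun p v => \sum_(i < p.+1) f i (g (p - i)%N v).

Definition opser_pow (f : opser) (r : nat) : opser :=
  iter r (opser_mul f) opser_one.

(* The exponential of a series with zero constant term: f^r has no term of
   degree < r, so only the powers r <= p contribute to z^p. *)
Definition opser_exp (f : opser) : opser :=
  fun p v => \sum_(r < p.+1) (r`!%:R)^-1 *: opser_pow f r p v.

(* [X n] is the coefficient of z^(-n-1). *)
Definition opfield := int -> V -> V.

(* (1/p!) (d/dz)^p maps z^(-m-1) to binz (-m-1) p z^(-(m+p)-1). *)
Definition dfield (p : nat) (A : opfield) : opfield :=
  fun k v => binz K (p%:Z - k - 1) p *: A (k - p%:Z) v.

(* The normally ordered product :A(z) X(z):, with the creation part of A
   (modes A_k, k < 0) to the left of X and its annihilation part to the
   right. *)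
Definition nop (A X : opfield) : opfield := fun n v =>
  \sum_(j \in [set: nat]) A (- j%:Z - 1) (X (n + j%:Z) v)
  + \sum_(j \in [set: nat]) X (n - j%:Z - 1) (A j%:Z v).

End OperatorSeries.

(* The pair (i, p) stands for the element u_i(-p-1) of h^-, where (u_i) is the
   standard basis of E, which is orthonormal.  By PBW, the multiset m
   and the lattice element a index the basis vector
   (\prod_((i, p) in m) u_i(-p-1)) e^a of M(1, a). *)
Definition fock_index (n : nat) : choiceType :=
  ({mset ('I_n * nat)%type}%mset * 'rV[int]_n)%type.

Section LatticeVOA.
Variables (R : realType) (n : nat) (L : even_lattice R n) (ep : cocycle L).

Local Notation C := (complex R).

Definition fock : lmodType C := {malg C[fock_index n]}.

Definition fock_lift (f : fock_index n -> fock) (v : fock) : fock :=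
  \sum_(b <- msupp v) v@_b *: f b.

Definition heis (i : 'I_n) (k : int) : fock -> fock :=
  fock_lift (fun b : fock_index n =>
    match k with
    | Negz p => << ((i, p) +` b.1, b.2)%mset >>
    | Posz 0 => (lvec L b.2 0 i)%:C%C *: << b >>
    | Posz p.+1 =>
        (p.+1 * b.1 (i, p))%:R *: << (b.1 `\ (i, p), b.2)%mset >>
    end).

Definition lheis (a : 'rV[int]_n) (k : int) (v : fock) : fock :=
  \sum_i (lvec L a 0 i)%:C%C *: heis i k v.

(* exp (\sum_(k > 0) a(-k)/k z^k) *)
Definition exp_minus (a : 'rV[int]_n) : opser fock :=
  opser_exp (fun k v => if k is 0 then 0
                        else k%:R^-1 *: lheis a (- k%:Z) v).

(* exp (- \sum_(k > 0) a(k)/k z^(-k)), as a series in z^(-1) *)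
Definition exp_plus (a : 'rV[int]_n) : opser fock :=
  opser_exp (fun k v => if k is 0 then 0
                        else - (k%:R^-1 *: lheis a k%:Z v)).

(* Y(e^a, z); on M(1, b), z^a is the scalar z^(a|b). *)
Definition Yexp (a : 'rV[int]_n) : opfield fock := fun k =>
  fock_lift (fun b : fock_index n =>
    (ep a b.2)%:~R *:
      \sum_(pq \in [set pq : nat * nat |
                     pq.1%:Z - pq.2%:Z + ldot L a b.2 = - k - 1])
         exp_minus a pq.1 (exp_plus a pq.2 << (b.1, a + b.2) >>)).

Definition Ybasis (b : fock_index n) : opfield fock :=
  foldr (fun ip X => nop (dfield ip.2 (heis ip.1)) X) (Yexp b.2)
        (enum_mset b.1).

Definition Yfock (v : fock) (k : int) (w : fock) : fock :=
  \sum_(b <- msupp v) v@_b *: Ybasis b k w.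

Definition fock_vac : fock := << (mset0, 0) >>.

Definition fock_conf : fock :=
  2^-1 *: \sum_i heis i (-1) (heis i (-1) fock_vac).

Definition lattice_voa : voa_data C := VoaData Yfock fock_vac fock_conf.

Section SubVOA.
Variable M : submonoid 'rV[int]_n.

(* \bigoplus_(a in M) M(1, a) *)
Definition charge_in : {pred fock} :=
  fun v : fock => all (fun b : fock_index n => `[< M b.2 >]) (msupp v).

Lemma charge_inP (v : fock) :
  reflect (forall b, ~ M b.2 -> v@_b = 0) (v \in charge_in).
Proof.
apply: (iffP allP) => [vM b bM | vM b bv].
  by apply/eqP/negPn/negP => vb; apply/bM/asboolP/vM; rewrite -mcoeff_neq0.
apply/asboolP; apply: contrapT => bM.
by move: bv; rewrite -mcoeff_neq0 vM ?eqxx.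
Qed.

Fact charge_in_submod : submod_closed charge_in.
Proof.
split=> [|c x y /charge_inP xM /charge_inP yM]; apply/charge_inP => b bM.
  by rewrite mcoeff0.
by rewrite mcoeffD mcoeffZ xM ?yM ?mulr0 ?addr0.
Qed.

HB.instance Definition _ :=
  GRing.isSubmodClosed.Build C fock charge_in charge_in_submod.

Record fock_on := FockOn {
  fock_val :> fock;
  fock_valP : fock_val \in charge_in
}.

HB.instance Definition _ := [isSub for fock_val].
HB.instance Definition _ := [Choice of fock_on by <:].
HB.instance Definition _ := [SubChoice_isSubLmodule of fock_on by <:].

Lemma charge_inU (b : fock_index n) : M b.2 -> << b >> \in charge_in.
Proof.
move=> bM; apply/charge_inP => b' b'M; rewrite mcoeffU.
by case: eqP => // bb'; case: b'M; rewrite -bb'.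
Qed.

Lemma fock_lift_charge (f : fock_index n -> fock) (v : fock) :
  (forall b, M b.2 -> f b \in charge_in) -> v \in charge_in ->
  fock_lift f v \in charge_in.
Proof.
move=> fM /allP vM; rewrite /fock_lift big_seq; apply: rpred_sum => b bv.
by apply/rpredZ/fM/asboolP/vM.
Qed.

Lemma heis_charge i k v : v \in charge_in -> heis i k v \in charge_in.
Proof.
apply: fock_lift_charge => b bM.
by case: k => [[|p]|p]; rewrite ?rpredZ // charge_inU.
Qed.

Lemma lheis_charge a k v : v \in charge_in -> lheis a k v \in charge_in.
Proof. by move=> vM; apply: rpred_sum => i _; apply/rpredZ/heis_charge. Qed.

Lemma opser_exp_charge (f : opser fock) :
  (forall p v, v \in charge_in -> f p v \in charge_in) ->
  forall p v, v \in charge_in -> opser_exp f p v \in charge_in.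
Proof.
move=> fM p v vM; apply: rpred_sum => r _; apply: rpredZ.
move: (nat_of_ord r) => k {r}.
elim: k p v vM => [|k IHk] p v vM; first by case: p => [|p] //=; apply: rpred0.
by apply: rpred_sum => i _; apply/fM/IHk.
Qed.

Lemma Yexp_charge a k v : M a -> v \in charge_in -> Yexp a k v \in charge_in.
Proof.
move=> aM; apply: fock_lift_charge => b bM; apply/rpredZ/rpred_sum => pq _.
have abM : << (b.1, a + b.2) : fock_index n >> \in charge_in.
  by apply/charge_inU/sm_memD.
apply: opser_exp_charge => [[|p] w wM|]; rewrite ?rpred0 //.
  by rewrite rpredZ ?lheis_charge.
apply: opser_exp_charge => // [[|p] w wM]; rewrite ?rpred0 //.
by rewrite rpredN rpredZ ?lheis_charge.
Qed.

Lemma Ybasis_charge (b : fock_index n) k v :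
  M b.2 -> v \in charge_in -> Ybasis b k v \in charge_in.
Proof.
move=> bM; rewrite /Ybasis.
elim: (enum_mset b.1) k v => [|ip s IHs] k v vM /=; first exact: Yexp_charge.
by apply: rpredD; apply: rpred_sum => j _;
   rewrite ?rpredZ ?heis_charge ?IHs // rpredZ ?heis_charge.
Qed.

Fact Yfock_charge v k w :
  v \in charge_in -> w \in charge_in -> Yfock v k w \in charge_in.
Proof.
move=> /allP vM wM; rewrite /Yfock big_seq; apply: rpred_sum => b bv.
by apply/rpredZ/Ybasis_charge => //; apply/asboolP/vM.
Qed.

Fact fock_vac_charge : fock_vac \in charge_in.
Proof. by apply/charge_inU/sm_mem0. Qed.

Fact fock_conf_charge : fock_conf \in charge_in.
Proof.
by apply/rpredZ/rpred_sum => i _; do 2!apply/heis_charge; apply: fock_vac_charge.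
Qed.

Definition sub_voa : voa_data C :=
  @VoaData C fock_on
    (fun v k w => FockOn (Yfock_charge k (fock_valP v) (fock_valP w)))
    (FockOn fock_vac_charge) (FockOn fock_conf_charge).

End SubVOA.

End LatticeVOA.

(* Main.v *)
Require Import Defs.
From HB Require Import structures.
From mathcomp Require Import all_boot all_order all_algebra.
From mathcomp Require Import finmap multiset monalg complex.
From mathcomp Require Import boolp classical_sets functions fsbigop reals.
From mathcomp Require Import zify ring lra.

Set Implicit Arguments.
Unset Strict Implicit.
Unset Printing Implicit Defensive.

Import Order.TTheory GRing.Theory Num.Theory.

Local Open Scope classical_set_scope.
Local Open Scope ring_scope.

(** Write height a = (g|a).  It is additive, and nonnegative on P.  Hence the sum
    V_+ of the M(1, a) with a in P of positive height is an ideal of V_P.  It does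
    not contain the vacuum, whose height is 0.  It is not zero: g is not orthogonal
    to all of L, and for every a one of a and -a lies in the Borel submonoid, so
    some a0 in P has positive height, and e^a0 lies in V_+.  So V_P is not simple.

    As for rationality, V_P graded by the weight is an admissible module over
    itself.  Suppose that it is a direct sum of irreducible admissible modules N_i.
    The intersection of N_i with V_+ is a submodule, and it is graded whatever the
    grading of N_i is: if h denotes the state g(-1) 1, of weight 1, then h_0 acts on
    M(1, a) as the scalar height a, so that V_+ consists of the vectors killed by
    some product of operators h_0 - c with c > 0 ([upper_kill], [kill_upper]); and
    these operators preserve every degree of N_i.  By irreducibility each N_i is
    contained in V_+ or meets it in 0.  Now decompose the vacuum along the N_i and
    apply the mode of index -1 of e^a0, which sends the vacuum to e^a0 and V_P into
    V_+.  It kills the components in the N_i of the second kind.  Hence e^a0 is the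
    image of the sum X of the other components.  But X lies in V_+, so that its image
    only involves heights greater than height a0: a contradiction
    ([VP_not_rational]).

    That V_P is a module over itself amounts to the Jacobi identity for lattice
    vertex operators.  It is derived from locality: the commutator of two fields is
    killed by a power of z - w.  For local fields the identity of Borcherds holds
    with the products A_(l) B of fields in place of the states a_l b
    ([borcherds]); the two agree ([associativity]) because a translation covariant
    field that is local with all the Y(c, z) and creates 0 from the vacuum is 0
    ([goddard]), and because products of pairwise local fields are local ([dong]).
    Since the field of a basis vector is an iterated product of Heisenberg fields
    and one Y(e^a, z) ([nop_nprod]), the Jacobi identity only needs the locality of
    these generators and the translation covariance of Y(e^a, z).

    Both come from a uniqueness principle ([heis_unique]): families of operators
    that commute with the modes of the Heisenberg fields up to other members, and
    have no matrix coefficient between highest weight vectors e^c, vanish. This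
    leaves the coefficients of Y(e^a, z) Y(e^b, w) e^c at highest weight vectors.
    Translation covariance gives a two-term recursion for them, whose solution is
    the expansion of (1 - w/z)^(a|b) ([top_prod]); the cocycle makes the
    coefficients of the opposite product the expansion of the same function in the
    other region, and the difference of both expansions is killed by a power of
    z - w ([vexp_loc]). *)

(** * Generalized binomial coefficients *)

Section Binomials.
Variable K : numFieldType.
Implicit Types (x : int) (j : nat).

Lemma binz0r x : binz K x 0 = 1.
Proof. by rewrite /binz big_ord0 divr1. Qed.

Lemma binzSr x j : j.+1%:R * binz K x j.+1 = (x - j%:Z)%:~R * binz K x j.
Proof.
rewrite /binz big_ord_recr /= factS natrM invfM.
have jn0 : j.+1%:R != 0 :> K by rewrite pnatr_eq0.
by rewrite [RHS]mulrCA [RHS]mulrA mulrCA; congr (_ * _);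
  rewrite mulrA divff ?mul1r.
Qed.

Lemma binzS x j : binz K (x + 1) j.+1 = binz K x j.+1 + binz K x j.
Proof.
rewrite /binz big_ord_recl [in RHS]big_ord_recr /= factS natrM invfM.
under eq_bigr => i _.
  rewrite (_ : x + 1 - (lift ord0 i)%:Z = x - (i : nat)%:Z);
    last by rewrite lift0 -addn1 PoszD; ring.
  over.
have jn0 : j.+1%:R != 0 :> K by rewrite pnatr_eq0.
have fn0 : j`!%:R != 0 :> K by rewrite pnatr_eq0 -lt0n fact_gt0.
rewrite subr0 intrB !intrD -!pmulrn -natr1 in jn0 *.
by field; rewrite jn0 fn0.
Qed.

Lemma binz0l j : binz K 0 j = (j == 0)%:R.
Proof.
case: j => [|j]; first by rewrite binz0r.
by rewrite /binz big_ord_recl subrr /= mulr0z !mul0r.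
Qed.

Lemma binz_nat (a : nat) j : binz K a%:Z j = 'C(a, j)%:R.
Proof.
elim: a j => [|a IHa] [|j]; rewrite ?binz0r ?binz0l ?bin0 ?bin0n //.
by rewrite -addn1 PoszD binzS !IHa addn1 binS natrD.
Qed.

Lemma binz_opp x j : (-1) ^+ j * binz K x j = binz K (j%:Z - 1 - x) j.
Proof.
elim: j x => [|j IHj] x; first by rewrite !binz0r expr0 mul1r.
have jn0 : j.+1%:R != 0 :> K by rewrite pnatr_eq0.
apply: (mulfI jn0); rewrite mulrCA binzSr binzSr.
have -> : j.+1%:Z - 1 - x = j%:Z - 1 - (x - 1) by lia.
have H : binz K (j%:Z - 1 - (x - 1)) j = (-1) ^+ j * binz K (x - 1) j by rewrite IHj.
rewrite H exprS.
have E : (x - j%:Z)%:~R * binz K x j = x%:~R * binz K (x - 1) j.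
  case: j {IHj jn0 H} => [|j]; first by rewrite !binz0r subr0.
  have jn0 : j.+1%:R != 0 :> K by rewrite pnatr_eq0.
  have -> : binz K x j.+1 = binz K (x - 1) j.+1 + binz K (x - 1) j.
    by rewrite -binzS subrK.
  have := binzSr (x - 1) j; rewrite !intrB -!pmulrn -natr1 => H.
  apply/eqP; rewrite -subr_eq0; apply/eqP.
  transitivity ((x%:~R - 1 - j%:R) * binz K (x - 1) j
                - (j%:R + 1) * binz K (x - 1) j.+1); first by ring.
  by rewrite -H subrr.
rewrite -mulrA mulrCA E; rewrite !intrB -!pmulrn; ring.
Qed.

Lemma binz_oppC x j : binz K x j = (-1) ^+ j * binz K (j%:Z - 1 - x) j.
Proof. by rewrite -binz_opp mulrA -exprMn mulrNN mulr1 expr1n mul1r. Qed.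

End Binomials.

(** * Sums of eventually vanishing sequences *)
Section InfiniteSums.
Variables (K : numFieldType) (V : lmodType K).
Implicit Types (F G : nat -> V) (f : V -> V).

Lemma linD f u v : linear f -> f (u + v) = f u + f v.
Proof. by move=> fl; rewrite -[u]scale1r fl !scale1r. Qed.
Lemma lin0 f : linear f -> f 0 = 0.
Proof. by move=> fl; apply: (addrI (f 0)); rewrite -linD // !addr0. Qed.
Lemma linZ f c v : linear f -> f (c *: v) = c *: f v.
Proof. by move=> fl; rewrite -[c *: v]addr0 fl lin0 // addr0. Qed.
Lemma linN f v : linear f -> f (- v) = - f v.
Proof. by move=> fl; rewrite -!scaleN1r linZ. Qed.
Lemma linB f u v : linear f -> f (u - v) = f u - f v.
Proof. by move=> fl; rewrite linD // linN. Qed.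
Lemma lin_sum f I (r : seq I) P (F : I -> V) : linear f ->
  f (\sum_(i <- r | P i) F i) = \sum_(i <- r | P i) f (F i).
Proof. by move=> fl; apply: big_morph => [x y|]; rewrite ?linD ?lin0. Qed.

Lemma lin_comp f g : linear f -> linear g -> linear (fun v : V => f (g v)).
Proof. by move=> fl gl c u v; rewrite gl fl. Qed.
Lemma lin_add f g : linear f -> linear g -> linear (fun v : V => f v + g v).
Proof. by move=> fl gl c u v; rewrite gl fl scalerDr addrACA. Qed.
Lemma lin_scale f c : linear f -> linear (fun v : V => c *: f v).
Proof. by move=> fl d u v; rewrite fl scalerDr !scalerA mulrC. Qed.
Lemma lin_opp f : linear f -> linear (fun v : V => - f v).
Proof. by move=> fl d u v; rewrite fl opprD scalerN. Qed.
Lemma lin_bigsum I (r : seq I) P (f : I -> V -> V) :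
  (forall i, linear (f i)) -> linear (fun v : V => \sum_(i <- r | P i) f i v).
Proof.
move=> fl d u v; rewrite scaler_sumr -big_split /=.
by apply: eq_bigr => i _; apply: fl.
Qed.

Definition nsum F : V := \sum_(j \in [set: nat]) F j.

Definition evz F : Prop := exists N, forall j, (N <= j)%N -> F j = 0.

Lemma nsumE N F : (forall j, (N <= j)%N -> F j = 0) ->
  nsum F = \sum_(j < N) F j.
Proof.
move=> FN; rewrite /nsum fsbig_ord; apply/esym/fsbig_widen => //= j [_ /=].
by move=> /negP; rewrite -leqNgt => /FN.
Qed.

Lemma eq_nsum F G : (forall j, F j = G j) -> nsum F = nsum G.
Proof. by move=> /funext ->. Qed.

Lemma nsum0 F : (forall j, F j = 0) -> nsum F = 0.
Proof. by move=> F0; rewrite (@nsumE 0) ?big_ord0. Qed.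

Lemma evzD F G : evz F -> evz G -> evz (fun j => F j + G j).
Proof.
move=> [M FM] [N GN]; exists (maxn M N) => j; rewrite geq_max => /andP[jM jN].
by rewrite FM ?GN ?addr0.
Qed.

Lemma evzN F : evz F -> evz (fun j => - F j).
Proof. by move=> [M FM]; exists M => j /FM ->; rewrite oppr0. Qed.

Lemma evzZ (c : nat -> K) F : evz F -> evz (fun j => c j *: F j).
Proof. by move=> [M FM]; exists M => j /FM ->; rewrite scaler0. Qed.

Lemma evz_lin f F : linear f -> evz F -> evz (fun j => f (F j)).
Proof. by move=> fl [M FM]; exists M => j /FM ->; rewrite lin0. Qed.

Lemma evzS F : evz F -> evz (fun j => F j.+1).
Proof. by move=> [M FM]; exists M => j jM; rewrite FM // ltnW. Qed.

Lemma nsumD F G : evz F -> evz G ->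
  nsum (fun j => F j + G j) = nsum F + nsum G.
Proof.
move=> [M FM] [N GN]; rewrite !(@nsumE (maxn M N)) ?big_split // => j.
- by rewrite geq_max => /andP[_]; apply: GN.
- by rewrite geq_max => /andP[+ _]; apply: FM.
- by rewrite geq_max => /andP[jM jN]; rewrite FM ?GN ?addr0.
Qed.

Lemma nsum_lin f F : linear f -> evz F -> f (nsum F) = nsum (fun j => f (F j)).
Proof.
move=> fl [M FM]; rewrite !(@nsumE M) ?lin_sum // => j /FM -> ; exact: lin0.
Qed.

Lemma nsumN F : evz F -> nsum (fun j => - F j) = - nsum F.
Proof.
by move=> [M FM]; rewrite !(@nsumE M) ?sumrN // => j /FM ->; rewrite oppr0.
Qed.

Lemma nsumB F G : evz F -> evz G ->
  nsum (fun j => F j - G j) = nsum F - nsum G.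
Proof. by move=> Fz Gz; rewrite nsumD ?nsumN //; apply: evzN. Qed.

Lemma nsumZ c F : evz F -> nsum (fun j => c *: F j) = c *: nsum F.
Proof.
move=> [M FM]; rewrite !(@nsumE M) ?scaler_sumr // => j /FM ->.
exact: scaler0.
Qed.

Lemma nsum_recl F : evz F -> nsum F = F 0 + nsum (fun j => F j.+1).
Proof.
move=> [M FM]; rewrite (@nsumE M.+1) ?(@nsumE M (fun j => F j.+1)).
- by rewrite big_ord_recl.
- by move=> j jM; rewrite FM // ltnW.
- by move=> j jM; rewrite FM // ltnW.
Qed.

Lemma nsum_shift k F : evz F ->
  nsum (fun j => if (k <= j)%N then F (j - k)%N else 0) = nsum F.
Proof.
move=> [M FM]; rewrite (@nsumE M F) // (@nsumE (k + M)).
  rewrite big_split_ord /= big1 ?add0r => [|i _]; last by rewrite leqNgt ltn_ord.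
  by apply: eq_bigr => i _; rewrite leq_addr addKn.
by move=> j jM; rewrite FM ?if_same //; lia.
Qed.

(** The expansion of (z - w)^l in the region |z| > |w|, applied to a sequence
    of coefficients. *)
Definition binsum (l : int) F := nsum (fun j => ((-1) ^+ j * binz K l j) *: F j).

(** Pascal's rule, that is, (z - w)^(l+1) = (z - w)^l (z - w). *)
Lemma binsumS l F : evz F -> binsum (l + 1) F = binsum l F - binsum l (fun j => F j.+1).
Proof.
move=> Fz; rewrite /binsum !(@nsum_recl (fun j => (_ * _) *: F j)); try exact: evzZ.
rewrite !binz0r -addrA; congr (_ + _); rewrite -nsumB; try exact/evzZ/evzS.
apply: eq_nsum => j.
by rewrite binzS exprS mulrDr scalerDl !mulN1r !mulNr !scaleNr.
Qed.

Lemma binsum0 F : evz F -> binsum 0 F = F 0.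
Proof.
move=> Fz; rewrite /binsum nsum_recl ?nsum0 //; last exact: evzZ.
  by rewrite binz0l mulr1 scale1r addr0.
by move=> j; rewrite binz0l mulr0 scale0r.
Qed.

Lemma binsumB l F G : evz F -> evz G ->
  binsum l (fun j => F j - G j) = binsum l F - binsum l G.
Proof.
move=> Fz Gz; rewrite /binsum -nsumB; try exact: evzZ.
by apply: eq_nsum => j; rewrite scalerBr.
Qed.

Lemma binsumD l F G : evz F -> evz G ->
  binsum l (fun j => F j + G j) = binsum l F + binsum l G.
Proof.
move=> Fz Gz; rewrite /binsum -nsumD; try exact: evzZ.
by apply: eq_nsum => j; rewrite scalerDr.
Qed.

Lemma binsum_lin l f F : linear f -> evz F -> f (binsum l F) = binsum l (fun j => f (F j)).
Proof.
move=> fl Fz; rewrite /binsum nsum_lin //; last exact: evzZ.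
by apply: eq_nsum => j; rewrite linZ.
Qed.

Lemma eq_binsum l F G : (forall j, F j = G j) -> binsum l F = binsum l G.
Proof. by move=> /funext ->. Qed.

End InfiniteSums.

(** * Products of fields, locality and the identity of Borcherds *)
Section Fields.
Variables (K : numFieldType) (V : lmodType K).
Implicit Types (A B C : opfield V) (l m n : int) (v : V).

Definition field A : Prop :=
  (forall n, linear (A n)) /\
  (forall v, exists N : int, forall n, N <= n -> A n v = 0).

Lemma field_evz A B (f : nat -> int) n v : field A -> field B ->
  evz (fun j => A (f j) (B (n + j%:Z) v)).
Proof.
move=> [Al _] [_ /(_ v)[N BN]]; exists `|N - n|%N => j jN.
by rewrite BN ?lin0 //; lia.
Qed.

(** [bor A B l m n] is the coefficient of z^(-m-1) w^(-n-1) in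
    (z - w)^l A(z) B(w) - (z - w)^l B(w) A(z), where (z - w)^l is expanded for
    |z| > |w| in the first term and for |w| > |z| in the second one; [halfbor] is
    the first term. *)
Definition halfbor A B l m n v :=
  binsum l (fun j => A (m + l - j%:Z) (B (n + j%:Z) v)).

Definition bor A B l m n v :=
  halfbor A B l m n v - (-1) ^ l *: halfbor B A l n m v.

(** The residue product A_(l) B; it will be the field of the state a_l b. *)
Definition nprod A B l : opfield V := fun n v => bor A B l 0 n v.

Lemma halfborS A B l m n v : field A -> field B ->
  halfbor A B (l + 1) m n v = halfbor A B l (m + 1) n v - halfbor A B l m (n + 1) v.
Proof.
move=> fA fB; rewrite /halfbor binsumS; last by apply field_evz.
by congr (_ - _); apply: eq_binsum => j; congr (A _ (B _ v)); lia.
Qed.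

Lemma signS l : (-1) ^ (l + 1) = - (-1) ^ l :> K.
Proof. by rewrite expfzDr ?oppr_eq0 ?oner_eq0 // expr1z mulrN1. Qed.

Lemma signM l : (-1) ^ l * (-1) ^ l = 1 :> K.
Proof. by rewrite -expfzMl mulrNN mulr1 exp1rz. Qed.

(** The additional factor z - w shifts either index. *)
Lemma borS A B l m n v : field A -> field B ->
  bor A B (l + 1) m n v = bor A B l (m + 1) n v - bor A B l m (n + 1) v.
Proof.
move=> fA fB; rewrite /bor !halfborS // signS scaleNr opprK scalerBr opprB.
by rewrite addrACA [RHS]addrACA [X in _ + X]addrC.
Qed.

Lemma bor0 A B m n v : field A -> field B ->
  bor A B 0 m n v = A m (B n v) - B n (A m v).
Proof.
move=> fA fB; rewrite /bor /halfbor !binsum0; try (by apply field_evz).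
by rewrite expr0z scale1r !(addr0, subr0).
Qed.

Lemma bor_sym A B l m n v : bor B A l n m v = - (-1) ^ l *: bor A B l m n v.
Proof.
by rewrite /bor scalerBr !scaleNr scalerA signM scale1r opprK addrC.
Qed.

Lemma borE A B l m n v : field A -> field B ->
  \sum_(j \in [set: nat]) ((-1) ^+ j * binz K l j) *:
     (A (m + l - j%:Z) (B (n + j%:Z) v)
      - (-1) ^ l *: B (n + l - j%:Z) (A (m + j%:Z) v)) = bor A B l m n v.
Proof.
move=> fA fB; rewrite -/(nsum _) -/(binsum _ _) binsumB; last first.
- by apply: (evzZ (fun=> _)); apply field_evz.
- by apply field_evz.
congr (_ - _); rewrite /halfbor binsum_lin //; last by apply field_evz.
by apply: (@lin_scale _ _ id).
Qed.

Lemma halfbor_linear A B l m n : field A -> field B ->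
  linear (halfbor A B l m n).
Proof.
move=> fA fB c u v; rewrite /halfbor.
rewrite [in RHS]/binsum -nsumZ; last by apply: evzZ; apply field_evz.
rewrite -nsumD; first last.
- by apply: evzZ; apply field_evz.
- by apply: (evzZ (fun=> _)); apply: evzZ; apply field_evz.
apply: eq_nsum => j.
by rewrite (proj1 fB) (proj1 fA) scalerDr !scalerA mulrC.
Qed.

Lemma bor_linear A B l m n : field A -> field B -> linear (bor A B l m n).
Proof.
move=> fA fB; apply: lin_add; first exact: halfbor_linear.
by apply/lin_opp/lin_scale; apply: halfbor_linear.
Qed.

(** For each of the finitely many j with A_j v <> 0, the vector A_j v is killed
    by the high modes of B; this bounds the second half uniformly in j. *)
Lemma nprod_field A B l : field A -> field B -> field (nprod A B l).
Proof.
move=> fA fB; split=> [n|v]; first exact: bor_linear.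
have [[Al /(_ v)[NA A0]] [Bl /(_ v)[NB B0]]] := (fA, fB).
have bnd : forall k, exists N : int, forall j, (j < k)%N -> forall n, N <= n ->
    B (n + l - j%:Z) (A (0 + j%:Z) v) = 0.
  elim=> [|k [N BN]]; first by exists 0.
  have [M BM] := proj2 fB (A (0 + k%:Z) v).
  exists (Num.max N (M - l + k%:Z)) => j + n; rewrite ge_max => jk /andP[nN nM].
  move: jk; rewrite ltnS leq_eqVlt => /orP[/eqP->|jk]; first by apply: BM; lia.
  exact: BN.
have [N BN] := bnd `|NA|%N.
exists (Num.max N NB) => n; rewrite ge_max => /andP[nN nM].
rewrite /nprod /bor /halfbor /binsum !nsum0 ?scaler0 ?subr0 // => j.
  have [jA|jA] := ltnP j `|NA|%N; first by rewrite BN // scaler0.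
  by rewrite A0 ?(lin0 (Bl _)) ?scaler0 //; lia.
by rewrite B0 ?(lin0 (Al _)) ?scaler0 //; lia.
Qed.

Lemma lincomb_field c A B : field A -> field B ->
  field (fun n v => c *: A n v + B n v).
Proof.
move=> [Al At] [Bl Bt]; split=> [n|v].
  by apply: lin_add => //; apply: lin_scale.
have [[N AN] [M BM]] := (At v, Bt v); exists (Num.max N M) => n.
by rewrite ge_max => /andP[nN nM]; rewrite AN ?BM // scaler0 addr0.
Qed.

Lemma bor_lincomb c A B C l m n v : field A -> field B -> field C ->
  bor (fun n v => c *: A n v + B n v) C l m n v =
  c *: bor A C l m n v + bor B C l m n v.
Proof.
move=> fA fB fC; rewrite /bor /halfbor.
pose F (D E : opfield V) m n j := D (m + l - j%:Z) (E (n + j%:Z) v).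
have H G1 G2 : evz G1 -> evz G2 ->
    binsum l (fun j => c *: G1 j + G2 j) = c *: binsum l G1 + binsum l G2 :> V.
  move=> e1 e2; rewrite binsumD //; last exact: (evzZ (fun=> _)).
  by rewrite [c *: _ in RHS](@binsum_lin _ _ l (fun v => c *: v)) //;
    apply: (@lin_scale _ _ id).
rewrite (H (F A C m n) (F B C m n)); try (by apply field_evz).
rewrite (@eq_binsum _ _ l (fun j => C (n + l - j%:Z) _)
  (fun j => c *: F C A n m j + F C B n m j)); last first.
  by move=> j; rewrite (proj1 fC).
rewrite H; try (by apply field_evz).
rewrite !scalerDr opprD addrACA; congr (_ + _).
by rewrite scalerN !scalerA mulrC.
Qed.

(** Locality: (z - w)^N [A(z), B(w)] = 0 for some N. *)
Definition loc A B : Prop :=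
  exists N : nat, forall m n v, bor A B N%:Z m n v = 0.

Lemma loc_ge A B : field A -> field B -> loc A B ->
  exists N : nat, forall l, N%:Z <= l -> forall m n v, bor A B l m n v = 0.
Proof.
move=> fA fB [N N0]; exists N => l Nl.
have -> : l = N%:Z + `|l - N%:Z|%N%:Z by lia.
elim: `|_|%N => [|k IHk] m n v; first by rewrite addr0.
by rewrite -addn1 PoszD addrA borS // !IHk subrr.
Qed.

Lemma loc_sym A B : loc A B -> loc B A.
Proof. by case=> N N0; exists N => m n v; rewrite bor_sym N0 scaler0. Qed.

Lemma loc_lincomb c A B C : field A -> field B -> field C ->
  loc A C -> loc B C -> loc (fun n v => c *: A n v + B n v) C.
Proof.
move=> fA fB fC /(loc_ge fA fC)[M M0] /(loc_ge fB fC)[N N0].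
exists (maxn M N) => m n v; rewrite bor_lincomb // M0 ?N0 ?scaler0 ?addr0 //.
- by rewrite lez_nat leq_maxr.
- by rewrite lez_nat leq_maxl.
Qed.

(** Both sides, as functions of (l, m, n), satisfy the recursion
    S(p, q + 1, r) = S(p, q, r + 1) + S(p + 1, q, r): on the left it is Pascal's
    rule.  They agree for q = 0, by the definition of the products, and by locality
    both vanish for p large.  The recursion propagates the equality from q = 0 to
    q > 0, and from large p to all p when q < 0. *)
Lemma borcherds A B l m n v : field A -> field B -> loc A B ->
  \sum_(j \in [set: nat]) binz K m j *: nprod A B (l + j%:Z) (m + n - j%:Z) v
  = bor A B l m n v.
Proof.
move=> fA fB /(loc_ge fA fB)[N N0]; rewrite -/(nsum _).
pose G p q := nprod A B p q v.
have Gz p (f : nat -> int) : evz (fun j => G (p + j%:Z) (f j)).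
  by exists `|N%:Z - p|%N => j jN; apply: N0; lia.
pose S p q r := nsum (fun j => binz K q j *: G (p + j%:Z) (q + r - j%:Z)).
have SS p q r : S p (q + 1) r = S p q (r + 1) + S (p + 1) q r.
  pose F1 j := binz K (q + 1) j *: G (p + j%:Z) (q + 1 + r - j%:Z).
  pose F2 j := binz K q j *: G (p + j%:Z) (q + (r + 1) - j%:Z).
  pose F3 j := binz K q j *: G (p + 1 + j%:Z) (q + r - j%:Z).
  have [z1 z2 z3] : [/\ evz F1, evz F2 & evz F3].
    by split; apply: evzZ; apply: Gz.
  rewrite -[LHS]/(nsum F1) -[RHS]/(nsum F2 + nsum F3).
  rewrite (nsum_recl z1) (nsum_recl z2) -addrA -nsumD //; last exact: evzS.
  congr (_ + _).
    by rewrite /F1 /F2 !binz0r; congr (_ *: G _ _); lia.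
  apply: eq_nsum => j; rewrite /F1 /F2 /F3 binzS scalerDl.
  by congr (_ *: G _ _ + _ *: G _ _); lia.
pose D p q r := S p q r - bor A B p q r v.
have DS p q r : D p (q + 1) r = D p q (r + 1) + D (p + 1) q r.
  by rewrite /D SS (borS p _ _ _ fA fB) [- (bor A B p _ r v - _)]opprB [RHS]addrACA addKr.
have D0 p r : D p 0 r = 0.
  rewrite /D /S nsum_recl ?nsum0; last exact: evzZ.
    by rewrite binz0r scale1r addr0 add0r !(addr0, subr0) subrr.
  by move=> j; rewrite binz0l scale0r.
have DN p q r : N%:Z <= p -> D p q r = 0.
  move=> pN; rewrite /D N0 // subr0 /S nsum0 // => j.
  by rewrite /G /nprod N0 ?scaler0 //; lia.
suff D00 p q r : D p q r = 0 by apply/eqP; rewrite -subr_eq0; apply/eqP/D00.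
have [q0|q0] := leP 0 q.
  have -> : q = `|q|%N%:Z by lia.
  elim: `|q|%N p r => [|k IHk] p r; first exact: D0.
  by rewrite -addn1 PoszD DS !IHk addr0.
have -> : q = - `|q|%N%:Z by lia.
elim: `|q|%N p r => [|k IHk] p r; first exact: D0.
have [pN|pN] := leP N%:Z p; first exact: DN.
have -> : p = N%:Z - `|N%:Z - p|%N%:Z by lia.
elim: `|N%:Z - p|%N r => [|d IHd] r; first by apply: DN; lia.
have := DS (N%:Z - d.+1%:Z) (- k.+1%:Z) (r - 1).
rewrite (_ : - k.+1%:Z + 1 = - k%:Z); last by lia.
rewrite (_ : N%:Z - d.+1%:Z + 1 = N%:Z - d%:Z); last by lia.
by rewrite IHk IHd subrK addr0.
Qed.

(** * The lemma of Dong *)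
Section Iterates.
Variable W : zmodType.

Lemma iterB (S : W -> W) : {morph S : x y / x - y} ->
  forall N, {morph iter N S : x y / x - y}.
Proof. by move=> SB; elim=> [|N IHN] x y //=; rewrite IHN SB. Qed.

Lemma iter_comm (S T : W -> W) : (forall x, S (T x) = T (S x)) ->
  forall M N x, iter M S (iter N T x) = iter N T (iter M S x).
Proof.
move=> ST; have S1 N x : S (iter N T x) = iter N T (S x).
  by elim: N => //= N IHN; rewrite ST IHN.
by elim=> [|M IHM] N x //=; rewrite IHM S1.
Qed.

(** The binomial expansion of (S - T)^(M + N) for commuting S and T: each term
    contains S^M or T^N. *)
Lemma iter_sub_eq0 (S T D : W -> W) :
  {morph S : x y / x - y} -> {morph T : x y / x - y} ->
  {morph D : x y / x - y} -> (forall x, S (T x) = T (S x)) ->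
  (forall x, D x = S x - T x) ->
  forall M N x, iter M S x = 0 -> iter N T x = 0 -> iter (M + N) D x = 0.
Proof.
move=> SB TB DB ST DE M N x.
have T0 : T 0 = 0 by rewrite -{1}(subrr 0) TB subrr.
have S0 : S 0 = 0 by rewrite -{1}(subrr 0) SB subrr.
have D0 : D 0 = 0 by rewrite -{1}(subrr 0) DB subrr.
have i0 k : iter k D 0 = 0 by elim: k => //= k ->.
have [k] := ubnP (M + N); elim: k M N x => // k IHk [|M] [|N] x kMN.
- by move=> /= ->.
- by move=> /= ->; rewrite i0 D0.
- by move=> _ /= ->; rewrite addn0 i0 D0.
rewrite iterSr => MS; rewrite iterSr => NT; rewrite addSn iterSr DE iterB //.
rewrite (IHk M N.+1) //; last first.
  by rewrite -[S x]/(iter 1 S x) -(iter_comm ST 1 N.+1 x) (iterSr N) NT.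
rewrite sub0r addnS -addSn (IHk M.+1 N) ?oppr0 //; first by lia.
by rewrite -[T x]/(iter 1 T x) (iter_comm ST M.+1 1 x) (iterSr M) MS.
Qed.

End Iterates.

(** Multiplication by z - w, on functions of the indices (m, n). *)
Definition dlt (f : int -> int -> V) : int -> int -> V :=
  fun m n => f (m + 1) n - f m (n + 1).

Lemma bor_iter A B N m n v : field A -> field B ->
  bor A B N%:Z m n v = iter N dlt (fun m n => A m (B n v) - B n (A m v)) m n.
Proof.
move=> fA fB; elim: N m n => [|N IHN] m n; first by rewrite bor0.
by rewrite -addn1 PoszD borS // !IHN addn1.
Qed.

(** The factor (z - w)^2 suffices for a commutator which is a multiple of the
    derivative of the delta function. *)
Lemma loc_central A B (g : int -> int -> K) : field A -> field B ->
  (forall m n v, A m (B n v) - B n (A m v) = g m n *: v) ->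
  (forall m n, g (m + 1 + 1) n - g (m + 1) (n + 1)
     - (g (m + 1) (n + 1) - g m (n + 1 + 1)) = 0) -> loc A B.
Proof.
move=> fA fB AB g0; exists 2%N => m n v; rewrite bor_iter // /= /dlt !AB.
by rewrite -!scalerBl g0 scale0r.
Qed.

(* A formal series in z, w, x is given by its coefficients; [zx], [wx] and [zw]
   multiply it by z - x, w - x and z - w, and [Th l] by the expansion of (z - w)^l
   in the region |z| > |w|, which requires the truncation [tame]. *)
Let W : zmodType := int -> int -> int -> V.
Implicit Types f g : W.
Let zx f : W := fun m n r => f (m + 1) n r - f m n (r + 1).
Let wx f : W := fun m n r => f m (n + 1) r - f m n (r + 1).
Let zw f : W := fun m n r => f (m + 1) n r - f m (n + 1) r.
Let swap f : W := fun m n r => f n m r.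
Let Th l f : W := fun m n r => binsum l (fun j => f (m + l - j%:Z) (n + j%:Z) r).
Let tame f := forall r, exists M : int, forall m n, M <= n -> f m n r = 0.

Lemma coef3_ext f g : (forall m n r, f m n r = g m n r) -> f = g.
Proof. by move=> fg; do 3!apply: funext => ?. Qed.

Let zxB : {morph zx : f g / f - g}.
Proof. by move=> f g; apply: coef3_ext => m n r; rewrite /zx /= !opprD addrACA. Qed.
Let wxB : {morph wx : f g / f - g}.
Proof. by move=> f g; apply: coef3_ext => m n r; rewrite /wx /= !opprD addrACA. Qed.
Let zwB : {morph zw : f g / f - g}.
Proof. by move=> f g; apply: coef3_ext => m n r; rewrite /zw /= !opprD addrACA. Qed.
Let subACA (a b c d : V) : a - b - (c - d) = a - c - (b - d).
Proof. by rewrite !opprB addrACA [RHS]addrACA [- b - c]addrC. Qed.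
Let zxzw f : zx (zw f) = zw (zx f).
Proof.
by apply: coef3_ext => m n r; rewrite /zx /zw subACA.
Qed.
Let wxzw f : wx (zw f) = zw (wx f).
Proof.
by apply: coef3_ext => m n r; rewrite /wx /zw subACA.
Qed.
Let zxwx f : zx (wx f) = wx (zx f).
Proof.
by apply: coef3_ext => m n r; rewrite /wx /zx subACA.
Qed.
Let wxE f : wx f = zx f - zw f.
Proof.
by apply: coef3_ext => m n r; rewrite /wx /zx /zw /= opprB [RHS]addrC addrA subrK.
Qed.

Let evz_tame l f m n r : tame f ->
  evz (fun j => f (m + l - j%:Z) (n + j%:Z) r).
Proof.
by move=> /(_ r)[M fM]; exists `|M - n|%N => j jM; apply: fM; lia.
Qed.

Let tame_zx f : tame f -> tame (zx f).
Proof.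
move=> ft r; have [[M fM] [N fN]] := (ft r, ft (r + 1)).
exists (Num.max M N) => m n; rewrite ge_max => /andP[nM nN].
by rewrite /zx fM ?fN ?subr0.
Qed.
Let tame_wx f : tame f -> tame (wx f).
Proof.
move=> ft r; have [[M fM] [N fN]] := (ft r, ft (r + 1)).
exists (Num.max M N) => m n; rewrite ge_max => /andP[nM nN].
by rewrite /wx fM ?fN ?subr0 //; lia.
Qed.
Let Th_zx l f : tame f -> zx (Th l f) = Th l (zx f).
Proof.
move=> ft; apply: coef3_ext => m n r; rewrite /zx /Th -binsumB; try exact: evz_tame.
by apply: eq_binsum => j; congr (f _ _ _ - _); lia.
Qed.
Let Th_wx l f : tame f -> wx (Th l f) = Th l (wx f).
Proof.
move=> ft; apply: coef3_ext => m n r; rewrite /wx /Th -binsumB; try exact: evz_tame.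
by apply: eq_binsum => j; congr (f _ _ _ - _); lia.
Qed.
Let Th_iter l f M N : tame f ->
  iter M zx (iter N wx (Th l f)) = Th l (iter M zx (iter N wx f)).
Proof.
move=> ft; have [-> ft'] : iter N wx (Th l f) = Th l (iter N wx f) /\
    tame (iter N wx f).
  elim: N => //= N [-> ft']; split; [exact: Th_wx | exact: tame_wx].
suff [] : iter M zx (Th l (iter N wx f)) = Th l (iter M zx (iter N wx f)) /\
    tame (iter M zx (iter N wx f)) by [].
elim: M => //= M [-> ft'']; split; [exact: Th_zx | exact: tame_zx].
Qed.

Let iterZ0 S N : {morph S : f g / f - g} -> iter N S (0 : W) = 0.
Proof. by move=> SB; rewrite -{1}(subrr 0) iterB // subrr. Qed.

(* A B C - C A B = A [B, C] + [A, C] B, where (w - x)^Q kills the first commutator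
   and (z - x)^P the second one. *)
Let dong_aux A B C l v (P Q : nat) : field A -> field B -> field C ->
  (forall m n v, bor A C P%:Z m n v = 0) ->
  (forall m n v, bor B C Q%:Z m n v = 0) ->
  iter P zx (iter Q wx (Th l (fun m n r =>
    A m (B n (C r v)) - C r (A m (B n v))))) = 0.
Proof.
move=> fA fB fC AC BC; rewrite Th_iter; last first.
  move=> r; have [N BN] := proj2 fB (C r v); have [M BM] := proj2 fB v.
  exists (Num.max M N) => m n; rewrite ge_max => /andP[nM nN].
  by rewrite BN // BM // !(lin0 (proj1 fA _)) (lin0 (proj1 fC _)) subrr.
rewrite (_ : iter P zx _ = 0); first by
  apply: coef3_ext => m n r; rewrite /Th /binsum nsum0 // => j; rewrite scaler0.
pose f1 : W := fun m n r => A m (B n (C r v) - C r (B n v)).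
pose f2 : W := fun m n r => C r (A m (B n v)) - A m (C r (B n v)).
have -> : (fun m n r => A m (B n (C r v)) - C r (A m (B n v))) = f1 - f2.
  apply: coef3_ext => m n r; rewrite -[RHS]/(f1 m n r - f2 m n r) /f1 /f2 (linB _ _ (proj1 fA _)).
  by rewrite opprB addrA subrK.
have f10 : iter Q wx f1 = 0.
  apply: coef3_ext => m n r; rewrite -[RHS](lin0 (proj1 fA m)) -(BC n r v) bor_iter //.
  elim: Q n r {BC} => [|k IHk] n r //=.
  by rewrite /wx /dlt !IHk (linB _ _ (proj1 fA _)).
have f20 : iter P zx f2 = 0.
  apply: coef3_ext => m n r; rewrite -[RHS]oppr0 -(AC m r (B n v)) bor_iter //.
  elim: P m r {AC} => [|k IHk] m r /=; first by rewrite /f2 opprB.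
  by rewrite /zx /dlt !IHk opprB opprK addrC.
rewrite iterB // f10 sub0r -[- _]sub0r iterB // iterZ0 // iter_comm // f20.
by rewrite iterZ0 // subr0.
Qed.

(** Let y be the commutator of (z - w)^l [A(z), B(w)] with C(x), as a series in the
    three variables.  It is killed by (z - w)^N' and by (z - x)^P (w - x)^Q.  As
    w - x = (z - x) - (z - w), it is also killed by (w - x)^(P + N' + Q); the
    coefficients of z^(-1) then give the statement. *)
Lemma dong A B C l : field A -> field B -> field C ->
  loc A B -> loc A C -> loc B C -> loc (nprod A B l) C.
Proof.
move=> fA fB fC /(loc_ge fA fB)[N AB] [P AC] [Q BC].
pose N' := `|N%:Z - l|%N.
exists (P + N' + Q)%N => m n v.
rewrite bor_iter //; last exact: nprod_field.
pose y l : W := fun m n r => bor A B l m n (C r v) - C r (bor A B l m n v).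
have y0 : iter (P + N' + Q) wx (y l) = 0.
  rewrite iterD; apply: (@iter_sub_eq0 _ zx zw wx) => //.
    pose f (A B : opfield V) : W :=
      fun m n r => A m (B n (C r v)) - C r (A m (B n v)).
    have -> : y l = Th l (f A B) -
        (fun m n r => (- 1) ^ l *: swap (Th l (f B A)) m n r).
      apply: coef3_ext => i j r.
      rewrite -[RHS]/(Th l (f A B) i j r - (-1) ^ l *: Th l (f B A) j i r).
      rewrite /y /Th /f !binsumB; try (by apply field_evz).
      - rewrite /bor /halfbor (linB _ _ (proj1 fC _)).
        rewrite (linZ _ _ (proj1 fC _)).
        rewrite !(binsum_lin _ (proj1 fC r)); try (by apply field_evz).
        by rewrite scalerBr subACA.
      - by apply: evz_lin; [exact: (proj1 fC) | by apply field_evz].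
      - by apply: evz_lin; [exact: (proj1 fC) | by apply field_evz].
    rewrite !iterB // (dong_aux l v fA fB fC AC BC) sub0r.
    suff -> : iter P zx (iter Q wx (fun m n r => (- 1) ^ l *: swap (Th l (f B A)) m n r))
       = fun m n r => (- 1) ^ l *: iter P wx (iter Q zx (Th l (f B A))) n m r.
      rewrite (iter_comm (S := wx)) // (dong_aux l v fB fA fC BC AC).
      apply: coef3_ext => i j r; rewrite -[LHS]/(- ((-1) ^ l *: (0 : V))).
      by rewrite scaler0 oppr0.
    have -> : iter Q wx (fun m n r => (- 1) ^ l *: swap (Th l (f B A)) m n r) =
       fun m n r => (-1) ^ l *: iter Q zx (Th l (f B A)) n m r.
      elim: Q {BC} => //= k ->; apply: coef3_ext => i j r.
      by rewrite /wx /zx scalerBr.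
    elim: P {AC} => //= k ->; apply: coef3_ext => i j r.
    by rewrite /wx /zx scalerBr.
  rewrite -iter_comm // (_ : iter N' zw (y l) = 0) ?iterZ0 //.
  have -> : iter N' zw (y l) = y (l + N'%:Z).
    elim: N' => [|k IHk]; first by rewrite addr0.
    rewrite iterS IHk -addn1 PoszD addrA; apply: coef3_ext => i j r.
    rewrite /y !borS // (linB _ _ (proj1 fC _)).
    by rewrite /zw !opprD addrACA.
  apply: coef3_ext => i j r; have lN : N%:Z <= l + N'%:Z by rewrite /N'; lia.
  by rewrite /y !AB // (lin0 (proj1 fC _)) subrr.
have -> : iter (P + N' + Q) dlt
    (fun m n => nprod A B l m (C n v) - C n (nprod A B l m v)) m n
    = iter (P + N' + Q) wx (y l) 0 m n.
  by elim: (P + N' + Q)%N m n => //= k IHk i j; rewrite /dlt /wx !IHk.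
by rewrite y0.
Qed.

End Fields.

(** * From local fields to the Jacobi identity *)
Section VertexAlgebra.
Variables (K : numFieldType) (V : lmodType K).
Variables (T : V -> V) (one : V).
Hypotheses (Tlin : linear T) (T1 : T one = 0).
Implicit Types (A B C : opfield V) (l m n : int) (v : V).

(** [T, A(z)] = A'(z), where T is the translation operator. *)
Definition covariant A : Prop :=
  forall n v, T (A n v) = A n (T v) - n%:~R *: A (n - 1) v.

(** A(z) 1 has no pole at z = 0; then A_(-1) 1 is its value there. *)
Definition creative A : Prop := forall n, 0 <= n -> A n one = 0.

Definition good A : Prop := [/\ field A, covariant A & creative A].

(** The derivation d/dz + d/dw kills (z - w)^l. *)
Lemma binsum_euler l (F G : nat -> V) : evz F -> evz G ->
  (forall j, G j.+1 = F j) ->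
  binsum l (fun j => (l - j%:Z)%:~R *: F j) + binsum l (fun j => j%:R *: G j) = 0.
Proof.
move=> Fz Gz GF; rewrite /binsum [X in _ + X]nsum_recl; last by do 2!apply: evzZ.
rewrite scale0r scaler0 add0r -nsumD; first last.
- by apply: (evzS (F := fun j => _ *: (_ *: G j))); do 2!apply: evzZ.
- by do 2!apply: evzZ.
apply: nsum0 => j; rewrite GF !scalerA -scalerDl.
rewrite -[_ * j.+1%:R]mulrA [_ * j.+1%:R]mulrC binzSr exprS.
by rewrite [X in X *: _](_ : _ = 0) ?scale0r //; ring.
Qed.

Lemma covariant_half A B l n v (k p : int) : field A -> field B ->
  covariant A -> covariant B ->
  T (halfbor A B l k p v) = halfbor A B l k p (T v)
   - k%:~R *: halfbor A B l (k - 1) p v - p%:~R *: halfbor A B l k (p - 1) v.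
Proof.
move=> fA fB cA cB; rewrite /halfbor (binsum_lin _ Tlin); last by apply field_evz.
pose F j := A (k + l - j%:Z - 1) (B (p + j%:Z) v).
pose G j := A (k + l - j%:Z) (B (p - 1 + j%:Z) v).
pose H j := A (k + l - j%:Z) (B (p + j%:Z) (T v)).
have Fz : evz F by apply (@field_evz _ _ A B (fun j => k + l - j%:Z - 1)).
have [Gz Hz] : evz G /\ evz H by split; apply field_evz.
have GF j : G j.+1 = F j by rewrite /F /G; congr (A _ (B _ v)); lia.
have Zl c : linear (fun v : V => c *: v) by apply: (@lin_scale _ _ id).
have kz : evz (fun j => k%:~R *: F j) by apply: (evz_lin (Zl _)).
have pz : evz (fun j => p%:~R *: G j) by apply: (evz_lin (Zl _)).
transitivity (binsum l (fun j => H j - k%:~R *: F j - p%:~R *: G j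
    - ((l - j%:Z)%:~R *: F j + j%:R *: G j))).
  apply: eq_binsum => j; rewrite cA cB (linB _ _ (proj1 fA _)) (linZ _ _ (proj1 fA _)).
  rewrite (_ : p + j%:Z - 1 = p - 1 + j%:Z); last by lia.
  rewrite -/(F j) -/(G j) -/(H j) -[k + l - _]addrA.
  rewrite [(k + _)%:~R]intrD [(p + _)%:~R]intrD !scalerDl.
  rewrite -!addrA -!opprD; congr (_ - _).
  by rewrite [LHS]addrC [LHS]addrACA -[LHS]addrA.
rewrite binsumB; first last.
- by apply: evzD; exact: evzZ.
- by apply: evzD; [apply: evzD => //|]; apply: evzN.
rewrite [X in _ - X]binsumD; first last.
- exact: evzZ.
- exact: evzZ.
rewrite (binsum_euler l Fz Gz GF) subr0 binsumB //; last by apply: evzD => //; apply: evzN.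
rewrite binsumB // -(binsum_lin _ (Zl _) Fz) -(binsum_lin _ (Zl _) Gz).
congr (_ - _ *: _ - _); apply: eq_binsum => j.
by rewrite /F; congr (A _ _); lia.
Qed.

Lemma covariant_nprod A B l : field A -> field B ->
  covariant A -> covariant B -> covariant (nprod A B l).
Proof.
move=> fA fB cA cB n v; rewrite /nprod /bor (linB _ _ Tlin) (linZ _ _ Tlin).
rewrite !covariant_half //.
rewrite !mulr0z !scale0r !subr0 !scalerBr !scalerA [n%:~R * _]mulrC.
by rewrite !opprB addrACA [RHS]addrACA [- _ - _]addrC.
Qed.

Lemma creative_nprod A B l : field A -> field B ->
  creative A -> creative B -> creative (nprod A B l).
Proof.
move=> [Al _] [Bl _] A1 B1 n n0; rewrite /nprod /bor /halfbor /binsum.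
rewrite !nsum0 ?scaler0 ?subr0 // => j.
  by rewrite A1 ?(lin0 (Bl _)) ?scaler0 //; lia.
by rewrite B1 ?(lin0 (Al _)) ?scaler0 //; lia.
Qed.

Lemma good_nprod A B l : good A -> good B -> good (nprod A B l).
Proof.
move=> [? ? ?] [? ? ?]; split.
- exact: nprod_field.
- exact: covariant_nprod.
- exact: creative_nprod.
Qed.

(** Products of fields correspond to products of the states that they create. *)
Lemma nprod_one A B l : field A -> field B -> creative A -> creative B ->
  nprod A B l (-1) one = A l (B (-1) one).
Proof.
move=> fA [Bl _] A1 B1; rewrite /nprod /bor /halfbor /binsum.
rewrite [X in _ - _ *: X]nsum0 ?scaler0 ?subr0; last first.
  by move=> j; rewrite A1 ?(lin0 (Bl _)) ?scaler0 //; lia.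
rewrite (@nsumE _ _ 1) => [|j j0]; last first.
  by rewrite B1 ?(lin0 (proj1 fA _)) ?scaler0 //; lia.
by rewrite big_ord1 binz0r mulr1 scale1r add0r subr0 addr0.
Qed.

Lemma good_lincomb c A B : good A -> good B ->
  good (fun n v => c *: A n v + B n v).
Proof.
move=> [fA cA A1] [fB cB B1]; split; first exact: lincomb_field.
- move=> n v; rewrite (linD _ _ Tlin) (linZ _ _ Tlin) cA cB scalerBr scalerDr opprD addrACA.
  by rewrite !scalerA mulrC.
- by move=> n n0; rewrite A1 ?B1 // scaler0 addr0.
Qed.

(** A(z) 1 = exp(z T) A_(-1) 1. *)
Lemma covariant_one A : covariant A -> creative A -> A (-1) one = 0 ->
  (forall n, linear (A n)) -> forall n, A n one = 0.
Proof.
move=> cA A1 Am1 Al n; have [n0|n0] := leP 0 n; first exact: A1.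
have -> : n = - 1 - `|- 1%:Z - n|%N%:Z by lia.
elim: `|_|%N => [|k IHk]; first by rewrite subr0.
have := cA (-1 - k%:Z) one; rewrite IHk lin0 // T1 lin0 // sub0r => /esym/eqP.
rewrite oppr_eq0 scaler_eq0 intr_eq0 => /orP[/eqP|/eqP]; first by lia.
by move=> <-; congr (A _ one); lia.
Qed.

(** By covariance A(z) 1 = 0, so that locality gives
    (z - w)^N A(z) Y(v, w) 1 = (z - w)^N Y(v, w) A(z) 1 = 0; at w = 0 this reads
    z^N A(z) v = 0. *)
Lemma goddard (Y : V -> opfield V) A : good A -> A (-1) one = 0 ->
  (forall c, good (Y c)) -> (forall c, Y c (-1) one = c) ->
  (forall c, loc A (Y c)) -> forall n v, A n v = 0.
Proof.
move=> [fA cA A1] Am1 Yg Y1 AY n v.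
have A0 : forall n, A n one = 0 by apply: covariant_one => //; apply: (proj1 fA).
have [N /(_ (n - N%:Z) (-1) one)] := AY v; rewrite /bor.
have [fY _ Yc] := Yg v.
rewrite [X in _ - _ *: X](_ : _ = 0) ?scaler0 ?subr0; last first.
  rewrite /halfbor /binsum nsum0 // => j; rewrite A0 lin0 ?scaler0 //.
  exact: (proj1 fY).
rewrite /halfbor /binsum (@nsumE _ _ 1) => [|j j0]; last first.
  by rewrite Yc ?(lin0 (proj1 fA _)) ?scaler0 //; lia.
by rewrite big_ord1 binz0r mulr1 scale1r !(addr0, subr0) subrK Y1.
Qed.

(** Both sides create a_l b from the vacuum, so [goddard] applies to their
    difference, which is local with every Y(c, z) by [dong]. *)
Lemma associativity (Y : V -> opfield V) :
  (forall n v, linear (fun a => Y a n v)) ->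
  (forall a, good (Y a)) -> (forall a, Y a (-1) one = a) ->
  (forall a b, loc (Y a) (Y b)) ->
  forall a b l n v, Y (Y a l b) n v = nprod (Y a) (Y b) l n v.
Proof.
move=> Yl Yg Y1 YY a b l n v; apply/eqP; rewrite -subr_eq0 addrC -scaleN1r; apply/eqP.
pose D : opfield V := fun n v => -1 *: nprod (Y a) (Y b) l n v + Y (Y a l b) n v.
have [[fa ca a1] [fb cb b1] [fc _ _]] := And3 (Yg a) (Yg b) (Yg (Y a l b)).
have gD : good D by apply: good_lincomb => //; apply: good_nprod.
apply: (goddard (Y := Y) gD) => //.
  by rewrite /D nprod_one // !Y1 scaleN1r addNr.
move=> c; have [fY _ _] := Yg c; apply: loc_lincomb => //; first exact: nprod_field.
exact: dong.
Qed.

Lemma vertex_jacobi (Y : V -> opfield V) :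
  (forall n v, linear (fun a => Y a n v)) ->
  (forall a, good (Y a)) -> (forall a, Y a (-1) one = a) ->
  (forall a b, loc (Y a) (Y b)) ->
  forall (a b : V) (l m n : int) (w : V),
  \sum_(j \in [set: nat])
    binz K m j *: Y (Y a (l + j%:Z) b) (m + n - j%:Z) w =
  \sum_(j \in [set: nat]) ((-1) ^+ j * binz K l j) *:
    (Y a (m + l - j%:Z) (Y b (n + j%:Z) w)
       - (-1) ^ l *: Y b (n + l - j%:Z) (Y a (m + j%:Z) w)).
Proof.
move=> Yl Yg Y1 YY a b l m n w.
have fY c : field (Y c) by case: (Yg c).
transitivity (bor (Y a) (Y b) l m n w); last exact: esym (borE l m n w (fY a) (fY b)).
rewrite -borcherds //; apply: eq_nsum => j.
by rewrite associativity.
Qed.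

End VertexAlgebra.

(** * Exponentials of operator series *)
Section ExpSeries.
Variables (K : numFieldType) (V : lmodType K).
Implicit Types (f : opser V) (v : V).

Lemma opser_pow_linear f : (forall p, linear (f p)) ->
  forall r p, linear (opser_pow f r p).
Proof.
move=> fl; elim=> [|r IHr] p.
  by move=> c u v; case: p => [|p] //=; rewrite scaler0 addr0.
by apply: lin_bigsum => i; apply: (lin_comp (fl i) (IHr _)).
Qed.

Lemma opser_exp_linear f : (forall p, linear (f p)) ->
  forall p, linear (opser_exp f p).
Proof.
by move=> fl p; apply: lin_bigsum => r; apply/lin_scale/opser_pow_linear.
Qed.

Lemma opser_pow_small f : (forall v, f 0%N v = 0) -> (forall p, linear (f p)) ->
  forall r p v, (p < r)%N -> opser_pow f r p v = 0.
Proof.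
move=> f0 fl; elim=> [|r IHr] // p v pr.
rewrite /= /opser_mul big_ord_recl f0 add0r big1 // => i _.
by rewrite IHr ?(lin0 (fl _)) //=; move: (ltn_ord i); rewrite /bump /=; lia.
Qed.

Lemma opser_exp0 f v : opser_exp f 0 v = v.
Proof. by rewrite /opser_exp big_ord1 /= fact0 invr1 scale1r. Qed.

(** If [D, f(z)] = g z^k is central, then [D, exp f(z)] = g z^k exp f(z). *)
Lemma opser_exp_comm f (D : V -> V) (k : nat) (g : K) :
  (forall v, f 0%N v = 0) -> (forall p, linear (f p)) -> linear D -> (0 < k)%N ->
  (forall p v, D (f p v) = f p (D v) + (if p == k then g *: v else 0)) ->
  forall p v, D (opser_exp f p v) =
    opser_exp f p (D v) + (if (k <= p)%N then g *: opser_exp f (p - k)%N v else 0).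
Proof.
move=> f0 fl Dl k0 Df.
have D1 q v : D (opser_one q v) = opser_one q (D v).
  by case: q => [|q] //; apply: lin0.
have Dpow r p v : D (opser_pow f r.+1 p v) = opser_pow f r.+1 p (D v) +
    (if (k <= p)%N then (r.+1%:R * g) *: opser_pow f r (p - k)%N v else 0).
  elim: r p v => [|r IHr] p v.
    rewrite /= /opser_mul (lin_sum _ _ _ Dl).
    under eq_bigr => i _ do rewrite Df.
    rewrite big_split /=; congr (_ + _).
      by apply: eq_bigr => i _; rewrite D1.
    rewrite -big_mkcond /=.
    have [kp|kp] := leqP k p; last first.
      by rewrite big1 // => i /eqP ik; move: (ltn_ord i); rewrite ik; lia.
    have kp' : (k < p.+1)%N by [].
    by rewrite (big_pred1 (Ordinal kp')) ?mul1r.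
  rewrite [opser_pow _ _]/= {1}/opser_mul (lin_sum _ _ _ Dl).
  under eq_bigr => i _ do rewrite Df -[opser_mul f (iter r _ _)]/(opser_pow f r.+1)
     IHr (linD _ _ (fl i)).
  rewrite !big_split /= -addrA; congr (_ + _).
  rewrite -[X in _ + X]big_mkcond /=.
  have [kp|kp] := leqP k p; last first.
    rewrite !big1 ?addr0 // => i; first by move/eqP => ik; move: (ltn_ord i); rewrite ik; lia.
    by case: ifP => // [kpi|]; [move: kpi kp (ltn_ord i); lia | rewrite (lin0 (fl _))].
  have kp' : (k < p.+1)%N by [].
  rewrite [X in _ + X](big_pred1 (Ordinal kp')) //=.
  rewrite -[in RHS](natr1 r.+1) mulrDl mul1r scalerDl; congr (_ + _).
  rewrite -[opser_mul f (iter r _ _)]/(opser_pow f r.+1).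
  rewrite [opser_pow f r.+1 _ _ in RHS]/= /opser_mul scaler_sumr.
  rewrite (big_ord_widen p.+1 (fun i => (r.+1%:R * g) *:
    f i (opser_pow f r (p - k - i)%N v))); last by lia.
  rewrite [RHS]big_mkcond; apply: eq_bigr => i _.
  case: ifP => kpi; case: ifP => ipk; try by move: kpi ipk; lia.
    by rewrite (linZ _ _ (fl i)); congr (_ *: f i (opser_pow _ _ _ _)); lia.
  by rewrite (lin0 (fl _)).
move=> p v; rewrite /opser_exp (lin_sum _ _ _ Dl).
under eq_bigr do rewrite (linZ _ _ Dl).
rewrite big_ord_recl [X in _ = X + _]big_ord_recl -[RHS]addrA; congr (_ + _).
  by rewrite /= D1.
under eq_bigr do rewrite lift0 Dpow scalerDr.
rewrite big_split /=; congr (_ + _).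
have [kp|kp] := leqP k p; last by rewrite big1 // => i _; rewrite scaler0.
rewrite scaler_sumr.
have pk : ((p - k).+1 <= p)%N by lia.
rewrite (big_ord_widen p (fun i => g *: (i`!%:R^-1 *: opser_pow f i (p - k)%N v)) pk).
rewrite [RHS]big_mkcond; apply: eq_bigr => i _; case: ifP => ipk; last first.
  by rewrite opser_pow_small ?scaler0 //; move: ipk; lia.
rewrite !scalerA; congr (_ *: _).
rewrite factS natrM invfM mulrA mulrC; congr (_ * _).
by rewrite mulrAC mulVf ?mul1r // pnatr_eq0.
Qed.

End ExpSeries.

(** * The Fock space and the lattice *)

(** The basis vectors are sealed: they are only used through their coefficients,
    and comparing them in unfolded form is very expensive.  For the same reason the
    operators on the Fock space are sealed below. *)
HB.lock Definition ket (R : realType) (n : nat) (b : fock_index n) : fock R n :=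
  << b >>.

Section FockSpace.
Variables (R : realType) (n : nat).
Local Notation C := (complex R).
Local Notation fock := (fock R n).
Local Notation ket := (@ket R n).
Implicit Types (b : fock_index n) (v w : fock) (a c : 'rV[int]_n).

Lemma fock_sumE (W : lmodType C) (f : fock_index n -> W) (d : {fset fock_index n}) v :
  (msupp v `<=` d)%fset ->
  \sum_(b <- msupp v) v@_b *: f b = \sum_(b <- d) v@_b *: f b.
Proof.
move=> vd; apply: big_fset_incl => // b _ bv.
by rewrite mcoeff_outdom // scale0r.
Qed.

Lemma lift_linear (W : lmodType C) (f : fock_index n -> W) :
  linear (fun v : fock => \sum_(b <- msupp v) v@_b *: f b).
Proof.
move=> c u v; set d := (msupp u `|` msupp v `|` msupp (c *: u + v))%fset.
have H x : (msupp x `<=` d)%fset ->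
   \sum_(b <- msupp x) x@_b *: f b = \sum_(b <- d) x@_b *: f b by apply: fock_sumE.
have [ud vd uvd] : [/\ (msupp u `<=` d)%fset, (msupp v `<=` d)%fset &
    (msupp (c *: u + v) `<=` d)%fset].
  by split; apply/fsubsetP => x; rewrite !in_fsetU => ->; rewrite ?orbT.
rewrite !H // scaler_sumr -big_split /=; apply: eq_bigr => b _.
by rewrite mcoeffD mcoeffZ scalerDl scalerA.
Qed.

Lemma fock_lift_linear (f : fock_index n -> fock) : linear (fock_lift f).
Proof. exact: lift_linear. Qed.

Lemma coef_ket b b' : (ket b)@_b' = (b == b')%:R.
Proof. by rewrite ket.unlock mcoeffU. Qed.

Lemma fock_liftE (f : fock_index n -> fock) b : fock_lift f (ket b) = f b.
Proof.
by rewrite /fock_lift ket.unlock msuppU oner_eq0 big_seq_fset1 mcoeffUU scale1r.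
Qed.

Lemma fock_expand v : v = \sum_(b <- msupp v) v@_b *: ket b.
Proof.
rewrite {1}[v]monalgE; apply: eq_bigr => b _; apply/malgP => k.
by rewrite mcoeffZ coef_ket [LHS]mcoeffU; case: eqP; rewrite ?mulr1 ?mulr0.
Qed.

Lemma fock_ext (W : lmodType C) (f g : fock -> W) : linear f -> linear g ->
  (forall b, f (ket b) = g (ket b)) -> forall v, f v = g v.
Proof.
move=> fl gl fg v; rewrite [v]fock_expand.
have S h : linear h -> h (\sum_(b <- msupp v) v@_b *: ket b) =
    \sum_(b <- msupp v) v@_b *: h (ket b) :> W.
  move=> hl; pose hL : {linear fock -> W} := HB.pack h (GRing.isLinear.Build _ _ _ _ h hl).
  rewrite -[h]/(hL : _ -> _) linear_sum; apply: eq_bigr => b _.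
  by rewrite linearZ.
by rewrite !S //; apply: eq_bigr => b _; rewrite fg.
Qed.

Lemma coef_linear b : linear (fun v : fock => v@_b : C^o).
Proof. by move=> c u v; rewrite mcoeffD mcoeffZ. Qed.

Lemma fock_sum_ind (Q : fock -> Prop) : Q 0 ->
  (forall (z : C) v w, Q v -> Q w -> Q (z *: v + w)) ->
  forall v, (forall b, v@_b != 0 -> Q (ket b)) -> Q v.
Proof.
move=> Q0 QD v Qb; rewrite [v]fock_expand big_seq; apply: big_ind => //.
  by move=> x y Qx Qy; rewrite -[x]scale1r; apply: QD.
by move=> b; rewrite -mcoeff_neq0 => /Qb Qbb; rewrite -[_ *: _]addr0; apply: QD.
Qed.

End FockSpace.

Section Lattice.
Variables (R : realType) (n : nat) (L : even_lattice R n).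
Implicit Types (a b c : 'rV[int]_n).

Lemma dotC (u v : 'rV[R]_n) : dot u v = dot v u.
Proof. by apply: eq_bigr => i _; rewrite mulrC. Qed.

Lemma dotDl (u v w : 'rV[R]_n) : dot (u + v) w = dot u w + dot v w.
Proof. by rewrite /dot -big_split; apply: eq_bigr => i _; rewrite mxE mulrDl. Qed.

Lemma lvecD a b : lvec L (a + b) = lvec L a + lvec L b.
Proof. by rewrite /lvec map_mxD mulmxDl. Qed.

Lemma lvec0 : lvec L 0 = 0.
Proof. by rewrite /lvec map_mx0 mul0mx. Qed.

Lemma ldotE a b : (ldot L a b)%:~R = dot (lvec L a) (lvec L b) :> R.
Proof.
have [k Hk] := lbasis_even L (a + b); have [i Hi] := lbasis_even L a.
have [j Hj] := lbasis_even L b; move: Hk Hi Hj.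
rewrite -!/(lvec L _) lvecD dotDl ![dot _ (_ + _)]dotC !dotDl => Hk Hi Hj.
have E : dot (lvec L a) (lvec L b) = (k - i - j)%:~R.
  move: Hk; rewrite Hi Hj [dot (lvec L b) (lvec L a)]dotC !intrM !intrD !intrN; lra.
by rewrite /ldot E intrKfloor.
Qed.

Lemma ldot_half a : exists k : int, 0 <= k /\ ldot L a a = 2 * k.
Proof.
have [k Hk] := lbasis_even L a; rewrite -/(lvec L a) -ldotE in Hk.
exists k; split; last exact: (intr_inj Hk).
have : 0 <= dot (lvec L a) (lvec L a) by apply: sumr_ge0 => i _; rewrite -expr2 sqr_ge0.
by rewrite -ldotE Hk ler0z; lia.
Qed.

Lemma ldotC a b : ldot L a b = ldot L b a.
Proof. by rewrite /ldot dotC. Qed.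

Lemma ldotDl a b c : ldot L (a + b) c = ldot L a c + ldot L b c.
Proof. by apply: (@intr_inj R); rewrite intrD !ldotE lvecD dotDl. Qed.

Lemma ldotDr a b c : ldot L a (b + c) = ldot L a b + ldot L a c.
Proof. by rewrite !(ldotC a) ldotDl. Qed.

Lemma ldot0r a : ldot L a 0 = 0.
Proof. by apply: (addrI (ldot L a 0)); rewrite -ldotDr !addr0. Qed.

(** Half the norm of a, an integer since the lattice is even: the weight of e^a. *)
Definition qf a : int := (ldot L a a %/ 2)%Z.

Lemma qfE a : 2 * qf a = ldot L a a.
Proof. by have [k [_ E]] := ldot_half a; rewrite /qf E; lia. Qed.

Lemma qf_ge0 a : 0 <= qf a.
Proof. by have [k [k0 E]] := ldot_half a; have := qfE a; lia. Qed.

Lemma qfD a b : qf (a + b) = qf a + qf b + ldot L a b.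
Proof.
by move: (qfE (a + b)) (qfE a) (qfE b); rewrite ldotDl !ldotDr (ldotC b a); lia.
Qed.

Lemma qf0 : qf 0 = 0.
Proof. by have := qfE 0; rewrite ldot0r; lia. Qed.

End Lattice.

Section Multisets.
Variable T : choiceType.
Implicit Types (x y : T) (m : {mset T}%mset).

Lemma perm_mset1D x m : perm_eq (x +` m)%mset (x :: m).
Proof.
by apply/allP => y _; rewrite /= !count_mem_mset mset1DE (eq_sym y x).
Qed.

Lemma mset_ind (P : {mset T}%mset -> Prop) : P mset0 ->
  (forall x m, P m -> P (x +` m)%mset) -> forall m, P m.
Proof.
move=> P0 PD m; have [k] := ubnP (size m); elim: k m => // k IHk m mk.
have [->|[x xm]] : m = mset0 \/ exists x, x \in m.
  case E : (enum_mset m) => [|x s]; last first.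
    by right; exists x; rewrite -[x \in m]/(x \in enum_mset m) E mem_head.
  by left; rewrite -[m]seq_mset_id E -enum_mset0 seq_mset_id.
  exact: P0.
rewrite -(msetB1K xm); apply/PD/IHk; rewrite -ltnS.
by have := perm_size (perm_mset1D x (m `\ x)%mset); rewrite msetB1K //= => <-.
Qed.

End Multisets.

(** * The Heisenberg fields *)
HB.lock Definition hmode (R : realType) (n : nat) (L : even_lattice R n)
  (i : 'I_n) (k : int) : fock R n -> fock R n := heis L i k.

Section Heisenberg.
Variables (R : realType) (n : nat) (L : even_lattice R n).
Local Notation C := (complex R).
Local Notation fock := (fock R n).
Local Notation heis := (hmode L).
Local Notation ket := (@ket R n).
Implicit Types (b : fock_index n) (v w : fock) (a c : 'rV[int]_n) (i j : 'I_n).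

Lemma heis_linear i k : linear (heis i k).
Proof. by rewrite hmode.unlock; apply: fock_lift_linear. Qed.

Lemma heisN i p m c :
  heis i (Negz p) (ket (m, c)) = ket ((i, p) +` m, c)%mset.
Proof. by rewrite hmode.unlock /Defs.heis fock_liftE ?ket.unlock. Qed.

Lemma heis0 i m c : heis i 0 (ket (m, c)) = (lvec L c 0 i)%:C%C *: ket (m, c).
Proof. by rewrite hmode.unlock /Defs.heis fock_liftE ?ket.unlock. Qed.

Lemma heisP i p m c : heis i p.+1 (ket (m, c)) =
  (p.+1 * m (i, p))%:R *: ket (m `\ (i, p), c)%mset.
Proof. by rewrite hmode.unlock /Defs.heis fock_liftE ?ket.unlock. Qed.

(** A nonzero mode acts on all the M(1, c) by the same formula. *)
Lemma heis_shift i k m : k != 0 -> exists (z : C) m',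
  forall c, heis i k (ket (m, c)) = z *: ket (m', c).
Proof.
case: k => [[|p]|p] // _.
  by exists (p.+1 * m (i, p))%:R, (m `\ (i, p))%mset => c; rewrite heisP.
by exists 1, ((i, p) +` m)%mset => c; rewrite heisN scale1r.
Qed.

Let eN i p j q : (i == j) && (Negz p + q.+1%:Z == 0) = ((i, p) == (j, q)).
Proof. by rewrite xpair_eqE; congr (_ && _); apply/eqP/eqP; lia. Qed.

Let hNP i p j q m c : heis i (Negz p) (heis j q.+1 (ket (m, c))) =
  heis j q.+1 (heis i (Negz p) (ket (m, c))) +
  (if (i == j) && (Negz p + q.+1%:Z == 0) then (Negz p)%:~R else 0) *: ket (m, c).
Proof.
rewrite eN heisP (linZ _ _ (heis_linear _ _)) !heisN heisP mset1DE.
set x := (i, p); set y := (j, q).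
have [xy|xy] := eqVneq x y.
  have -> : p = q by case: xy.
  rewrite {}xy ?eqxx msetD1K.
  have [m0|m0] := eqVneq (m y) 0%N.
    rewrite m0 muln0 scale0r muln1 NegzE mulrNz -scalerDl -pmulrn.
    by rewrite subrr scale0r.
  rewrite msetB1K; last by rewrite -mset_neq0.
  rewrite -scalerDl NegzE mulrNz -pmulrn mulnDr muln1 natrD.
  by rewrite addrAC subrr add0r.
rewrite scale0r addr0 add0n.
have [m0|m0] := eqVneq (m y) 0%N; first by rewrite m0 !muln0 !scale0r.
congr (_ *: ket (_, _)); apply/msetP => z.
rewrite !(mset1DE, msetB1E); have [->|_] := eqVneq z y; last by rewrite !subn0.
by rewrite [y == x]eq_sym (negPf xy).
Qed.

Let hPP i p j q m c : heis i p.+1 (heis j q.+1 (ket (m, c))) =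
  heis j q.+1 (heis i p.+1 (ket (m, c))).
Proof.
rewrite !heisP !(linZ _ _ (heis_linear _ _)) !heisP !scalerA -!natrM !msetB1E.
have -> : (m `\ (j, q) `\ (i, p) = m `\ (i, p) `\ (j, q))%mset.
  by apply/msetP => z; rewrite !msetB1E; lia.
suff -> : (q.+1 * m (j, q) * (p.+1 * (m (i, p) - ((i, p) == (j, q)))) =
    p.+1 * m (i, p) * (q.+1 * (m (j, q) - ((j, q) == (i, p)))))%N by [].
have [[-> ->] //|_] := eqVneq (i, p) (j, q).
by rewrite !subn0 mulnC.
Qed.

Let hcomm i k j l v : heis i k (heis j l v) = heis j l (heis i k v) +
  (if (i == j) && (k + l == 0) then k%:~R else 0) *: v.
Proof.
have l1 := lin_comp (heis_linear i k) (heis_linear j l).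
have l2 := lin_comp (heis_linear j l) (heis_linear i k).
apply: (fock_ext l1 (g := fun v => heis j l (heis i k v) + _ *: v)).
  by apply: lin_add => //; apply: (@lin_scale _ _ id).
move=> {v l1 l2} [m c].
have k0 : k = 0 -> (if (i == j) && (k + l == 0) then k%:~R else 0) = 0 :> C.
  by move=> ->; rewrite if_same.
have sw (x y : int) : heis j y (heis i x (ket (m, c))) =
    heis i x (heis j y (ket (m, c))) +
    (if (j == i) && (y + x == 0) then y%:~R else 0) *: ket (m, c) ->
  heis i x (heis j y (ket (m, c))) = heis j y (heis i x (ket (m, c))) +
    (if (i == j) && (x + y == 0) then x%:~R else 0) *: ket (m, c).
  move=> ->; rewrite -addrA -scalerDl [j == i]eq_sym [y + x]addrC.
  case: ifP => [/andP[_ /eqP xy]|_]; last by rewrite addr0 scale0r addr0.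
  by rewrite -intrD [y + x]addrC xy scale0r addr0.
case: k k0 => [[|p]|p] k0.
- rewrite (k0 erefl) scale0r addr0; case: l {k0} => [[|q]|q].
  + by rewrite !heis0 !(linZ _ _ (heis_linear _ _)) !heis0 !scalerA mulrC.
  + by rewrite heisP heis0 !(linZ _ _ (heis_linear _ _)) heis0 heisP !scalerA mulrC.
  + by rewrite heisN !heis0 (linZ _ _ (heis_linear _ _)) heisN.
- case: l {k0} => [[|q]|q].
  + rewrite addr0 andbF scale0r addr0.
    by rewrite heisP heis0 !(linZ _ _ (heis_linear _ _)) heis0 heisP !scalerA mulrC.
  + by rewrite hPP andbF scale0r addr0.
  + by apply: sw; apply: hNP.
- case: l {k0} => [[|q]|q].
  + rewrite addr0 andbF scale0r addr0.
    by rewrite heisN !heis0 (linZ _ _ (heis_linear _ _)) heisN.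
  + exact: hNP.
  + by rewrite !heisN msetDCA andbF scale0r addr0.
Qed.

Lemma heis_comm i k j l v : heis i k (heis j l v) = heis j l (heis i k v) +
  (if (i == j) && (k + l == 0) then k%:~R else 0) *: v.
Proof. exact: hcomm. Qed.

(** An annihilation operator recovers the coefficients of a vector at all basis
    vectors that contain the corresponding oscillator. *)
Lemma coef_heis i p v m c : (heis i p.+1 v)@_(m, c) =
  (p.+1 * (m (i, p)).+1)%:R * v@_(((i, p) +` m)%mset, c).
Proof.
apply: (fock_ext (W := C^o) (f := fun v => (heis i p.+1 v)@_(m, c))
  (g := fun v => _ * v@_(((i, p) +` m)%mset, c))) => [||[m' c']].
- by move=> z x y; rewrite heis_linear coef_linear.
- by move=> z x y; rewrite coef_linear mulrDr scalerAr.
rewrite heisP mcoeffZ !coef_ket.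
have [[-> ->]|ne] := eqVneq (m', c') (((i, p) +` m)%mset, c).
  by rewrite msetD1K eqxx mset1DE eqxx add1n.
rewrite mulr0; have [[E1 E2]|_] := eqVneq ((m' `\ (i, p))%mset, c') (m, c); last by rewrite mulr0.
suff -> : m' (i, p) = 0%N by rewrite muln0 mul0r.
apply/eqP; rewrite mset_eq0; apply/negP => m'x.
by move/eqP: ne; apply; rewrite -E1 msetB1K // E2.
Qed.

Definition wt b : int := (\sum_(x <- enum_mset b.1) x.2.+1)%N%:Z + qf L b.2.

Lemma wt_ge0 b : 0 <= wt b.
Proof. by rewrite addr_ge0 ?qf_ge0. Qed.

Lemma wt_add x m c : wt ((x +` m)%mset, c) = x.2.+1%:Z + wt (m, c).
Proof. by rewrite /wt (perm_big _ (perm_mset1D x m)) big_cons PoszD addrA. Qed.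

Lemma wt_zero c : wt (mset0, c) = qf L c.
Proof. by rewrite /wt /= enum_mset0 big_nil add0r. Qed.

(** Homogeneous vectors of weight d in M(1, c). *)
Definition bihom (d : int) c v : Prop := forall b, v@_b != 0 -> wt b = d /\ b.2 = c.

Lemma bihom0 d c : bihom d c 0.
Proof. by move=> b; rewrite mcoeff0 eqxx. Qed.

Lemma bihomD d c v w : bihom d c v -> bihom d c w -> bihom d c (v + w).
Proof.
move=> vh wh b; rewrite mcoeffD; have [->|/vh //] := eqVneq v@_b 0.
by rewrite add0r; apply: wh.
Qed.

Lemma bihomZ d c z v : bihom d c v -> bihom d c (z *: v).
Proof. by move=> vh b; rewrite mcoeffZ mulf_eq0 negb_or => /andP[_ /vh]. Qed.

Lemma bihom_sum d c (I : Type) (r : seq I) (P : pred I) (F : I -> fock) :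
  (forall x, P x -> bihom d c (F x)) -> bihom d c (\sum_(x <- r | P x) F x).
Proof.
by move=> Fh; apply: big_ind => //; [exact: bihom0 | exact: bihomD].
Qed.

Lemma bihom_nsum d c (F : nat -> fock) :
  (forall q, bihom d c (F q)) -> bihom d c (nsum F).
Proof. by move=> Fh; apply: bihom_sum => q _; apply: Fh. Qed.

Lemma bihomU m c : bihom (wt (m, c)) c (ket (m, c)).
Proof. by move=> b; rewrite coef_ket; case: ((m, c) =P b) => [<-|_] //; rewrite eqxx. Qed.

Lemma bihom_neg d c v : bihom d c v -> d < 0 -> v = 0.
Proof.
move=> vh d0; apply/malgP => b; rewrite mcoeff0; apply/eqP/negPn/negP => /vh[].
by have := wt_ge0 b; lia.
Qed.

Lemma bihom_lin (f : fock -> fock) d c d' c' v : linear f -> bihom d c v ->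
  (forall m, wt (m, c) = d -> bihom d' c' (f (ket (m, c)))) -> bihom d' c' (f v).
Proof.
move=> fl vh fh; refine (@fock_sum_ind R n (fun v => bihom d' c' (f v)) _ _ v _).
- by rewrite (lin0 fl); apply: bihom0.
- by move=> z x y xh yh; rewrite fl; apply/bihomD/yh/bihomZ.
- by move=> [m c0] /vh [Hwt /= Hc]; subst c0; apply: fh.
Qed.

Lemma heis_bihom i k d c v : bihom d c v -> bihom (d - k) c (heis i k v).
Proof.
move=> vh; apply: (bihom_lin (heis_linear i k) vh) => m wm.
case: k => [[|p]|p].
- by rewrite heis0 subr0 -wm; apply/bihomZ/bihomU.
- rewrite heisP; have [m0|m0] := eqVneq (m (i, p)) 0%N.
    by rewrite m0 muln0 scale0r; apply: bihom0.
  have -> : d - p.+1%:Z = wt ((m `\ (i, p))%mset, c).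
    have := wt_add (i, p) (m `\ (i, p))%mset c.
    by rewrite msetB1K -?mset_neq0 //= wm; lia.
  exact/bihomZ/bihomU.
- rewrite heisN; have -> : d - Negz p = wt (((i, p) +` m)%mset, c).
    by rewrite wt_add /= wm; lia.
  exact: bihomU.
Qed.

(** Operators F x of weight lev x that commute with the nonzero Heisenberg modes, up
    to members of the family whose weight is shifted accordingly, vanish as soon as
    they have no matrix coefficient between highest weight vectors.  For F x (e^c),
    induct on its weight: the members of lower weight vanish on e^c, hence F x commutes
    there with the annihilation operators, and F x (e^c) is killed by all of them.  So
    it is a combination of highest weight vectors, with coefficients 0 by assumption.
    Creation operators then give all vectors. *)
Lemma heis_unique (X : Type) (lev : X -> int) (F : X -> fock -> fock) :
  (forall x, linear (F x)) ->
  (forall i k x v, k != 0 -> (forall y, lev y = lev x - k -> F y v = 0) ->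
     heis i k (F x v) = F x (heis i k v)) ->
  (forall x c, exists c', bihom (qf L c + lev x) c' (F x (ket (mset0, c)))) ->
  (forall x c c', (F x (ket (mset0, c)))@_(mset0, c') = 0) ->
  forall x v, F x v = 0.
Proof.
move=> Fl Fc Fh Ft.
have F0 c x : F x (ket (mset0, c)) = 0.
  have [k] := ubnP `|(qf L c + lev x)%R|%N; elim: k x => // k IHk x lex.
  have [c' Fxh] := Fh x c.
  have [ln|ln] := ltP (qf L c + lev x) 0; first exact: bihom_neg Fxh ln.
  apply/malgP => -[m c0]; rewrite mcoeff0.
  elim/mset_ind: m => [|[i p] m _]; first exact: Ft.
  have := coef_heis i p (F x (ket (mset0, c))) m c0.
  rewrite Fc // => [|y ly].
    rewrite heisP mset0E muln0 scale0r (lin0 (Fl _)) mcoeff0 => /esym/eqP.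
    by rewrite mulf_eq0 pnatr_eq0 /= => /eqP.
  have [ln'|ln'] := ltP (qf L c + lev y) 0; last by apply: IHk; lia.
  by have [c2 h] := Fh y c; apply: bihom_neg h ln'.
have Fb m c x : F x (ket (m, c)) = 0.
  elim/mset_ind: m x => [|[i p] m IHm] x; first exact: F0.
  by rewrite -heisN -Fc // IHm (lin0 (heis_linear _ _)).
move=> x v; apply: (@fock_ext R n _ (F x) (fun=> 0)) => //.
- by move=> c u w; rewrite scaler0 addr0.
- by case.
Qed.

(** The field of a state of weight w in M(1, a). *)
Definition homog (w : int) a (A : opfield fock) : Prop := forall (k d : int) c v,
  bihom d c v -> bihom (d + w - k - 1) (a + c) (A k v).

Lemma homog_field (w : int) a (A : opfield fock) :
  (forall k, linear (A k)) -> homog w a A -> field A.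
Proof.
move=> Al Ah; split=> // v.
apply: (@fock_sum_ind R n (fun v => exists N : int, forall k : int, N <= k -> A k v = 0)).
- by exists 0 => k _; rewrite (lin0 (Al _)).
- move=> z x y [M xM] [N yN]; exists (Num.max M N) => k.
  by rewrite ge_max => /andP[Mk Nk]; rewrite Al xM ?yN // scaler0 addr0.
- move=> [m c] _; have := @bihomU m c; move: (wt (m, c)) => d hb.
  by exists (d + w) => k kw; apply: (bihom_neg (Ah k _ _ _ hb)); lia.
Qed.

Lemma homog_bor (w1 w2 : int) a1 a2 (A B : opfield fock) (l m p d : int) c v :
  homog w1 a1 A -> homog w2 a2 B ->
  bihom d c v ->
  bihom (d + w1 + w2 - l - m - p - 2) (a1 + a2 + c) (bor A B l m p v).
Proof.
have H (w1' w2' : int) a1' a2' (A' B' : opfield fock) (m' p' : int) :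
    homog w1' a1' A' -> homog w2' a2' B' ->
  bihom d c v ->
  bihom (d + w1' + w2' - l - m' - p' - 2) (a1' + a2' + c) (halfbor A' B' l m' p' v).
  move=> Ah Bh vh; apply: bihom_nsum => j; apply: bihomZ.
  have := Ah (m' + l - j%:Z) _ _ _ (Bh (p' + j%:Z) _ _ _ vh).
  by rewrite addrA; congr bihom; lia.
move=> Ah Bh vh; apply: bihomD; first exact: H.
rewrite -scaleNr; apply: bihomZ; have := H _ _ _ _ _ _ p m Bh Ah vh.
by congr bihom; [lia | rewrite [a2 + a1]addrC].
Qed.

Lemma homog_nprod (w1 w2 : int) a1 a2 (A B : opfield fock) (l : int) :
  homog w1 a1 A -> homog w2 a2 B ->
  homog (w1 + w2 - l - 1) (a1 + a2) (nprod A B l).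
Proof.
move=> Ah Bh k d c v vh; have := @homog_bor _ _ _ _ _ _ l 0 k _ _ _ Ah Bh vh.
by congr bihom; lia.
Qed.

Lemma heis_homog i : homog 1 0 (heis i).
Proof.
move=> k d c v vh; have := @heis_bihom i k _ _ _ vh.
by rewrite add0r; congr bihom; lia.
Qed.

Lemma heis_field i : field (heis i).
Proof. exact: (homog_field (heis_linear i) (@heis_homog i)). Qed.

Lemma heis_loc i j : loc (heis i) (heis j).
Proof.
pose g (m p : int) : C := if (i == j) && (m + p == 0) then m%:~R else 0.
apply: (@loc_central _ _ _ _ g); try exact: heis_field.
  by move=> m p v; rewrite heis_comm addrAC subrr add0r.
move=> m p; rewrite /g.
rewrite (_ : m + 1 + 1 + p = m + p + 2); last by lia.
rewrite (_ : m + 1 + (p + 1) = m + p + 2); last by lia.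
rewrite (_ : m + (p + 1 + 1) = m + p + 2); last by lia.
by case: ifP => _; rewrite ?subrr // !intrD; ring.
Qed.

End Heisenberg.

(** * Translation covariance and primary fields *)
Section ZmodIdentities.
Variable V : zmodType.
Implicit Types x y z w u s q o : V.

(** These three regroupings are stated for variables because normalizing the sums of
    operators in which they occur is expensive. *)
Lemma regroup1 x y z w u s q o : x + y + (z + w) - (u + z + s) + (q + o) =
  x - u + q + (y - s + (o + w)).
Proof.
by rewrite !opprD !addrA [LHS](ACl (1*5*8*2*7*9*4*(3*6)))%AC /= subrr addr0.
Qed.

Lemma regroup2 x y z u s w : x + y + z - (u + s + w) = x - u + (z - s + (y - w)).
Proof. by rewrite !opprD !addrA [LHS](ACl (1*4*3*5*2*6))%AC. Qed.

Lemma regroup3 x y z u s w : x + (y + z) - (u + (s + w)) = x - u + (y - s + (z - w)).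
Proof. by rewrite !opprD !addrA [LHS](ACl (1*4*2*5*3*6))%AC. Qed.

End ZmodIdentities.

Section Sugawara.
Variables (K : numFieldType) (V : lmodType K) (n : nat).
Variable h : 'I_n -> opfield V.
Hypothesis hf : forall i, field (h i).
Hypothesis hc : forall i k j l v, h i k (h j l v) = h j l (h i k v) +
  (if (i == j) && (k + l == 0) then k%:~R else 0) *: v.
Implicit Types (i j : 'I_n) (k l m p : int) (v : V).

Let hl i k : linear (h i k). Proof. exact: (proj1 (hf i)). Qed.

Lemma nsum_delta q0 (F : nat -> V) : (forall q, q != q0 -> F q = 0) ->
  nsum F = F q0.
Proof.
move=> F0; rewrite (@nsumE _ _ q0.+1) => [|q qq]; last by apply: F0; lia.
rewrite big_ord_recr /= big1 ?add0r // => i _.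
by apply: F0; rewrite neq_ltn ltn_ord.
Qed.

(** L(-1) = 1/2 sum_k :h(k) h(-1-k):.  No index is fixed by k -> -1-k, so the
    factor 1/2 disappears when the sum is restricted to k >= 0. *)
Definition transl v : V := \sum_i nsum (fun q : nat => h i (Negz q) (h i q%:Z v)).

Let evz_h i v : evz (fun q : nat => h i (Negz q) (h i q%:Z v)).
Proof.
have [N hN] := proj2 (hf i) v; exists `|N|%N => q qN.
by rewrite hN ?(lin0 (hl _ _)) //; lia.
Qed.

Lemma transl_linear : linear transl.
Proof.
apply: lin_bigsum => i c u v; rewrite -nsumZ // -nsumD //; last first.
  exact: (evzZ (fun=> c)).
by apply: eq_nsum => q; rewrite !hl.
Qed.

Lemma transl_eq0 v : (forall i (q : nat), h i q%:Z v = 0) -> transl v = 0.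
Proof.
move=> h0; rewrite /transl big1 // => i _; rewrite nsum0 // => q.
by rewrite h0 (lin0 (hl _ _)).
Qed.

Lemma transl_heis i : covariant transl (h i).
Proof.
move=> k v; apply/esym/(canLR (addrK _)).
rewrite /transl (lin_sum _ _ _ (hl i k)).
have H j : h i k (nsum (fun q : nat => h j (Negz q) (h j q%:Z v))) =
    nsum (fun q : nat => h j (Negz q) (h j q%:Z (h i k v))) +
    (if j == i then k%:~R *: h i (k - 1) v else 0).
  rewrite (nsum_lin (hl i k)) //.
  pose c1 (q : nat) : K := if (i == j) && (k + q%:Z == 0) then k%:~R else 0.
  pose c2 (q : nat) : K := if (i == j) && (k + Negz q == 0) then k%:~R else 0.
  have E q : h i k (h j (Negz q) (h j q%:Z v)) =
      h j (Negz q) (h j q%:Z (h i k v)) +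
      (c1 q *: h j (Negz q) v + c2 q *: h j q%:Z v).
    by rewrite hc [h i k (h j q%:Z v)]hc (linD _ _ (hl _ _)) (linZ _ _ (hl _ _)) -addrA.
  have d1 : forall q, q != `|k|%N -> c1 q *: h j (Negz q) v = 0.
    by move=> q qk; rewrite /c1 ifF ?scale0r //; apply/negbTE/negP; lia.
  have d2 : forall q, q != `|k - 1|%N -> c2 q *: h j q%:Z v = 0.
    by move=> q qk; rewrite /c2 ifF ?scale0r //; apply/negbTE/negP; lia.
  have z1 : evz (fun q => c1 q *: h j (Negz q) v).
    by exists `|k|.+1 => q qk; apply: d1; lia.
  have z2 : evz (fun q => c2 q *: h j q%:Z v).
    by exists `|k - 1|.+1 => q qk; apply: d2; lia.
  rewrite (eq_nsum E) nsumD //; last exact: evzD.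
  congr (_ + _); rewrite nsumD // (nsum_delta d1) (nsum_delta d2) /c1 /c2 [j == i]eq_sym.
  have [<-|_] := eqVneq i j; last by rewrite !scale0r addr0.
  have [k0|k0] := leP k 0.
    rewrite ifT; last by apply/eqP; lia.
    rewrite ifF; last by apply/negbTE/negP; lia.
    by rewrite scale0r addr0; congr (_ *: h i _ v); lia.
  rewrite ifF; last by apply/negbTE/negP; lia.
  rewrite ifT; last by apply/eqP; lia.
  by rewrite scale0r add0r; congr (_ *: h i _ v); lia.
rewrite (eq_bigr _ (fun j _ => H j)) big_split /=; congr (_ + _).
by rewrite -big_mkcond big_pred1_eq.
Qed.

(** The commutation relation [h_i(k), E(z)] = a_i z^k E(z) of a vertex operator of
    charge a. *)
Definition primary (a : 'I_n -> K) (E : opfield V) : Prop := forall i k p v,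
  h i k (E p v) = E p (h i k v) + a i *: E (p + k) v.

(** The failure of covariance satisfies the relations of a primary field of charge a,
    so that [heis_unique] applies to it. *)
Lemma primary_defect a E : field E -> primary a E ->
  forall i k p v,
  let D p v := transl (E p v) - E p (transl v) + p%:~R *: E (p - 1) v in
  h i k (D p v) = D p (h i k v) + a i *: D (p + k) v.
Proof.
move=> [El _] aE i k p v /=.
have tr w : h i k (transl w) = transl (h i k w) + k%:~R *: h i (k - 1) w.
  by rewrite transl_heis subrK.
have tl := transl_linear.
rewrite (linD _ _ (hl _ _)) (linB _ _ (hl _ _)) (linZ _ _ (hl _ _)) !tr !aE.
rewrite !(linD _ _ tl) !(linZ _ _ tl) tr (linD _ _ (El _)) (linZ _ _ (El _)).
rewrite (_ : p - 1 + k = p + k - 1); last by lia.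
rewrite (_ : p + (k - 1) = p + k - 1); last by lia.
rewrite !scalerDr !scalerN [(p + k)%:~R]intrD !scalerDl !scalerDr !scalerA.
rewrite !(mulrC (a i)).
exact: regroup1.
Qed.

(** Likewise for the failure of locality: bracketing with h_i(k) multiplies a product
    of primary fields of charges a and b by a_i z^k + b_i w^k. *)
Lemma primary_bor a b A B : field A -> field B -> primary a A -> primary b B ->
  forall (N : nat) i k m p v, h i k (bor A B N%:Z m p v) =
    bor A B N%:Z m p (h i k v) +
    (a i *: bor A B N%:Z (m + k) p v + b i *: bor A B N%:Z m (p + k) v).
Proof.
move=> fA fB aA bB; elim=> [|N IHN] i k m p v.
  have [Al Bl] := (proj1 fA, proj1 fB).
  rewrite !bor0 // (linB _ _ (hl _ _)) !(aA, bB).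
  rewrite (linD _ _ (Al _)) (linZ _ _ (Al _)) (linD _ _ (Bl _)) (linZ _ _ (Bl _)).
  by rewrite !scalerBr regroup2.
rewrite -addn1 PoszD !borS // (linB _ _ (hl _ _)) !IHN.
rewrite regroup3 -(scalerBr (a i)) -(scalerBr (b i)).
by rewrite ![_ + 1 + k]addrAC.
Qed.

(** The commutator a_i delta(z - w) A(w) is killed by z - w. *)
Lemma primary_loc a A i : field A -> primary a A -> loc (h i) A.
Proof.
move=> fA aA; exists 1%N => m p v; rewrite bor_iter //.
have E (x y : V) : x + y - x = y by rewrite addrAC subrr add0r.
rewrite /= /dlt !aA !E -scalerBr (_ : p + (m + 1) = p + 1 + m); last by lia.
by rewrite subrr scaler0.
Qed.

Section Vertex.
Variable a : 'I_n -> K.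

Definition lh k v : V := \sum_i a i *: h i k v.

Lemma lh_linear k : linear (lh k).
Proof. by apply: lin_bigsum => i; apply/lin_scale/hl. Qed.

Lemma lh_comm i k l v : h i k (lh l v) =
  lh l (h i k v) + (if k + l == 0 then a i * k%:~R else 0) *: v.
Proof.
rewrite /lh (lin_sum _ _ _ (hl i k)).
rewrite (eq_bigr (fun j => a j *: h j l (h i k v) +
    (if j == i then (if k + l == 0 then a i * k%:~R else 0) *: v else 0))).
  by rewrite big_split -big_mkcond big_pred1_eq.
move=> j _; rewrite (linZ _ _ (hl _ _)) hc scalerDr scalerA [i == j]eq_sym.
congr (_ + _); case: eqP => [->|_] /=; last by rewrite mulr0 scale0r.
by case: ifP => _; rewrite ?mulr0 ?scale0r.
Qed.

Let fmin : opser V :=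
  fun q v => if q is 0%N then 0 else q%:R^-1 *: lh (- q%:Z) v.
Let fplus : opser V :=
  fun q v => if q is 0%N then 0 else - (q%:R^-1 *: lh q%:Z v).

Definition emin : opser V := opser_exp fmin.
Definition eplus : opser V := opser_exp fplus.

Let zero_linear : linear (fun _ : V => 0 : V).
Proof. by move=> c u v; rewrite scaler0 addr0. Qed.

Let fmin_linear q : linear (fmin q).
Proof. by case: q => [|q]; [exact: zero_linear | apply/lin_scale/lh_linear]. Qed.

Let fplus_linear q : linear (fplus q).
Proof.
by case: q => [|q]; [exact: zero_linear | apply/lin_opp/lin_scale/lh_linear].
Qed.

Lemma emin_linear q : linear (emin q).
Proof. exact: opser_exp_linear fmin_linear q. Qed.

Lemma eplus_linear q : linear (eplus q).
Proof. exact: opser_exp_linear fplus_linear q. Qed.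

Let fmin_comm i k q v : h i k (fmin q v) =
  fmin q (h i k v) + (if k == q%:Z then (if k == 0 then 0 else a i) *: v else 0).
Proof.
case: q => [|q] /=.
  by rewrite (lin0 (hl _ _)) add0r;
    have [k0|k0] := eqVneq k 0; rewrite ?scale0r ?if_same ?(negPf k0).
rewrite (linZ _ _ (hl _ _)) lh_comm scalerDr scalerA; congr (_ + _).
rewrite subr_eq0; case: eqP => [->|_]; last by rewrite mulr0 scale0r.
by congr (_ *: _); rewrite /= mulrCA mulVf ?mulr1 // pnatr_eq0.
Qed.

Let fplus_comm i k q v : h i k (fplus q v) =
  fplus q (h i k v) + (if - k == q%:Z then (if k == 0 then 0 else a i) *: v else 0).
Proof.
case: q => [|q] /=.
  by rewrite (lin0 (hl _ _)) add0r oppr_eq0;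
    have [k0|k0] := eqVneq k 0; rewrite ?scale0r ?if_same ?(negPf k0).
rewrite (linN _ (hl _ _)) (linZ _ _ (hl _ _)) lh_comm scalerDr scalerA opprD.
congr (_ + _).
have -> : (k + q.+1%:Z == 0) = (- k == q.+1%:Z) by apply/eqP/eqP; lia.
case: eqP => [E|_]; last by rewrite mulr0 scale0r oppr0.
have -> : k = - q.+1%:Z by rewrite -E opprK.
by rewrite -scaleNr; congr (_ *: _);
  rewrite mulrNz mulrN mulrN opprK mulrCA mulVf ?mulr1 // pnatr_eq0.
Qed.

Lemma emin_comm i k q v : h i k (emin q v) = emin q (h i k v) +
  (if (0 < k) && (k <= q%:Z) then a i *: emin (q - `|k|)%N v else 0).
Proof.
have [k0|k0] := ltP 0 k => /=; last first.
  rewrite addr0 [LHS](opser_exp_comm (k := 1) (g := 0)) //; try exact: fmin_linear.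
    by case: ifP => _; rewrite ?scale0r addr0.
  move=> p u; rewrite fmin_comm; congr (_ + _); rewrite scale0r if_same.
  case: eqP => // kp; have -> : k = 0 by lia.
  by rewrite eqxx scale0r.
have -> : k = `|k|%N%:Z by lia.
have : (0 < `|k|)%N by lia.
move: `|k|%N => {k k0} k k0.
rewrite [LHS](opser_exp_comm (k := k) (g := a i)) //; try exact: fmin_linear.
- move=> p u; have kn : (k%:Z == 0) = false by lia.
  by rewrite fmin_comm kn eqz_nat [k == p]eq_sym.
Qed.

Lemma eplus_comm i k q v : h i k (eplus q v) = eplus q (h i k v) +
  (if (k < 0) && (- k <= q%:Z) then a i *: eplus (q - `|k|)%N v else 0).
Proof.
have [k0|k0] := ltP k 0 => /=; last first.
  rewrite addr0 [LHS](opser_exp_comm (k := 1) (g := 0)) //; try exact: fplus_linear.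
    by case: ifP => _; rewrite ?scale0r addr0.
  move=> p u; rewrite fplus_comm; congr (_ + _); rewrite scale0r if_same.
  case: eqP => // kp; have -> : k = 0 by lia.
  by rewrite eqxx scale0r.
have -> : k = - `|k|%N%:Z by lia.
have : (0 < `|k|)%N by lia.
move: `|k|%N => {k k0} k k0.
rewrite [LHS](opser_exp_comm (k := k) (g := a i)) //; try exact: fplus_linear.
- by rewrite abszN opprK lez_nat.
- move=> p u; have kn : (- k%:Z == 0) = false by lia.
  by rewrite fplus_comm kn opprK eqz_nat [k == p]eq_sym.
Qed.

(** Integer indices spare the case distinctions at negative exponents. *)
Definition Emin (p : int) v : V := if p is Posz q then emin q v else 0.

Lemma Emin_linear p : linear (Emin p).
Proof. by case: p => q; [exact: emin_linear | exact: zero_linear]. Qed.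

Lemma Emin_comm i k p v : h i k (Emin p v) =
  Emin p (h i k v) + (if 0 < k then a i *: Emin (p - k) v else 0).
Proof.
case: p => q /=; last first.
  rewrite (lin0 (hl _ _)) add0r; case: ifP => // k0.
  have -> : Negz q - k = Negz (q + `|k|)%N by lia.
  by rewrite /= scaler0.
rewrite emin_comm; congr (_ + _); have [k0|] //= := ltP 0 k.
case: ifP => kq.
  by have -> : q%:Z - k = (q - `|k|)%N%:Z by lia.
have -> : q%:Z - k = Negz (`|k| - q).-1%N by lia.
by rewrite /= scaler0.
Qed.

Hypothesis eplus_trunc : forall v, evz (fun q => eplus q v).

(** The coefficient of z^s in the product of both exponentials. *)
Definition vert (s : int) v : V := nsum (fun q => Emin (q%:Z + s) (eplus q v)).

Let evz_vert (f : nat -> int) v : evz (fun q => Emin (f q) (eplus q v)).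
Proof. by have [N vN] := eplus_trunc v; exists N => q /vN ->; rewrite (lin0 (Emin_linear _)). Qed.

Lemma vert_linear s : linear (vert s).
Proof.
move=> c u v; rewrite /vert -nsumZ // -nsumD //; last exact: (evzZ (fun=> c)).
by apply: eq_nsum => q; rewrite eplus_linear Emin_linear.
Qed.

(** The positive modes only see the first exponential, the negative modes only the
    second one, with the same result; the zero mode commutes with both. *)
Lemma vert_comm i k s v : h i k (vert s v) =
  vert s (h i k v) + (if k == 0 then 0 else a i *: vert (s - k) v).
Proof.
rewrite /vert (nsum_lin (hl i k)) //.
have [k0|k0|k0] := ltgtP 0 k.
- rewrite -nsumZ // -nsumD //; last exact: (evzZ (fun=> a i)).
  apply: eq_nsum => q; rewrite Emin_comm k0 eplus_comm.
  rewrite ifF ?addr0 ?addrA //; lia.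
- pose G q := a i *: Emin (q%:Z + s - k) (eplus q v).
  have Gz : evz G by apply: (evzZ (fun=> a i)).
  rewrite -nsumZ // [X in _ + X](eq_nsum (G := G)); last by move=> q; rewrite /G addrA.
  rewrite -(nsum_shift `|k|%N Gz) -nsumD //; last first.
    have [N GN] := Gz; exists (N + `|k|)%N => q qN; rewrite GN ?if_same //; lia.
  have kf : (0 < k) = false by lia.
  apply: eq_nsum => q; rewrite Emin_comm eplus_comm k0 kf /=.
  rewrite addr0 (linD _ _ (Emin_linear _)); congr (_ + _); rewrite /G.
  have -> : (- k <= q%:Z) = (`|k| <= q)%N by lia.
  case: ifP => kq; last by rewrite (lin0 (Emin_linear _)).
  by rewrite (linZ _ _ (Emin_linear _)); congr (_ *: Emin _ _); lia.
- rewrite addr0; apply: eq_nsum => q.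
  by rewrite Emin_comm eplus_comm -k0 ltxx /= !addr0.
Qed.

End Vertex.

End Sugawara.

(** * The vertex operators Y(e^a, z) *)
HB.lock Definition vexp (R : realType) (n : nat) (L : even_lattice R n)
  (ep : cocycle L) (a : 'rV[int]_n) : opfield (fock R n) := Yexp ep a.

Section BinomialDifferences.
Variable K : numFieldType.

(** The coefficient of t^i in (1 - t)^x.  With an integer index the recursion
    [altbinS] has no boundary case. *)
Definition altbin (x i : int) : K := if i is Posz k then (-1) ^+ k * binz K x k else 0.

Lemma altbin_neg x i : i < 0 -> altbin x i = 0.
Proof. by case: i. Qed.

Lemma altbin_nat x (k : nat) : altbin x k%:Z = (-1) ^+ k * binz K x k.
Proof. by []. Qed.

Lemma altbinS x i : (i + 1)%:~R * altbin x (i + 1) = (i - x)%:~R * altbin x i.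
Proof.
case: (ltP i (-1)) => [i0|i1].
  by rewrite !altbin_neg ?mulr0 //; lia.
case: (ltP i 0) => [i0|i0].
  have -> : i = -1 by lia.
  by rewrite addNr mul0r altbin_neg ?mulr0.
have -> : i = `|i|%N%:Z by lia.
move: `|i|%N => {i i0 i1} k; rewrite -PoszD addn1 !altbin_nat exprS.
by rewrite mulrCA -pmulrn binzSr !intrB; ring.
Qed.

(** A polynomial has only one expansion. *)
Lemma altbin_sub_ge0 x i : 0 <= x -> altbin x i - (-1) ^ x * altbin x (x - i) = 0.
Proof.
move=> x0; have -> : x = `|x|%N%:Z by lia.
move: `|x|%N => {x x0} x; have [i0|i0] := ltP i 0.
  rewrite altbin_neg // sub0r; have -> : x%:Z - i = (x + `|i|)%N%:Z by lia.
  by rewrite altbin_nat binz_nat bin_small ?mulr0 ?oppr0 //; lia.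
have -> : i = `|i|%N%:Z by lia.
move: `|i|%N => {i i0} i; have [xi|ix] := ltnP x i.
  rewrite (@altbin_neg _ (_ - _)) ?mulr0 ?subr0; last by lia.
  by rewrite altbin_nat binz_nat bin_small ?mulr0.
have -> : x%:Z - i%:Z = (x - i)%N%:Z by lia.
rewrite !altbin_nat !binz_nat bin_sub // -exprnP.
have -> : (-1) ^+ x = (-1) ^+ i * (-1) ^+ (x - i)%N :> K by rewrite -exprD subnKC.
by rewrite mulrA -[_ * _ * (-1) ^+ _]mulrA -expr2 sqrr_sign mulr1 subrr.
Qed.

(** The expansions of (1 - t)^(-N-1) at 0 and at infinity differ by the N-th divided
    derivative of the delta function, whose coefficients are polynomial of degree N in i. *)
Lemma altbin_sub_lt0 (N : nat) i :
  altbin (- N.+1%:Z) i - (-1) ^ (- N.+1%:Z) * altbin (- N.+1%:Z) (- N.+1%:Z - i)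
  = binz K (i + N%:Z) N.
Proof.
set x := - N.+1%:Z.
have [i0|i0] := leP 0 i.
  rewrite (@altbin_neg _ (x - i)) ?mulr0 ?subr0; last by lia.
  have -> : i = `|i|%N%:Z by lia.
  move: `|i|%N => {i i0} i; rewrite altbin_nat binz_opp -PoszD binz_nat.
  have -> : i%:Z - 1 - x = (i + N)%N%:Z by lia.
  by rewrite binz_nat -(bin_sub (leq_addl i N)) addnK.
rewrite altbin_neg // sub0r; have [ix|ix] := ltP x i.
  rewrite altbin_neg ?mulr0 ?oppr0; last by lia.
  have -> : i + N%:Z = `|(i + N%:Z)%R|%N%:Z by lia.
  by rewrite binz_nat bin_small //; lia.
have -> : x - i = `|(x - i)%R|%N%:Z by lia.
rewrite altbin_nat binz_opp [RHS]binz_oppC.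
set k := `|_|%N.
have -> : k%:Z - 1 - x = (k + N)%N%:Z by lia.
have -> : N%:Z - 1 - (i + N%:Z) = (k + N)%N%:Z by lia.
rewrite !binz_nat -(bin_sub (leq_addl k N)) addnK /x -exprnN exprS.
by rewrite mulN1r invrN invr_sign mulNr opprK.
Qed.

End BinomialDifferences.

Lemma fsbig_antidiagonal (K : numFieldType) (V : lmodType K)
    (F : nat -> nat -> V) (x y : int) :
  \sum_(pq \in [set pq : nat * nat | pq.1%:Z - pq.2%:Z + x = y]) F pq.1 pq.2 =
  nsum (fun q : nat => if q%:Z + (y - x) is Posz p then F p q else 0).
Proof.
pose H (q : nat) := (`|(q%:Z + (y - x))%R|%N, q).
rewrite (reindex_fsbig H [set q : nat | 0 <= q%:Z + (y - x)]).
  rewrite /nsum fsbig_mkcond; apply: eq_fsbigr => q _.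
  rewrite /patch /H /=; case: ifPn => [/set_mem /=|].
    by case: (_ + _).
  by rewrite notin_setE /=; case: (q%:Z + (y - x)) => // p [].
split=> [q /= q0|q q' _ _ []//|[p q] /= pq]; first by rewrite /H /=; lia.
by exists q => /=; [lia | rewrite /H; congr (_, _); lia].
Qed.

Lemma scale_swap (K : numFieldType) (V : lmodType K) (e x y : K) (u : V) :
  e *: ((x + y) *: u) = y *: (e *: u) + x *: (e *: u).
Proof. by rewrite !scalerA -scalerDl; congr (_ *: _); ring. Qed.

Lemma scaleD_swap (K : numFieldType) (V : lmodType K) (e x y : K) (u w : V) :
  e *: (x *: u + y *: w) = x *: (e *: u) + y *: (e *: w).
Proof. by rewrite scalerDr !scalerA !(mulrC e). Qed.

Section LatticeVertex.
Variables (R : realType) (n : nat) (L : even_lattice R n) (ep : cocycle L).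
Local Notation C := (complex R).
Local Notation fock := (fock R n).
Local Notation ket := (@ket R n).
Local Notation h := (hmode L).
Local Notation bihom := (@bihom R n L).
Local Notation E := (vexp ep).
Local Notation T := (transl h).
Implicit Types (v w : fock) (a c : 'rV[int]_n) (i j : 'I_n).

Definition avec a i : C := (lvec L a 0 i)%:C%C.

Lemma avecD a c i : avec (a + c) i = avec a i + avec c i.
Proof. by rewrite /avec lvecD mxE rmorphD. Qed.

Lemma avec_dot a c : \sum_i avec a i * avec c i = (ldot L a c)%:~R.
Proof.
transitivity ((dot (lvec L a) (lvec L c))%:C%C : C).
  by rewrite /dot rmorph_sum; apply: eq_bigr => i _; rewrite rmorphM.
by rewrite -ldotE rmorph_int.
Qed.

Let hf := @heis_field R n L.
Let hc := @heis_comm R n L.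
Let hl := @heis_linear R n L.

Lemma exp_minusE a : exp_minus L a = emin h (avec a).
Proof. by rewrite /emin /lh hmode.unlock. Qed.

Lemma exp_plusE a : exp_plus L a = eplus h (avec a).
Proof. by rewrite /eplus /lh hmode.unlock. Qed.

Lemma opser_exp_bihom (f : opser fock) (s : int) :
  (forall q d c v, bihom d c v -> bihom (d + s * q%:Z) c (f q v)) ->
  forall q d c v, bihom d c v -> bihom (d + s * q%:Z) c (opser_exp f q v).
Proof.
move=> fh q d c v vh; apply: bihom_sum => r _; apply: bihomZ.
move: (nat_of_ord r) => {}r; elim: r q => [|r IHr] q.
  by case: q => [|q]; [rewrite mulr0 addr0 | apply: bihom0].
apply: bihom_sum => i _; have := fh i _ _ _ (IHr (q - i)%N).
by congr bihom; have := ltn_ord i; rewrite ltnS => iq; rewrite -addrA -mulrDr -PoszD subnK.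
Qed.

Lemma lh_bihom a k d c v : bihom d c v -> bihom (d - k) c (lh h (avec a) k v).
Proof. by move=> vh; apply: bihom_sum => i _; apply/bihomZ/heis_bihom. Qed.

Lemma emin_bihom a q d c v : bihom d c v -> bihom (d + q%:Z) c (emin h (avec a) q v).
Proof.
move=> vh; have := @opser_exp_bihom _ 1 _ q _ _ _ vh; rewrite mul1r; apply.
move=> {vh v d c q} [|q] d c v vh; first exact: bihom0.
by apply: bihomZ; rewrite mul1r -[q.+1%:Z]opprK; apply: lh_bihom.
Qed.

Lemma eplus_bihom a q d c v : bihom d c v -> bihom (d - q%:Z) c (eplus h (avec a) q v).
Proof.
move=> vh; have := @opser_exp_bihom _ (-1) _ q _ _ _ vh; rewrite mulN1r; apply.
move=> {vh v d c q} [|q] d c v vh; first exact: bihom0.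
by rewrite -scaleNr; apply: bihomZ; rewrite mulN1r; apply: lh_bihom.
Qed.

Lemma eplus_trunc a v : evz (fun q => eplus h (avec a) q v).
Proof.
apply: (@fock_sum_ind R n (fun v => evz (fun q => eplus h (avec a) q v))).
- by exists 0%N => q _; rewrite (lin0 (eplus_linear hf _ q)).
- move=> z x y [M xM] [N yN]; exists (maxn M N) => q; rewrite geq_max => /andP[qM qN].
  by rewrite (eplus_linear hf) xM // yN // scaler0 addr0.
- move=> [m c] _; have := @bihomU R n L m c; move: (wt _ _) => d hb.
  exists `|d|.+1 => q qd; apply: (bihom_neg (@eplus_bihom a q _ _ _ hb)); lia.
Qed.

Lemma vert_bihom a s d c v : bihom d c v -> bihom (d + s) c (vert h (avec a) s v).
Proof.
move=> vh; apply: bihom_nsum => q.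
have := @eplus_bihom a q _ _ _ vh; set u := eplus _ _ _ _ => uh.
case qs : (q%:Z + s) => [p|p] /=; last exact: bihom0.
by have := @emin_bihom a p _ _ _ uh; congr bihom; rewrite -qs; lia.
Qed.

Lemma vexpE a k m c : E a k (ket (m, c)) =
  (ep a c)%:~R *: vert h (avec a) (- k - 1 - ldot L a c) (ket (m, a + c)).
Proof.
rewrite vexp.unlock /Yexp fock_liftE /=; congr (_ *: _).
have -> : << (m, a + c) >> = ket (m, a + c) by rewrite ket.unlock.
rewrite exp_minusE exp_plusE.
rewrite (fsbig_antidiagonal (fun p q => emin h (avec a) p (eplus h (avec a) q _))).
by apply: eq_nsum => q; rewrite -addrA; case: (_ + _).
Qed.

Lemma vexp_linear a k : linear (E a k).
Proof. by rewrite vexp.unlock; apply: fock_lift_linear. Qed.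

Lemma vexp_homog a : homog L (qf L a) a (E a).
Proof.
move=> k d c v vh; apply: (bihom_lin (vexp_linear a k) vh) => m wm.
rewrite vexpE; apply: bihomZ.
have := @vert_bihom a (- k - 1 - ldot L a c) _ _ _ (@bihomU R n L m (a + c)).
by congr bihom; move: wm; rewrite /wt /= qfD; lia.
Qed.

Lemma vexp_field a : field (E a).
Proof. exact: (homog_field (vexp_linear a) (@vexp_homog a)). Qed.

(** The zero mode sees the charge a + c of the result instead of c; the other modes
    are handled by [vert_comm]. *)
Lemma vexp_primary a : primary h (avec a) (E a).
Proof.
move=> i k p v; have El := vexp_linear a.
apply: (fock_ext (f := fun v => h i k (E a p v))
  (g := fun v => E a p (h i k v) + avec a i *: E a (p + k) v)).
- exact: lin_comp.
- by apply: lin_add; [exact: lin_comp | exact: lin_scale].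
move=> {v} [m c]; rewrite !vexpE (linZ _ _ (hl _ _)).
rewrite (vert_comm hf hc (eplus_trunc a)).
have [->|k0] := eqVneq k 0.
  rewrite !heis0 !addr0 (linZ _ _ (vert_linear hf (eplus_trunc a) _)).
  rewrite (linZ _ _ (El _)) vexpE -/(avec c i) -/(avec (a + c) i) avecD.
  exact: scale_swap.
have [z [m' hm]] := heis_shift L i m k0; rewrite !hm.
rewrite (linZ _ _ (vert_linear hf (eplus_trunc a) _)) (linZ _ _ (El _)) vexpE.
rewrite (_ : - (p + k) - 1 - ldot L a c = - p - 1 - ldot L a c - k); last by lia.
by apply: scaleD_swap.
Qed.

End LatticeVertex.

Lemma addr_scale_eq0 (K : numFieldType) (V : lmodType K) (x y : V) (z : K) :
  y = 0 -> x + z *: y = x.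
Proof. by move=> ->; rewrite scaler0 addr0. Qed.

(** * Locality of the vertex operators *)
Section PrimaryRelations.
Variables (K : numFieldType) (V : lmodType K) (n : nat).
Variable h : 'I_n -> opfield V.
Hypothesis hf : forall i, field (h i).

Lemma primary_lh (a c : 'I_n -> K) E : field E -> primary h a E ->
  forall k p v, E p (lh h c k v) =
    lh h c k (E p v) - (\sum_i a i * c i) *: E (p + k) v.
Proof.
move=> [El _] aE k p v; rewrite /lh (lin_sum _ _ _ (El p)) scaler_suml -sumrB.
apply: eq_bigr => i _; rewrite (linZ _ _ (El p)) aE scalerDr scalerA.
by rewrite [a i * c i]mulrC addrK.
Qed.

Lemma covariant_defect (T : V -> V) (E : opfield V) :
  (forall p v, T (E p v) - E p (T v) + p%:~R *: E (p - 1) v = 0) ->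
  covariant T E.
Proof.
move=> H p v; apply/eqP; rewrite -subr_eq0; apply/eqP; rewrite -[RHS](H p v).
by rewrite opprB addrCA addrC.
Qed.

(** Here w stands for e^c, which T - c(-1) kills.  Moving this operator through B and
    through A relates consecutive modes of both. *)
Lemma vertex_recursion (T : V -> V) (A B : opfield V) (a b c : 'I_n -> K) w :
  field A -> field B -> primary h a A -> primary h b B ->
  covariant T A -> covariant T B -> T w = lh h c (-1) w ->
  forall m p, let u := B (p + 1) w in
  (- (p + 1)%:~R - \sum_i b i * c i) *: A m (B p w) =
    T (A m u) - lh h c (-1) (A m u)
    + (m%:~R + \sum_i a i * c i) *: A (m - 1) u.
Proof.
move=> fA fB aA bB cA cB Tw m p u.
have [Al Bl] := (proj1 fA, proj1 fB).
have E : (- (p + 1)%:~R - \sum_i b i * c i) *: B p w = T u - lh h c (-1) u.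
  rewrite /u cB Tw (primary_lh c fB bB) addrK scalerBl scaleNr.
  by rewrite [RHS](ACl (1*4*(3*2)))%AC /= subrr add0r.
rewrite -(linZ _ (B p w) (Al m)) E (linB _ _ (Al _)) (primary_lh c fA aA) cA.
rewrite scalerDl opprB.
set x := A m (T u); set y := m%:~R *: _; set z := lh _ _ _ _; set s := _ *: A _ u.
by rewrite !addrA [RHS](ACl (1*5*3*(4*2)))%AC /= subrr addr0.
Qed.

(** On each antidiagonal m + p = M, multiplication by z - w is a difference operator,
    and the function is polynomial of degree N in p. *)
Lemma iter_dlt_binz (k : K) (M e : int) (N : nat) m p :
  iter N.+1 (@dlt K K^o) (fun m p => k * (m + p == M)%:R * binz K (e - p) N) m p = 0.
Proof.
pose g j m p : K := k * (m + p + j%:Z == M)%:R * binz K (e - p - j%:Z) (N - j)%N.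
have H j : (j <= N)%N -> iter j (@dlt K K^o)
    (fun m p => k * (m + p == M)%:R * binz K (e - p) N) = g j.
  elim: j => [|j IHj] jN.
    by do 2!apply: funext => ?; rewrite /g !(addr0, subr0) subn0.
  rewrite iterS IHj; last by lia.
  apply: funext => x; apply: funext => y; rewrite /dlt /g.
  have -> : x + 1 + y + j%:Z = x + y + j.+1%:Z by lia.
  have -> : x + (y + 1) + j%:Z = x + y + j.+1%:Z by lia.
  have -> : e - y - j%:Z = e - y - j.+1%:Z + 1 by lia.
  have -> : e - (y + 1) - j%:Z = e - y - j.+1%:Z by lia.
  have -> : (N - j = (N - j.+1).+1)%N by lia.
  by rewrite -mulrBr binzS; set A := binz K _ _.+1; rewrite [A + _]addrC addrK.
rewrite iterS H // /dlt /g subnn !binz0r.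
have -> : m + 1 + p + N%:Z = m + (p + 1) + N%:Z by lia.
exact: subrr.
Qed.

End PrimaryRelations.

Section Locality.
Variables (R : realType) (n : nat) (L : even_lattice R n) (ep : cocycle L).
Local Notation C := (complex R).
Local Notation fock := (fock R n).
Local Notation ket := (@ket R n).
Local Notation h := (hmode L).
Local Notation bihom := (@bihom R n L).
Local Notation E := (vexp ep).
Local Notation T := (transl h).
Local Notation avec := (avec L).
Implicit Types (v w : fock) (a b c : 'rV[int]_n) (i j : 'I_n).

Let hf := @heis_field R n L.
Let hc := @heis_comm R n L.
Let hl := @heis_linear R n L.

Lemma transl_bihom d c v : bihom d c v -> bihom (d + 1) c (T v).
Proof.
move=> vh; apply: bihom_sum => i _; apply: bihom_nsum => q.
have := @heis_bihom R n L i (Negz q) _ _ _ (@heis_bihom R n L i q%:Z _ _ _ vh).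
by congr bihom; lia.
Qed.

(** No component along the highest weight vectors e^c; creation operators only
    produce such vectors. *)
Definition topless v : Prop := forall c, v@_(mset0, c) = 0.

Lemma topless0 : topless 0.
Proof. by move=> c; rewrite mcoeff0. Qed.

Lemma toplessD v w : topless v -> topless w -> topless (v + w).
Proof. by move=> v0 w0 c; rewrite mcoeffD v0 w0 addr0. Qed.

Lemma toplessZ (z : C) v : topless v -> topless (z *: v).
Proof. by move=> v0 c; rewrite mcoeffZ v0 mulr0. Qed.

Lemma topless_sum (I : Type) (r : seq I) (P : pred I) (F : I -> fock) :
  (forall x, P x -> topless (F x)) -> topless (\sum_(x <- r | P x) F x).
Proof. by move=> F0; apply: big_ind => //; [exact: topless0 | exact: toplessD]. Qed.

Lemma topless_heis i p v : topless (h i (Negz p) v).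
Proof.
move=> c; apply: (fock_ext (W := C^o) (f := fun v => (h i (Negz p) v)@_(mset0, c))
  (g := fun=> 0)) => [||[m c']].
- by move=> z x y; rewrite hl coef_linear.
- by move=> z x y; rewrite scaler0 addr0.
rewrite heisN coef_ket; case: eqP => // -[E _]; have := mset1DE (i, p) m (i, p).
by rewrite E mset0E eqxx.
Qed.

Lemma topless_transl v : topless (T v).
Proof.
apply: topless_sum => i _; apply: topless_sum => q _; exact: topless_heis.
Qed.

Lemma topless_lh a p v : topless (lh h (avec a) (Negz p) v).
Proof. by apply: topless_sum => i _; apply/toplessZ/topless_heis. Qed.

Lemma top_Emin a s v c : (Emin h (avec a) s v)@_(mset0, c) =
  (s == 0)%:R * v@_(mset0, c).
Proof.
case: s => [[|p]|p]; first by rewrite /= /emin opser_exp0 mul1r.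
  rewrite mul0r; apply: topless_sum => r _; apply: toplessZ.
  case: (nat_of_ord r) => [|{}r] /=; first exact: topless0.
  by apply: topless_sum => -[[|q] qp] _ /=; [exact: topless0 | apply/toplessZ/topless_lh].
by rewrite /= mcoeff0 mul0r.
Qed.

Lemma heis_vacuum i (q : nat) c : h i q.+1%:Z (ket (mset0, c)) = 0.
Proof. by rewrite heisP mset0E muln0 scale0r. Qed.

Lemma transl_vacuum c : T (ket (mset0, c)) = lh h (avec c) (-1) (ket (mset0, c)).
Proof.
apply: eq_bigr => i _; rewrite (@nsum_delta _ _ 0%N) => [|[|q] // _]; last first.
  by rewrite heis_vacuum (lin0 (hl _ _)).
by rewrite heis0 (linZ _ _ (hl _ _)).
Qed.

Lemma eplus_vacuum a q c : eplus h (avec a) q (ket (mset0, c)) =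
  if q is 0%N then ket (mset0, c) else 0.
Proof.
case: q => [|q]; first exact: opser_exp0.
rewrite /eplus /opser_exp big1 // => r _; move: (nat_of_ord r) => {}r.
set f : opser fock := fun _ _ => _; have fl k : linear (f k).
  case: k => [|k]; first by move=> z x y; rewrite scaler0 addr0.
  by apply/lin_opp/lin_scale/lh_linear.
have f0 k : f k (ket (mset0, c)) = 0.
  case: k => [|k] //; rewrite /f /lh big1 ?scaler0 ?oppr0 // => i _.
  by rewrite heis_vacuum scaler0.
have fr r' k : opser_pow f r' k (ket (mset0, c)) =
    if (r' == 0%N) && (k == 0%N) then ket (mset0, c) else 0.
  elim: r' k => [|r' IHr] k; first by case: k.
  rewrite /= /opser_mul big1 // => i _; rewrite -/(opser_pow f r') IHr.
  by case: ifP => _; rewrite ?f0 ?(lin0 (fl _)).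
by rewrite fr andbF scaler0.
Qed.

Lemma vexp_vacuum a k c : E a k (ket (mset0, c)) =
  (ep a c)%:~R *: Emin h (avec a) (- k - 1 - ldot L a c) (ket (mset0, a + c)).
Proof.
rewrite vexpE /vert (@nsum_delta _ _ 0%N) => [|[|q] // _].
  by rewrite eplus_vacuum add0r.
by rewrite eplus_vacuum (lin0 (Emin_linear hf _ _)).
Qed.

Lemma top_vexp a k c c' : (E a k (ket (mset0, c)))@_(mset0, c') =
  (ep a c)%:~R * (k == - 1 - ldot L a c)%:R * (c' == a + c)%:R.
Proof.
rewrite vexp_vacuum mcoeffZ top_Emin coef_ket xpair_eqE eqxx /= mulrA [c' == _]eq_sym.
by congr (_ * _%:R * _); congr nat_of_bool; apply/eqP/eqP; lia.
Qed.

(** By [heis_unique], only the coefficients at highest weight vectors matter.  There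
    T, being a sum of creation operators times others, contributes nothing, and
    T e^c = c(-1) e^c evaluates the remaining terms. *)
Lemma vexp_covariant a : covariant T (E a).
Proof.
apply: covariant_defect => p v.
have Tl := transl_linear hf; have El := vexp_linear ep a.
pose D p v : fock := T (E a p v) - E a p (T v) + p%:~R *: E a (p - 1) v.
apply: (@heis_unique R n L int (fun p => qf L a - p) D) => {p v}.
- move=> p; apply: lin_add; last exact: lin_scale.
  by apply: lin_add; [exact: lin_comp | apply/lin_opp/lin_comp].
- move=> i k p v k0 D0.
  have H : h i k (D p v) = D p (h i k v) + avec a i *: D (p + k) v.
    exact: (primary_defect hf hc (vexp_field ep a) (@vexp_primary R n L ep a)).
  have D0' : D (p + k) v = 0 by apply: D0; lia.
  exact: etrans H (@addr_scale_eq0 _ fock _ _ _ D0').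
- move=> p c; exists (a + c).
  have vh := @bihomU R n L mset0 c; rewrite wt_zero in vh.
  apply: bihomD; first apply: bihomD.
  + by have := transl_bihom (@vexp_homog R n L ep a p _ _ _ vh); congr bihom; lia.
  + rewrite -scaleN1r; apply: bihomZ.
    by have := @vexp_homog R n L ep a p _ _ _ (transl_bihom vh); congr bihom; lia.
  + apply: bihomZ.
    by have := @vexp_homog R n L ep a (p - 1) _ _ _ vh; congr bihom; lia.
- move=> p c c'; rewrite /D transl_vacuum.
  rewrite (primary_lh (avec c) (vexp_field ep a) (@vexp_primary R n L ep a)).
  have tp (x y z : fock) (s q : C) : x@_(mset0, c') = 0 -> z@_(mset0, c') = 0 ->
      (x - (z - s *: y) + q *: y)@_(mset0, c') = (s + q) * y@_(mset0, c').
    move=> x0 z0.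
    have cf (u w : fock) : (x - (z - u) + w)@_(mset0, c') = u@_(mset0, c') + w@_(mset0, c').
      by rewrite mcoeffD !mcoeffB x0 z0 !sub0r opprK.
    by rewrite cf mulrDl; congr (_ + _); exact: mcoeffZ.
  rewrite tp; [|exact: topless_transl|exact: topless_lh].
  rewrite top_vexp avec_dot -intrD.
  have [pc|_] := eqVneq (p - 1) (- 1 - ldot L a c); last by rewrite mulr0 mul0r mulr0.
  by rewrite (_ : _ + _ = 0) ?mul0r //; lia.
Qed.

End Locality.

Lemma factor_sub (K : numFieldType) (x y z s t u : K) :
  x * y * z * t - s * x * y * z * u = x * y * z * (t - s * u).
Proof. ring. Qed.

Section ExpLocality.
Variables (R : realType) (n : nat) (L : even_lattice R n) (ep : cocycle L).
Local Notation C := (complex R).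
Local Notation fock := (fock R n).
Local Notation ket := (@ket R n).
Local Notation h := (hmode L).
Local Notation bihom := (@bihom R n L).
Local Notation E := (vexp ep).
Local Notation T := (transl h).
Local Notation avec := (avec L).
Implicit Types (v w : fock) (a b c : 'rV[int]_n) (i j : 'I_n).

Let hf := @heis_field R n L.
Let hc := @heis_comm R n L.
Let hl := @heis_linear R n L.

Lemma top_recursion a b c c' (m p : int) :
  let t m p := (E a m (E b p (ket (mset0, c))))@_(mset0, c') in
  (- (p + 1) - ldot L b c)%:~R * t m p =
  (m + ldot L a c)%:~R * t (m - 1) (p + 1).
Proof.
move=> t.
have := vertex_recursion (vexp_field ep a) (vexp_field ep b) (@vexp_primary R n L ep a)
  (@vexp_primary R n L ep b) (@vexp_covariant R n L ep a) (@vexp_covariant R n L ep b)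
  (transl_vacuum L c) m p.
rewrite /= !avec_dot -intrN -intrB -intrD /t.
move: (E a m (E b p _)) (E b (p + 1) _) => u w.
move: (topless_transl L (E a m w) c') (topless_lh L c 0 (E a m w) c').
move: (T _) (lh _ _ _ _) (E a (m - 1) w) => x y z x0 y0 H.
rewrite -[LHS](mcoeffZ _ u) H mcoeffD mcoeffB x0 y0 subrr add0r.
exact: mcoeffZ.
Qed.

(** The recursion [top_recursion] is that of the binomial series (1 - w/z)^(a|b), and
    its first term comes from the leading term ep(b, c) w^(b|c) e^(b+c) of
    Y(e^b, w) e^c. *)
Lemma top_prod a b c c' (m p : int) :
  (E a m (E b p (ket (mset0, c))))@_(mset0, c') =
  (ep b c * ep a (b + c))%:~R * (c' == a + (b + c))%:R *
  (m + p == - 2 - ldot L b c - ldot L a (b + c))%:R *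
  altbin C (ldot L a b) (- 1 - ldot L b c - p).
Proof.
have [p0|p0] := ltP (- 1 - ldot L b c - p) 0.
  rewrite altbin_neg // mulr0 vexp_vacuum (linZ _ _ (vexp_linear ep a m)).
  case s : (- p - 1 - ldot L b c) => [q|q]; first by lia.
  by rewrite /= (lin0 (vexp_linear ep a m)) scaler0 mcoeff0.
have -> : p = - 1 - ldot L b c - `|(- 1 - ldot L b c - p)%R|%N%:Z by lia.
move: `|_|%N => {p p0} k; elim: k m => [|k IHk] m.
  rewrite subr0 subrr /= expr0 binz0r !mulr1 vexp_vacuum (linZ _ _ (vexp_linear ep a m)).
  rewrite (_ : - _ - 1 - ldot L b c = 0); last by lia.
  rewrite /= /emin opser_exp0 mcoeffZ top_vexp intrM !mulrA -!mulrA; congr (_ * _).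
  rewrite mulrA mulrAC -mulrA; congr (_ * (_ * _%:R)); congr nat_of_bool.
  by apply/eqP/eqP; lia.
have kn0 : k.+1%:R != 0 :> C by rewrite pnatr_eq0.
apply: (mulfI kn0).
have := top_recursion a b c c' m (- 1 - ldot L b c - k.+1%:Z).
rewrite (_ : - 1 - ldot L b c - k.+1%:Z + 1 = - 1 - ldot L b c - k%:Z); last by lia.
rewrite /= IHk (_ : - (- 1 - ldot L b c - k%:Z) - ldot L b c = k.+1%:Z); last by lia.
rewrite -pmulrn => ->.
rewrite (_ : m - 1 + (- 1 - ldot L b c - k%:Z) = m + (- 1 - ldot L b c - k.+1%:Z));
  last by lia.
rewrite (_ : - 1 - ldot L b c - (- 1 - ldot L b c - k.+1%:Z) = k%:Z + 1); last by lia.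
rewrite (_ : - 1 - ldot L b c - (- 1 - ldot L b c - k%:Z) = k%:Z); last by lia.
rewrite mulrCA [RHS]mulrCA.
have [M|_] := eqVneq (m + (- 1 - ldot L b c - k.+1%:Z)) (- 2 - ldot L b c - ldot L a (b + c));
  last by rewrite mulr0 !mul0r.
congr (_ * _); have := altbinS C (ldot L a b) k%:Z.
rewrite -PoszD addn1 -pmulrn => ->; congr (_%:~R * _).
by move: M; rewrite ldotDr; lia.
Qed.

Lemma coef_iter_dlt (f : int -> int -> fock) (b : fock_index n) (N : nat) (m p : int) :
  (iter N (@dlt _ fock) f m p)@_b =
  iter N (@dlt C C^o) (fun m p => (f m p)@_b) m p.
Proof.
elim: N m p => [|N IHN] m p //=; rewrite {1}/dlt.
by rewrite [RHS]/dlt -!IHN; exact: mcoeffB.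
Qed.

(** The sign (-1)^(a|b) between the two orders of the product is exactly the one
    between (z - w)^(a|b) and (w - z)^(a|b). *)
Lemma eps_swap a b c :
  (ep a c * ep b (a + c))%:~R = (-1) ^ ldot L a b * (ep b c * ep a (b + c))%:~R :> C.
Proof.
rewrite -!eps_cocycle [b + a]addrC !intrM mulrA; congr (_ * _).
have := eps_comm ep a b; set s := (-1) ^ _ => sE.
have -> : (-1) ^ ldot L a b = (ep a b * ep b a)%:~R :> C.
  by rewrite sE /s rmorphXz ?unitrN1 // mulrN1z.
by rewrite -intrM; congr (_%:~R); case: (eps_sign ep a b) => ->; lia.
Qed.

(** By [heis_unique] it suffices to treat the coefficients at highest weight vectors.
    By [top_prod] they are those of the difference of the two expansions of
    (1 - w/z)^(a|b): zero if (a|b) >= 0, and otherwise polynomial of degree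
    -(a|b) - 1 along the antidiagonals, hence killed by (z - w)^(-(a|b)). *)
Lemma vexp_loc a b : loc (E a) (E b).
Proof.
pose N : nat := if ldot L a b < 0 then `|ldot L a b|%N else 0%N.
exists N => m p v.
pose F (x : int * int) := bor (E a) (E b) N%:Z x.1 x.2.
have [fa fb] := (vexp_field ep a, vexp_field ep b).
apply: (@heis_unique R n L (int * int)
  (fun x => qf L a + qf L b - x.1 - x.2 - N%:Z - 2) F _ _ _ _ (m, p) v) => {m p v}.
- by move=> x; apply: bor_linear.
- move=> i k [m p] v k0 F0.
  have H := primary_bor hf fa fb (@vexp_primary R n L ep a) (@vexp_primary R n L ep b) N i k m p v.
  rewrite -[h i k _]/(h i k (bor (E a) (E b) N%:Z m p v)) H.
  have F1 : bor (E a) (E b) N%:Z (m + k) p v = 0 by apply: (F0 (m + k, p)) => /=; lia.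
  have F2 : bor (E a) (E b) N%:Z m (p + k) v = 0 by apply: (F0 (m, p + k)) => /=; lia.
  by rewrite F1 F2 2!scaler0 2!addr0.
- move=> [m p] c; exists (a + b + c).
  have vh := @bihomU R n L mset0 c; rewrite wt_zero in vh.
  have := @homog_bor _ _ _ _ _ _ _ _ _ N%:Z m p _ _ _
    (@vexp_homog R n L ep a) (@vexp_homog R n L ep b) vh.
  by congr bihom => /=; lia.
move=> [m p] c c'; rewrite /F /= bor_iter // coef_iter_dlt.
pose M := - 2 - ldot L b c - ldot L a (b + c).
pose k : C := (ep b c * ep a (b + c))%:~R * (c' == a + (b + c))%:R.
pose x := ldot L a b; pose e := - 1 - ldot L b c.
have Ft (y z : int) : (E a y (E b z (ket (mset0, c))) -
    E b z (E a y (ket (mset0, c))))@_(mset0, c') =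
    k * (y + z == M)%:R * (altbin C x (e - z) - (-1) ^ x * altbin C x (x - (e - z))).
  rewrite mcoeffB top_prod top_prod (eps_swap a b c) -/x.
  rewrite (_ : b + (a + c) = a + (b + c)); last by rewrite addrCA.
  rewrite (ldotC _ b a) -/x [z + y]addrC.
  rewrite (_ : - 2 - ldot L a c - ldot L b (a + c) = M); last first.
    by rewrite /M !ldotDr (ldotC _ b a); lia.
  rewrite -/M -/k -/e; have [yz|_] := eqVneq (y + z) M; last by rewrite !mulr0 !mul0r subrr.
  rewrite (_ : - 1 - ldot L a c - y = x - (e - z)); last first.
    by move: yz; rewrite /M /e /x ldotDr; lia.
  exact: factor_sub.
have -> : (fun m p => (E a m (E b p (ket (mset0, c))) -
    E b p (E a m (ket (mset0, c))))@_(mset0, c')) =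
    (fun m p => k * (m + p == M)%:R * (altbin C x (e - p) - (-1) ^ x * altbin C x (x - (e - p)))).
  by do 2!apply: funext => ?; apply: Ft.
rewrite /N -/x; have [x0|x0] := ltP x 0; last by rewrite /= altbin_sub_ge0 ?mulr0.
have -> : `|x|%N = (`|x|.-1).+1 by lia.
have xE : x = - (`|x|.-1).+1%:Z by lia.
rewrite -[RHS](iter_dlt_binz k M (e + `|x|.-1%:Z) `|x|.-1 m p).
congr (iter _ _ _ m p); apply: funext => y; apply: funext => z; congr (_ * _).
have := altbin_sub_lt0 C `|x|.-1 (e - z); rewrite -xE => ->; congr binz; lia.
Qed.

End ExpLocality.

(** * Normally ordered products as residue products *)
Section NormalOrdering.
Variables (K : numFieldType) (V : lmodType K).
Implicit Types (A X : opfield V) (v : V).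

(** The products with negative index are the normally ordered ones: (z - w)^(-p-1)
    expanded in either region produces the modes of the p-th divided derivative. *)
Lemma nop_nprod (p : nat) A X : field A -> field X ->
  nop (dfield p A) X = nprod A X (- p%:Z - 1).
Proof.
move=> fA fX; apply: funext => k; apply: funext => v.
rewrite /nop /nprod /bor -!/(nsum _); congr (_ + _).
  apply: eq_nsum => j; rewrite /dfield; congr (_ *: A _ _); last by lia.
  rewrite binz_opp (_ : p%:Z - (- j%:Z - 1) - 1 = (j + p)%N%:Z); last by lia.
  rewrite (_ : j%:Z - 1 - (- p%:Z - 1) = (j + p)%N%:Z); last by lia.
  by rewrite !binz_nat -(bin_sub (leq_addl j p)) addnK.
pose G (j : nat) := X (k - p%:Z - j%:Z - 1) (binz K (- j%:Z - 1) p *: A j%:Z v).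
have [N AN] := proj2 fA v.
have Gz : evz G.
  exists `|N|%N => j jN; rewrite /G AN ?scaler0 ?(lin0 (proj1 fX _)) //; lia.
rewrite (eq_nsum (G := fun j => if (p <= j)%N then G (j - p)%N else 0)); last first.
  move=> j; rewrite /dfield; case: leqP => pj.
    rewrite /G (_ : k - p%:Z - (j - p)%N%:Z - 1 = k - j%:Z - 1); last by lia.
    rewrite (_ : - (j - p)%N%:Z - 1 = p%:Z - j%:Z - 1); last by lia.
    by rewrite (_ : (j - p)%N%:Z = j%:Z - p%:Z) //; lia.
  have -> : p%:Z - j%:Z - 1 = (p - j.+1)%N%:Z by lia.
  by rewrite binz_nat bin_small ?scale0r ?(lin0 (proj1 fX _)) //; lia.
rewrite nsum_shift // /halfbor /binsum -scaleNr -nsumZ; last first.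
  by apply: evzZ; apply field_evz.
apply: eq_nsum => j; rewrite /G (linZ _ _ (proj1 fX _)) scalerA add0r.
rewrite (_ : k + (- p%:Z - 1) - j%:Z = k - p%:Z - j%:Z - 1); last by lia.
congr (_ *: _); rewrite binz_opp [LHS]binz_oppC.
rewrite (_ : p%:Z - 1 - (- j%:Z - 1) = (j + p)%N%:Z); last by lia.
rewrite (_ : j%:Z - 1 - (- p%:Z - 1) = (j + p)%N%:Z); last by lia.
rewrite !binz_nat -(bin_sub (leq_addl j p)) addnK; congr (_ * _).
rewrite (_ : - p%:Z - 1 = - p.+1%:Z); last by lia.
by rewrite -exprnN exprS mulN1r invrN invr_sign opprK.
Qed.

Definition idfield : opfield V := fun k v => if k == -1 then v else 0.

Lemma idfield_field : field idfield.
Proof.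
split=> [k c u v|v]; first by rewrite /idfield; case: ifP; rewrite ?scaler0 ?addr0.
by exists 0 => k k0; rewrite /idfield; case: eqP => // k1; move: k0; rewrite k1.
Qed.

Lemma nprod_id A : field A -> nprod A idfield (-1) = A.
Proof.
move=> fA; apply: funext => k; apply: funext => v; rewrite /nprod /bor /halfbor /binsum.
have c1 (j : nat) : (-1) ^+ j * binz K (-1) j = 1.
  by rewrite binz_opp (_ : j%:Z - 1 - -1 = j%:Z) ?binz_nat ?binn //; lia.
have Al := proj1 fA.
have [k0|k0] := leP 0 k.
  rewrite nsum0; last first.
    move=> j; rewrite /idfield ifF ?(lin0 (Al _)) ?scaler0 //; apply/eqP; lia.
  rewrite (nsum_delta (q0 := `|k|%N)) => [|j jk]; last first.
    by rewrite /idfield ifF ?scaler0 //; apply/eqP; lia.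
  rewrite c1 scale1r /idfield ifT; last by apply/eqP; lia.
  rewrite sub0r -scaleNr (_ : (-1) ^ (-1) = -1 :> K) ?opprK ?scale1r; last first.
    by rewrite exprN1 invrN1.
  by congr (A _ v); lia.
rewrite [X in _ - _ *: X]nsum0 ?scaler0 ?subr0; last first.
  by move=> j; rewrite /idfield ifF ?scaler0 //; apply/eqP; lia.
rewrite (nsum_delta (q0 := `|- 1%:Z - k|%N)) => [|j jk]; last first.
  by rewrite /idfield ifF ?(lin0 (Al _)) ?scaler0 //; apply/eqP; lia.
rewrite c1 scale1r /idfield ifT; last by apply/eqP; lia.
by congr (A _ v); lia.
Qed.

Lemma nprod_square A v : field A ->
  nprod A A (-1) 1 v = A 0 (A 0 v) + 2 *: nsum (fun q : nat => A (Negz q) (A q.+1%:Z v)).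
Proof.
move=> fA; rewrite /nprod /bor /halfbor /binsum.
have c1 (j : nat) : (-1) ^+ j * binz K (-1) j = 1.
  by rewrite binz_opp (_ : j%:Z - 1 - -1 = j%:Z) ?binz_nat ?binn //; lia.
rewrite (_ : (-1) ^ (-1) = -1 :> K) ?scaleN1r ?opprK; last by rewrite exprN1 invrN1.
pose F (q : nat) := A (Negz q) (A q.+1%:Z v).
pose G (q : nat) := A (- q%:Z) (A q%:Z v).
have [N AN] := proj2 fA v.
have Gz : evz G by exists `|N|%N => q qN; rewrite /G AN ?(lin0 (proj1 fA _)) //; lia.
have -> : nsum (fun j : nat => ((-1) ^+ j * binz K (-1) j) *:
    A (0 - 1 - j%:Z) (A (1 + j%:Z) v)) = nsum F.
  apply: eq_nsum => j; rewrite c1 scale1r /F.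
  by congr (A _ (A _ v)); lia.
have -> : nsum (fun j : nat => ((-1) ^+ j * binz K (-1) j) *:
    A (1 - 1 - j%:Z) (A (0 + j%:Z) v)) = nsum G.
  apply: eq_nsum => j; rewrite c1 scale1r /G.
  by congr (A _ (A _ v)); lia.
rewrite (nsum_recl Gz) {1}/G oppr0 addrCA scaler_nat mulr2n; congr (_ + (_ + _)).
Qed.

End NormalOrdering.

(** * The state-field correspondence *)
Section NumberOperator.
Variables (K : numFieldType) (V : lmodType K) (n : nat).
Variable h : 'I_n -> opfield V.
Hypothesis hf : forall i, field (h i).
Hypothesis hc : forall i k j l v, h i k (h j l v) = h j l (h i k v) +
  (if (i == j) && (k + l == 0) then k%:~R else 0) *: v.
Implicit Types (i j : 'I_n) (v : V).

(** The part of L(0) without zero modes; it counts oscillators with their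
    degrees. *)
Definition numop v : V := \sum_i nsum (fun q : nat => h i (Negz q) (h i q.+1%:Z v)).

Lemma numop_heis j p v : numop (h j (Negz p) v) =
  h j (Negz p) (numop v) + p.+1%:R *: h j (Negz p) v.
Proof.
have hl i k : linear (h i k) by exact: (proj1 (hf i)).
rewrite /numop (lin_sum _ _ _ (hl j _)).
have H i : nsum (fun q : nat => h i (Negz q) (h i q.+1%:Z (h j (Negz p) v))) =
    h j (Negz p) (nsum (fun q : nat => h i (Negz q) (h i q.+1%:Z v))) +
    (if i == j then p.+1%:R *: h j (Negz p) v else 0).
  have [N hN] := proj2 (hf i) v.
  have z1 : evz (fun q : nat => h i (Negz q) (h i q.+1%:Z v)).
    by exists `|N|%N => q qN; rewrite hN ?(lin0 (hl _ _)) //; lia.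
  rewrite (nsum_lin (hl j _)) //.
  pose c (q : nat) : K := if (i == j) && (q.+1%:Z + Negz p == 0) then q.+1%:Z%:~R else 0.
  have E (q : nat) : h i (Negz q) (h i q.+1%:Z (h j (Negz p) v)) =
      h j (Negz p) (h i (Negz q) (h i q.+1%:Z v)) + c q *: h i (Negz q) v.
    rewrite [h i q.+1%:Z _]hc (linD _ _ (hl _ _)) (linZ _ _ (hl _ _)) [h i (Negz q) (h j _ _)]hc.
    by rewrite andbF scale0r addr0.
  have d : forall q : nat, q != p -> c q *: h i (Negz q) v = 0.
    by move=> q qp; rewrite /c ifF ?scale0r //; apply/negbTE/negP; lia.
  rewrite (eq_nsum E) nsumD; first last.
  - by exists p.+1 => q qp; apply: d; lia.
  - exact: evz_lin.
  rewrite (nsum_delta d) /c; congr (_ + _); have [->|_] := eqVneq i j; last by rewrite scale0r.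
  by rewrite ifT //; apply/eqP; lia.
rewrite (eq_bigr _ (fun i _ => H i)) big_split /=; congr (_ + _).
by rewrite -big_mkcond big_pred1_eq.
Qed.

End NumberOperator.

HB.lock Definition state_field (R : realType) (n : nat) (L : even_lattice R n)
  (ep : cocycle L) (v : fock R n) : opfield (fock R n) := Yfock ep v.

Section ModuleIdentities.
Variables (K : numFieldType) (V : lmodType K).

Lemma addr_scale0 (x y : V) : x + 0 *: y = x.
Proof. by rewrite scale0r addr0. Qed.

Lemma half_sum (n : nat) (x y : 'I_n -> V) :
  2^-1 *: (\sum_i (x i + 2 *: y i)) = 2^-1 *: (\sum_i x i) + \sum_i y i.
Proof.
rewrite big_split scalerDr -scaler_sumr scalerA mulVf ?scale1r //.
by rewrite pnatr_eq0.
Qed.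

Lemma L0_eigenvalue (n : nat) (c : 'I_n -> K) (l q : int) (N : nat) (u : V) :
  \sum_i c i * c i = l%:~R -> 2 * q = l ->
  2^-1 *: (\sum_i c i *: (c i *: u)) + N%:R *: u = (N%:Z + q)%:~R *: u.
Proof.
move=> cl ql; under eq_bigr do rewrite scalerA.
rewrite -scaler_suml cl -ql scalerA -scalerDl; congr (_ *: _).
rewrite intrD intrM mulrA mulVf ?pnatr_eq0 // mul1r addrC.
by rewrite -pmulrn.
Qed.

End ModuleIdentities.

Section StateField.
Variables (R : realType) (n : nat) (L : even_lattice R n) (ep : cocycle L).
Local Notation C := (complex R).
Local Notation fock := (fock R n).
Local Notation ket := (@ket R n).
Local Notation h := (hmode L).
Local Notation bihom := (@bihom R n L).
Local Notation E := (vexp ep).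
Local Notation T := (transl h).
Local Notation Y := (state_field ep).
Local Notation one := (ket (mset0, 0)).
Implicit Types (v w : fock) (a c : 'rV[int]_n) (b : fock_index n) (i j : 'I_n).
Implicit Types (s : seq ('I_n * nat)).

Let hf := @heis_field R n L.
Let hc := @heis_comm R n L.
Let hl := @heis_linear R n L.
Let Tl := transl_linear hf.

(** The fields of basis vectors as iterated products, which makes [good_nprod] and
    [dong] applicable. *)
Definition basis_field s c : opfield fock :=
  foldr (fun ip X => nprod (h ip.1) X (- ip.2%:Z - 1)) (E c) s.

Lemma heis_one i k : 0 <= k -> h i k one = 0.
Proof.
case: k => [[|k]|k] // _; last by rewrite heis_vacuum.
by rewrite heis0 lvec0 mxE scale0r.
Qed.

Lemma transl_one : T one = 0.
Proof. by apply: transl_eq0 => // i q; apply: heis_one. Qed.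

Lemma heis_good i : good T one (h i).
Proof.
by split; [exact: hf | exact: transl_heis | move=> k; apply: heis_one].
Qed.

Lemma vexp_one a k : 0 <= k -> E a k one = 0.
Proof.
move=> k0; rewrite vexp_vacuum ldot0r; case s : (_ - _) => [q|q]; first by lia.
by rewrite /= scaler0.
Qed.

Lemma vexp_good a : good T one (E a).
Proof.
by split; [exact: vexp_field | exact: vexp_covariant | move=> k; apply: vexp_one].
Qed.

Lemma basis_field_good s c : good T one (basis_field s c).
Proof.
elim: s => [|x s IHs]; first exact: vexp_good.
exact: (good_nprod Tl _ (heis_good x.1) IHs).
Qed.

Lemma basis_field_field s c : field (basis_field s c).
Proof. by case: (basis_field_good s c). Qed.

Lemma basis_field_creates s c : basis_field s c (-1) one = ket (seq_mset s, c).
Proof.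
elim: s => [|[i p] s IHs] /=.
  rewrite vexp_vacuum eps_0r ldot0r [c + 0]addr0 scale1r.
  rewrite (_ : - -1 - 1 - 0 = 0) //= /emin opser_exp0.
  by congr ket; congr (_, _); apply/msetP => z; rewrite mset0E mset_seqE.
have [_ _ hcr] := heis_good i; have [yF _ ycr] := basis_field_good s c.
rewrite nprod_one // IHs (_ : - p%:Z - 1 = Negz p); last by lia.
rewrite heisN; congr ket; congr (_, _); apply/msetP => z.
by rewrite mset1DE !mset_seqE /= eq_sym.
Qed.

Lemma heis_vexp_loc i a : loc (h i) (E a).
Proof. exact: primary_loc (vexp_field ep a) (@vexp_primary R n L ep a). Qed.

Lemma heis_basis_field_loc s c i : loc (h i) (basis_field s c).
Proof.
elim: s i => [|x s IHs] i; first exact: heis_vexp_loc.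
apply/loc_sym/dong; [exact: hf|exact: basis_field_field|exact: hf|exact: IHs| |].
  exact: heis_loc.
exact/loc_sym/IHs.
Qed.

Lemma basis_field_loc (A : opfield fock) s c : field A -> (forall i, loc (h i) A) ->
  loc (E c) A -> loc (basis_field s c) A.
Proof.
move=> fA hA EA; elim: s => [|x s IHs]; first exact: EA.
by apply: dong; [exact: hf|exact: basis_field_field|exact: fA|
  exact: heis_basis_field_loc|exact: hA|exact: IHs].
Qed.

Lemma basis_fields_loc s c s' c' : loc (basis_field s c) (basis_field s' c').
Proof.
apply: basis_field_loc; [exact: basis_field_field | exact: heis_basis_field_loc |].
apply/loc_sym/basis_field_loc; [exact: vexp_field | move=> i; exact: heis_vexp_loc |
  exact: vexp_loc].
Qed.

Lemma YbasisE b : Ybasis ep b = basis_field (enum_mset b.1) b.2.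
Proof.
rewrite /Ybasis /basis_field; elim: (enum_mset b.1) => [|x s IHs] /=; first by rewrite vexp.unlock.
rewrite IHs -nop_nprod; [by rewrite hmode.unlock | exact: hf | exact: basis_field_field].
Qed.

Lemma Y_ket b : Y (ket b) = basis_field (enum_mset b.1) b.2.
Proof.
apply: funext => k; apply: funext => w; rewrite -YbasisE state_field.unlock.
exact: (fock_liftE (fun b => Ybasis ep b k w)).
Qed.

Lemma Y_linear k w : linear (fun v => Y v k w).
Proof. by rewrite state_field.unlock; apply: lift_linear. Qed.

Lemma Y_lincomb (z : C) v w : Y (z *: v + w) = fun k u => z *: Y v k u + Y w k u.
Proof. by apply: funext => k; apply: funext => u; rewrite Y_linear. Qed.

Lemma Y_0 : Y 0 = fun _ _ => 0.
Proof.
by apply: funext => k; apply: funext => u; apply: (lin0 (Y_linear k u)).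
Qed.

Lemma Y_ind (Q : opfield fock -> Prop) : Q (fun _ _ => 0) ->
  (forall (z : C) A B, Q A -> Q B -> Q (fun k u => z *: A k u + B k u)) ->
  forall v, (forall b, v@_b != 0 -> Q (Y (ket b))) -> Q (Y v).
Proof.
move=> Q0 QD v Qv; apply: (@fock_sum_ind R n (fun v => Q (Y v))) => //.
- by rewrite Y_0.
- by move=> z x y Qx Qy; rewrite Y_lincomb; apply: QD.
Qed.

Lemma field0 : field (fun _ _ => 0 : fock).
Proof. by split=> [k c u v|v]; [rewrite scaler0 addr0 | exists 0]. Qed.

Lemma Y_good v : good T one (Y v).
Proof.
apply: (@Y_ind (good T one)) => [|z A B|b _]; last by rewrite Y_ket; apply: basis_field_good.
  split=> //; first exact: field0.
  by move=> k u; rewrite (lin0 Tl) scaler0 subr0.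
exact: good_lincomb.
Qed.

Lemma Y_field v : field (Y v).
Proof. by case: (Y_good v). Qed.

Lemma loc0 (A : opfield fock) : field A -> loc (fun _ _ => 0) A.
Proof.
move=> fA; exists 0%N => m p v; rewrite bor0 //; last exact: field0.
by rewrite (lin0 (proj1 fA _)) subrr.
Qed.

Lemma Y_loc v w : loc (Y v) (Y w).
Proof.
have H u : loc (Y v) (Y (ket u)).
  suff [] : field (Y v) /\ loc (Y v) (Y (ket u)) by [].
  apply: (@Y_ind (fun A => field A /\ loc A (Y (ket u)))).
  - by split; [exact: field0 | exact: (loc0 (Y_field _))].
  - move=> z A B [fA lA] [fB lB]; split; first exact: lincomb_field.
    by apply: loc_lincomb => //; apply: Y_field.
  - by move=> b _; split; [exact: Y_field | rewrite !Y_ket; apply: basis_fields_loc].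
suff [] : field (Y w) /\ loc (Y w) (Y v) by move=> _ /loc_sym.
apply: (@Y_ind (fun A => field A /\ loc A (Y v))).
- by split; [exact: field0 | exact: (loc0 (Y_field _))].
- move=> z A B [fA lA] [fB lB]; split; first exact: lincomb_field.
  by apply: loc_lincomb => //; apply: Y_field.
- by move=> b _; split; [exact: Y_field | exact/loc_sym/H].
Qed.

Lemma Y_creates v : Y v (-1) one = v.
Proof.
apply: (fock_ext (f := fun v => Y v (-1) one) (g := fun v => v)) => //.
- exact: Y_linear.
- by move=> b; rewrite Y_ket basis_field_creates seq_mset_id -surjective_pairing.
Qed.

Lemma Y_jacobi (a b : fock) (l m p : int) (w : fock) :
  \sum_(j \in [set: nat])
    binz C m j *: Y (Y a (l + j%:Z) b) (m + p - j%:Z) w =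
  \sum_(j \in [set: nat]) ((-1) ^+ j * binz C l j) *:
    (Y a (m + l - j%:Z) (Y b (p + j%:Z) w)
       - (-1) ^ l *: Y b (p + l - j%:Z) (Y a (m + j%:Z) w)).
Proof.
exact: (vertex_jacobi Tl transl_one Y_linear Y_good Y_creates Y_loc).
Qed.

(** Another instance of [heis_unique], for Y(e^0, z) - 1. *)
Lemma vexp_0 : E 0 = @idfield C fock.
Proof.
apply: funext => k; apply: funext => v; apply/eqP; rewrite -subr_eq0; apply/eqP.
pose F p u : fock := E 0 p u - @idfield C fock p u.
have [Il _] := @idfield_field C fock.
have a0 i : avec L 0 i = 0 by rewrite /avec lvec0 mxE.
apply: (@heis_unique R n L int (fun p => - p - 1) F _ _ _ _ k v) => {k v}.
- by move=> p; apply: lin_add; [exact: vexp_linear | exact/lin_opp/Il].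
- move=> i k p v _ _; rewrite /F (linB _ _ (hl _ _)).
  rewrite (@vexp_primary R n L ep 0) a0 (@addr_scale0 C fock); congr (_ - _).
  by rewrite /idfield; case: ifP => _ //; apply: lin0.
- move=> p c; exists c; have vh := @bihomU R n L mset0 c; rewrite wt_zero in vh.
  apply: bihomD.
    have := @vexp_homog R n L ep 0 p _ _ _ vh; rewrite add0r.
    by congr bihom; rewrite qf0; lia.
  rewrite -scaleN1r; apply: bihomZ; rewrite /idfield; case: eqP => [->|_].
    by congr bihom: vh; lia.
  exact: bihom0.
- move=> p c c'; rewrite /F mcoeffB top_vexp eps_0l mul1r ldotC ldot0r subr0 add0r.
  rewrite /idfield; case: eqP => _; last by rewrite mul0r mcoeff0 subr0.
  by rewrite mul1r coef_ket xpair_eqE eqxx /= [c == c']eq_sym subrr.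
Qed.

Lemma Y_one : Y one = @idfield C fock.
Proof. by rewrite Y_ket /= enum_mset0 /= vexp_0. Qed.

Lemma conf_ket i : h i (-1) (h i (-1) one) = ket (msetn 2 (i, 0%N), 0).
Proof.
rewrite -[-1]/(Negz 0) !heisN; congr ket; congr (_, _); apply/msetP => z.
by rewrite !mset1DE mset0E msetnE; case: eqP.
Qed.

Lemma numop_ket m c : numop h (ket (m, c)) =
  (\sum_(x <- enum_mset m) x.2.+1)%N%:R *: ket (m, c).
Proof.
elim/mset_ind: m => [|[i p] m IHm].
  rewrite enum_mset0 big_nil scale0r /numop big1 // => i _; rewrite nsum0 // => q.
  by rewrite heis_vacuum (lin0 (hl _ _)).
have -> : (\sum_(x <- enum_mset ((i, p) +` m)%mset) x.2.+1 =
    p.+1 + \sum_(x <- enum_mset m) x.2.+1)%N.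
  by rewrite (perm_big _ (perm_mset1D (i, p) m)) big_cons.
rewrite -(heisN L) (numop_heis hf hc) IHm (linZ _ _ (hl _ _)) -scalerDl -natrD.
exact: (congr1 (fun k => k%:R *: _) (addnC _ _)).
Qed.

Lemma confE : fock_conf L = 2^-1 *: \sum_i ket (msetn 2 (i, 0%N), 0).
Proof.
rewrite /fock_conf; congr (_ *: _); apply: eq_bigr => i _.
by rewrite -conf_ket hmode.unlock /fock_vac ket.unlock.
Qed.

Lemma Y_conf u : Y (fock_conf L) 1 u =
  2^-1 *: (\sum_i h i 0 (h i 0 u)) + numop h u.
Proof.
rewrite confE (linZ _ _ (Y_linear 1 u)) (lin_sum _ _ _ (Y_linear 1 u)).
under eq_bigr => i _.
  rewrite Y_ket /= enum_msetn /= vexp_0 nprod_id; last exact: hf.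
  rewrite nprod_square; last exact: hf.
  over.
exact: half_sum.
Qed.

(** The zero modes contribute half the norm of c, the oscillators the rest. *)
Lemma L0_ket m c : Y (fock_conf L) 1 (ket (m, c)) = (wt L (m, c))%:~R *: ket (m, c).
Proof.
rewrite Y_conf numop_ket.
have h00 i : h i 0 (h i 0 (ket (m, c))) = avec L c i *: (avec L c i *: ket (m, c)).
  by rewrite heis0 (linZ _ _ (hl i 0)) heis0.
rewrite (eq_bigr _ (fun i _ => h00 i)).
exact: L0_eigenvalue (avec_dot L c c) (qfE L c).
Qed.

Lemma basis_field_homog s c : homog L ((\sum_(x <- s) x.2.+1)%N%:Z + qf L c) c (basis_field s c).
Proof.
elim: s => [|[i p] s IHs] /=.
  by rewrite big_nil add0r; apply: vexp_homog.
have H := @homog_nprod R n L _ _ _ _ _ _ (- p%:Z - 1) (@heis_homog R n L i) IHs.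
rewrite big_cons /=; move=> k d c' v vh; have := H k d c' v vh; rewrite [0 + c]add0r.
by congr bihom; lia.
Qed.

Lemma Y_ket_homog b : homog L (wt L b) b.2 (Y (ket b)).
Proof. by rewrite Y_ket; apply: basis_field_homog. Qed.

End StateField.

(** * Weights, charges and the adjoint module *)
Section Supports.
Variables (R : realType) (n : nat) (L : even_lattice R n) (ep : cocycle L).
Local Notation C := (complex R).
Local Notation fock := (fock R n).
Local Notation ket := (@ket R n).
Local Notation Y := (state_field ep).
Implicit Types (v w : fock) (a c : 'rV[int]_n) (b : fock_index n).

Definition supp (Q : fock_index n -> Prop) v : Prop := forall b, v@_b != 0 -> Q b.

Lemma supp0 Q : supp Q 0.
Proof. by move=> b; rewrite mcoeff0 eqxx. Qed.

Lemma supp_lin Q (z : C) v w : supp Q v -> supp Q w -> supp Q (z *: v + w).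
Proof.
move=> vQ wQ b; rewrite mcoeffD mcoeffZ; have [->|/vQ //] := eqVneq v@_b 0.
by rewrite mulr0 add0r; apply: wQ.
Qed.

Lemma supp_ket (Q : fock_index n -> Prop) b : Q b -> supp Q (ket b).
Proof. by move=> Qb b'; rewrite coef_ket; case: (b =P b') => [<-|] //; rewrite eqxx. Qed.

Lemma supp_map Q (f : fock -> fock) v : linear f ->
  (forall b, v@_b != 0 -> supp Q (f (ket b))) -> supp Q (f v).
Proof.
move=> fl vf; refine (@fock_sum_ind R n (fun v => supp Q (f v)) _ _ v _).
- by rewrite (lin0 fl); apply: supp0.
- by move=> z x y xQ yQ; rewrite fl; apply: supp_lin.
- by move=> b /vf.
Qed.

(** The mode k of a product adds charges, adds weights and subtracts k + 1. *)
Lemma Y_supp (Q : int -> 'rV[int]_n -> Prop) v k w :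
  (forall b b', v@_b != 0 -> w@_b' != 0 -> Q (wt L b + wt L b' - k - 1) (b.2 + b'.2)) ->
  supp (fun b => Q (wt L b) b.2) (Y v k w).
Proof.
move=> vwQ; apply: (@supp_map _ (fun v => Y v k w)); first exact: Y_linear.
move=> b vb; apply: supp_map; first by case: (Y_field ep (ket b)).
move=> -[m c] wb' b'' b''n0.
have [-> ->] := @Y_ket_homog R n L ep b k _ _ _ (@bihomU R n L m c) b'' b''n0.
by rewrite [wt L (m, c) + _]addrC; exact: (vwQ _ _ vb wb').
Qed.

Lemma coef_L0 v b : (Y (fock_conf L) 1 v)@_b = (wt L b)%:~R * v@_b.
Proof.
apply: (fock_ext (W := C^o) (f := fun v => (Y (fock_conf L) 1 v)@_b)
  (g := fun v => (wt L b)%:~R * v@_b)).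
- by move=> z x y; rewrite (proj1 (Y_field _ _)) coef_linear.
- by move=> z x y; rewrite coef_linear mulrDr scalerAr.
move=> -[m c]; rewrite L0_ket mcoeffZ coef_ket.
by case: eqP => [->|_] //; rewrite !mulr0.
Qed.

Lemma weight_supp v (d : int) : Y (fock_conf L) 1 v = d%:~R *: v ->
  supp (fun b => wt L b = d) v.
Proof.
move=> vd b vb; apply: (@intr_inj C); apply: (mulIf vb).
by rewrite -coef_L0 vd mcoeffZ.
Qed.

Lemma supp_weight v (d : int) : supp (fun b => wt L b = d) v ->
  Y (fock_conf L) 1 v = d%:~R *: v.
Proof.
move=> vd; apply/malgP => b; rewrite coef_L0 mcoeffZ.
by have [->|/vd ->] := eqVneq v@_b 0; rewrite ?mulr0.
Qed.

Definition wproj (k : nat) : fock -> fock :=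
  fock_lift (fun b => if wt L b == k%:Z then ket b else 0).

Lemma coef_wproj k v b : (wproj k v)@_b = if wt L b == k%:Z then v@_b else 0.
Proof.
have [e|e] := eqVneq (wt L b) k%:Z.
  apply: (fock_ext (W := C^o) (f := fun v => (wproj k v)@_b) (g := fun v => v@_b)).
  - by move=> z x y; rewrite /wproj fock_lift_linear coef_linear.
  - exact: coef_linear.
  move=> b'; rewrite /wproj fock_liftE; case: eqP => // b'k.
  rewrite mcoeff0 coef_ket; case: eqP => // bb'; by rewrite -bb' in e.
apply: (fock_ext (W := C^o) (f := fun v => (wproj k v)@_b) (g := fun=> 0)).
- by move=> z x y; rewrite /wproj fock_lift_linear coef_linear.
- by move=> z x y; rewrite scaler0 addr0.
move=> b'; rewrite /wproj fock_liftE; case: eqP => [b'k|_]; last by rewrite mcoeff0.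
rewrite coef_ket; case: eqP => // bb'; by rewrite -bb' b'k eqxx in e.
Qed.

Lemma coef_sum (I : Type) (r : seq I) (F : I -> fock) b :
  (\sum_(i <- r) F i)@_b = \sum_(i <- r) (F i)@_b.
Proof. by elim/big_ind2: _ => [|x x' y y' <- <-|i _]; rewrite ?mcoeff0 ?mcoeffD. Qed.

Lemma sum_wproj v : v = \sum_(k <- undup [seq `|wt L b|%N | b <- msupp v]) wproj k v.
Proof.
apply/malgP => b; rewrite coef_sum (eq_bigr _ (fun k _ => coef_wproj k v b)).
have [vb|vb] := eqVneq v@_b 0.
  by rewrite vb big1 // => k _; rewrite if_same.
have wb : wt L b = `|wt L b|%N%:Z by have := wt_ge0 L b; lia.
rewrite (bigD1_seq `|wt L b|%N) ?undup_uniq //=; last first.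
  by rewrite mem_undup; apply/map_f; rewrite -mcoeff_neq0.
rewrite -wb eqxx big1 ?addr0 // => k kb.
by case: eqP => // wk; move: kb; rewrite wk eqxx.
Qed.

End Supports.

Section Adjoint.
Variables (R : realType) (n : nat) (L : even_lattice R n) (ep : cocycle L).
Variable P : submonoid 'rV[int]_n.
Local Notation C := (complex R).
Local Notation fock := (fock R n).
Local Notation ket := (@ket R n).
Local Notation Y := (state_field ep).
Local Notation VP := (sub_voa ep P).
Implicit Types (u v w : VP) (b : fock_index n).

Definition fval (v : VP) : fock := fock_val v.

Lemma fval_inj : injective fval.
Proof. exact: val_inj. Qed.

Lemma fval_linear : linear fval.
Proof. by move=> c u v. Qed.

Lemma fvalZ (z : C) v : fval (z *: v) = z *: fval v.
Proof. by []. Qed.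

Lemma fvalB u v : fval (u - v) = fval u - fval v.
Proof. by []. Qed.

Lemma fvalE u k v : fval (vop u k v) = Y (fval u) k (fval v).
Proof. by rewrite state_field.unlock. Qed.

Lemma fval_sum (I : Type) (r : seq I) (F : I -> VP) :
  fval (\sum_(i <- r) F i) = \sum_(i <- r) fval (F i).
Proof. by elim/big_ind2: _ => [|x x' y y' <- <-|i _]. Qed.

Lemma fval_fsum (F : nat -> VP) :
  fval (\sum_(j \in [set: nat]) F j) = \sum_(j \in [set: nat]) fval (F j).
Proof.
have E : [set: nat] `&` F @^-1` [set~ 0] =
    [set: nat] `&` (fun j => fval (F j)) @^-1` [set~ 0].
  apply/seteqP; split=> j [_ /= Fj]; split=> //= Fj0; apply: Fj.
    by apply: fval_inj; rewrite Fj0.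
  by rewrite Fj0.
by rewrite fval_sum /finite_support !unlock E.
Qed.

Lemma fval_P v : supp (fun b => P b.2) (fval v).
Proof.
move=> b vb; apply: contrapT => Pb; move/eqP: vb; apply.
by have /charge_inP := fock_valP v; apply.
Qed.

Lemma fval_vac : fval (vac VP) = ket (mset0, 0).
Proof. by rewrite ket.unlock. Qed.

Let linl k w : linear (fun u => vop u k w).
Proof.
by move=> c u v; apply: fval_inj; rewrite fvalE !fval_linear Y_linear -!fvalE.
Qed.

Let linr u k : linear (vop u k).
Proof.
move=> c v w; apply: fval_inj.
by rewrite fvalE !fval_linear (proj1 (Y_field _ _)) -!fvalE.
Qed.

Let trunc u v : exists N : int, forall k, N <= k -> vop u k v = 0.
Proof.
have [N HN] := proj2 (Y_field ep (fval u)) (fval v).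
by exists N => k kN; apply: fval_inj; rewrite fvalE HN.
Qed.

Let vacuum k v : vop (vac VP) k v = if k == -1 then v else 0.
Proof.
by apply: fval_inj; rewrite fvalE fval_vac Y_one /idfield; case: ifP.
Qed.

Let jacobi u v (l m p : int) w :
  \sum_(j \in [set: nat])
    binz C m j *: vop (vop u (l + j%:Z) v) (m + p - j%:Z) w =
  \sum_(j \in [set: nat])
    ((-1) ^+ j * binz C l j) *:
      (vop u (m + l - j%:Z) (vop v (p + j%:Z) w)
       - (-1) ^ l *: vop v (p + l - j%:Z) (vop u (m + j%:Z) w)).
Proof.
apply: fval_inj; rewrite !fval_fsum.
apply: etrans (etrans _ (Y_jacobi ep (fval u) (fval v) l m p (fval w))) _;
  apply: eq_nsum => j.
  by rewrite fvalZ !fvalE.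
by rewrite fvalZ fvalB fvalZ !fvalE.
Qed.

Definition adjoint_weak : weak_module VP :=
  @WeakModule C VP VP (@vop C VP) linl linr trunc vacuum jacobi.

Definition wt_gr (k : nat) (v : adjoint_weak) : Prop :=
  supp (fun b => wt L b = k%:Z) (fval v).

Let gr_direct : is_direct_sum wt_gr.
Proof.
split.
- move=> k; split; first exact: supp0.
  by move=> c x y xk yk; rewrite /wt_gr fval_linear; apply: supp_lin.
- move=> w.
  have wP k : wproj L k (fval w) \in charge_in P.
    apply: fock_lift_charge (fock_valP w) => b bP; case: ifP => _; last exact: rpred0.
    by rewrite ket.unlock; apply: charge_inU.
  exists (undup [seq `|wt L b|%N | b <- msupp (fval w)]), (fun k => FockOn (wP k)).
  split=> [k b|]; last by apply: fval_inj; rewrite fval_sum -sum_wproj.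
  by rewrite /fval /= coef_wproj; case: (wt L b =P k%:Z) => // _; rewrite eqxx.
- move=> s f us fk s0 k ks; apply: fval_inj; apply/malgP => b.
  rewrite [RHS]mcoeff0; have [//|fb] := eqVneq (fval (f k))@_b 0.
  have := congr1 (fun v => (fval v)@_b) s0; rewrite fval_sum coef_sum mcoeff0.
  rewrite (bigD1_seq k) //= big1 ?addr0 // => k' k'k.
  apply/eqP/negPn/negP => fb'; have := fk _ _ fb'; rewrite (fk _ _ fb).
  by move=> [] kk'; rewrite kk' eqxx in k'k.
Qed.

Let gr_degree (u : VP) (d m : int) (k : nat) (w : adjoint_weak) :
  has_weight u d -> wt_gr k w ->
  (forall k' : nat, k'%:Z = k%:Z + d - m - 1 -> wt_gr k' (wm_op u m w)) /\
  (k%:Z + d - m - 1 < 0 -> wm_op u m w = 0).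
Proof.
move=> /(congr1 fval); rewrite fvalE fvalZ.
move=> /weight_supp ud wk.
have H : supp (fun b => wt L b = k%:Z + d - m - 1) (fval (wm_op u m w)).
  rewrite fvalE; apply: (@Y_supp R n L ep (fun e _ => e = k%:Z + d - m - 1)).
  by move=> b b' /ud -> /wk ->; lia.
split=> [k' k'E|neg]; first by move=> b /H ->.
apply: fval_inj; apply/malgP => b; rewrite [RHS]mcoeff0.
by apply/eqP/negPn/negP => /H; have := wt_ge0 L b; lia.
Qed.

Definition adjoint : admissible_module VP :=
  @AdmissibleModule C VP adjoint_weak wt_gr gr_direct gr_degree.

End Adjoint.

(** * The ideal cut out by the half-space *)
Section HalfSpace.
Variables (R : realType) (n : nat) (L : even_lattice R n) (ep : cocycle L).
Variables (P : submonoid 'rV[int]_n) (g : 'rV[R]_n).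
Hypothesis Pg : in_halfspace L P g.
Variable a0 : 'rV[int]_n.
Hypotheses (Pa0 : P a0) (ga0 : 0 < dot g (lvec L a0)).
Local Notation C := (complex R).
Local Notation fock := (fock R n).
Local Notation ket := (@ket R n).
Local Notation Y := (state_field ep).
Local Notation VP := (sub_voa ep P).
Local Notation fval := (@fval R n L ep P).
Implicit Types (u v w : VP) (b : fock_index n).

Definition height (c : 'rV[int]_n) : R := dot g (lvec L c).

Lemma heightD a c : height (a + c) = height a + height c.
Proof. by rewrite /height lvecD !(dotC g) dotDl. Qed.

Lemma height0 : height 0 = 0.
Proof. by apply: (addrI (height 0)); rewrite -heightD !addr0. Qed.

(** The ideal V_+. *)
Definition upper v : Prop := supp (fun b => 0 < height b.2) (fval v).

Lemma upper_subspace : subspace upper.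
Proof.
split; first exact: supp0.
by move=> c x y xu yu; rewrite /upper fval_linear; apply: supp_lin.
Qed.

Lemma VP_ge0 v b : (fval v)@_b != 0 -> 0 <= height b.2.
Proof. by move=> /fval_P /Pg. Qed.

(** One factor has positive height, the other one nonnegative height because P lies in
    the half-space. *)
Lemma upper_ideal : ideal upper.
Proof.
split=> [|u v k vu]; first exact: upper_subspace.
by split; rewrite /upper fvalE;
  apply: (@Y_supp R n L ep (fun _ c => 0 < height c)) => b b' ub vb;
  rewrite heightD; [apply: ltr_wpDl | apply: ltr_wpDr];
  try exact: (VP_ge0 ub); try exact: (VP_ge0 vb); exact: vu.
Qed.

Lemma ket_in m c : P c -> ket (m, c) \in charge_in P.
Proof. by move=> Pc; rewrite ket.unlock; apply: charge_inU. Qed.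

Definition etop : VP := FockOn (ket_in mset0 Pa0).

Lemma upper_etop : upper etop.
Proof. exact: supp_ket. Qed.

Lemma ket_neq0 b : ket b != 0.
Proof.
apply/eqP => /(congr1 (fun v : fock => v@_b)).
by rewrite coef_ket eqxx mcoeff0 => /eqP; rewrite oner_eq0.
Qed.

Lemma VP_not_simple : ~ simple_voa VP.
Proof.
move=> /(_ _ upper_ideal) [up0|up].
  by have /(congr1 fval) := up0 _ upper_etop; apply/eqP/ket_neq0.
have := up (vac VP) (mset0, 0); rewrite fval_vac coef_ket eqxx oner_neq0 /= height0.
by rewrite ltxx => /(_ isT).
Qed.

(** The state g(-1) 1. *)
Definition height_vec : fock := \sum_i (g 0 i)%:C%C *: ket ([mset (i, 0%N)]%mset, 0).

Lemma height_vec_in : height_vec \in charge_in P.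
Proof. by apply: rpred_sum => i _; apply/rpredZ/ket_in/sm_mem0. Qed.

Definition height_elt : VP := FockOn height_vec_in.

Lemma Y_height_vec m c : Y height_vec 0 (ket (m, c)) = (height c)%:C%C *: ket (m, c).
Proof.
rewrite /height_vec (lin_sum _ _ _ (Y_linear ep 0 _)).
have H (i : 'I_n) : Y ((g 0 i)%:C%C *: ket ([mset (i, 0%N)]%mset, 0)) 0 (ket (m, c)) =
    (g 0 i * lvec L c 0 i)%:C%C *: ket (m, c).
  rewrite (linZ _ _ (Y_linear ep 0 _)) Y_ket /= enum_msetn /= vexp_0.
  rewrite nprod_id; last exact: heis_field.
  by rewrite heis0 scalerA rmorphM.
by rewrite (eq_bigr _ (fun i _ => H i)) -scaler_suml -rmorph_sum.
Qed.

Lemma coef_height_elt v b : (fval (vop height_elt 0 v))@_b = (height b.2)%:C%C * (fval v)@_b.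
Proof.
rewrite fvalE -[fval height_elt]/height_vec; move: (fval v) => {v} v.
pose f (v : fock) : C^o := (Y height_vec 0 v)@_b.
pose h (v : fock) : C^o := (height b.2)%:C%C * v@_b.
have fl : linear f.
  by move=> z x y; rewrite /f (proj1 (Y_field _ _)) coef_linear.
have hl : linear h.
  by move=> z x y; rewrite /h coef_linear mulrDr; congr (_ + _); apply: mulrCA.
have fh b' : f (ket b') = h (ket b').
  rewrite /f /h; case: b' => m c; rewrite Y_height_vec mcoeffZ coef_ket.
  by case: ((m, c) =P b) => [<-|_] //; rewrite !mulr0.
exact: (fock_ext fl hl fh).
Qed.

Lemma height_elt_weight : has_weight height_elt 1.
Proof.
apply: fval_inj; rewrite fvalE fvalZ; apply: supp_weight => b.
have : supp (fun b => wt L b = 1) height_vec; last exact.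
apply: big_ind => [|x y xs ys|i _]; first exact: supp0.
  by rewrite -[x]scale1r; apply: supp_lin.
rewrite -[_ *: _]addr0; apply: supp_lin; last exact: supp0.
by apply: supp_ket; rewrite /wt /= enum_msetn /= big_seq1 qf0.
Qed.

(** The product of the operators h_0 - c for c in s, on any weak module; it is
    diagonal on V_P. *)
Definition kill (N : weak_module VP) (s : seq C) (x : N) : N :=
  foldr (fun c y => wm_op height_elt 0 y - c *: y) x s.

Lemma coef_kill s (v : adjoint ep P) b : (fval (kill s v))@_b =
  (\prod_(c <- s) ((height b.2)%:C%C - c)) * (fval v)@_b.
Proof.
elim: s => [|c s IHs]; first by rewrite big_nil mul1r.
rewrite big_cons -mulrA -IHs mulrBl -coef_height_elt.
exact: etrans (mcoeffB _ _ _) (congr1 (fun z => _ - z) (mcoeffZ _ _ _)).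
Qed.

Lemma kill_upper s (v : adjoint ep P) : (forall c, c \in s -> exists2 r : R, 0 < r & c = r%:C%C) ->
  kill s v = 0 -> upper v.
Proof.
move=> s0 /(congr1 fval) H b vb.
have := congr1 (fun v : fock => v@_b) H; rewrite coef_kill mcoeff0 => /eqP.
rewrite mulf_eq0 (negPf vb) orbF prodf_seq_eq0 => /hasP[c /s0[r r0 ->]] /=.
by rewrite subr_eq0 => /eqP /complexI ->.
Qed.

Lemma upper_kill v : upper v -> exists2 s : seq C,
  (forall c, c \in s -> exists2 r : R, 0 < r & c = r%:C%C) & kill (N := adjoint ep P) s v = 0.
Proof.
move=> vu; exists [seq (height b.2)%:C%C | b : fock_index n <- msupp (fval v)].
  by move=> c /mapP[b bv ->]; exists (height b.2) => //; apply: vu; rewrite mcoeff_neq0.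
apply: fval_inj; apply/malgP => b; rewrite coef_kill [RHS]mcoeff0.
have [->|vb] := eqVneq (fval v)@_b 0; first by rewrite mulr0.
rewrite (big_rem ((height b.2)%:C%C)) /= ?subrr ?mul0r //.
by apply: map_f; rewrite -mcoeff_neq0.
Qed.

Lemma upper_op u k (x : adjoint ep P) : upper x -> upper (wm_op u k x).
Proof.
move=> xu; have [H _] := (proj2 upper_ideal) u x k xu.
exact H.
Qed.

Section Pieces.
Variables (N : admissible_module VP) (iota : {linear N -> adjoint ep P}).
Hypothesis iota_inj : injective iota.
Hypothesis iota_hom : forall a k x, iota (wm_op a k x) = wm_op a k (iota x).

Lemma kill_linear s : linear (kill (N := N) s).
Proof.
elim: s => [|c s IHs] z x y //=; rewrite IHs wm_linr.
by rewrite !scalerDr !scalerN !scalerA opprD addrACA mulrC.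
Qed.

Lemma kill_hom s x : iota (kill s x) = kill s (iota x).
Proof.
elim: s => [|c s IHs] //.
apply: etrans (raddfB iota _ _) _.
congr (_ - _); first exact: etrans (iota_hom _ _ _) (congr1 _ IHs).
exact: etrans (linearZZ iota _ _) (congr1 _ IHs).
Qed.

Lemma kill_gr s k x : am_gr k x -> am_gr k (kill (N := N) s x).
Proof.
move=> xk; have [/(_ k) [g0 gL] _ _] := am_direct N.
elim: s => [|c s IHs] //=; rewrite addrC -scaleNr; apply: gL => //.
have [gk _] := @am_degree _ _ N _ _ 0 _ _ height_elt_weight IHs.
by apply: gk; lia.
Qed.

(** If the sum of the f k lies in V_+, some product of operators h_0 - c with c > 0
    kills it, hence kills each f k, since it preserves the degrees of N. *)
Lemma upper_submodule : admissible_submodule (fun x : N => upper (iota x)).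
Proof.
have [up0 upL] := upper_subspace.
split.
- split; first by rewrite raddf0.
  by move=> c x y xu yu; rewrite linearP; apply: upL.
- by move=> a k x xu; rewrite iota_hom; apply: upper_op.
move=> s f us fk /upper_kill [t t0] tf k ks.
have tf0 : \sum_(k <- s) kill t (f k) = 0.
  rewrite -(lin_sum _ _ _ (kill_linear t)); apply: iota_inj.
  by rewrite kill_hom raddf0.
have [_ _ /(_ s (fun k => kill t (f k)) us (fun k => kill_gr t (fk k)) tf0 k ks)] :=
  am_direct N.
move=> tfk; apply: (kill_upper t0).
by rewrite -kill_hom tfk raddf0.
Qed.

End Pieces.

(** The mode -1 of e^a0 is applied to the decomposition of the vacuum into components
    f i of irreducible submodules; see the introduction. *)
Lemma VP_not_rational : ~ rational_voa VP.
Proof.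
move=> /(_ (adjoint ep P)) [I [N [iota [irr lin hom [_ dec _]]]]].
have [s [f [fN vacE]]] := dec (vac VP).
have [[up0 upL] upI] := upper_ideal.
pose u (x : adjoint ep P) : adjoint ep P := wm_op etop (-1) x.
have ul : linear u by exact: wm_linr.
(* In the first case u (f i) lies both in V_+ and in a submodule meeting it in 0. *)
have dich i : u (f i) = 0 \/ upper (f i).
  have [x fx] := fN i; have [il ii] := lin i.
  pose io : {linear N i -> adjoint ep P} :=
    HB.pack (iota i) (GRing.isLinear.Build _ _ _ _ (iota i) il).
  have [_ /(_ _ (@upper_submodule _ io ii (hom i)))] := irr i.
  case=> H; last by right; rewrite fx; apply: H.
  left; rewrite fx /u -hom.
  rewrite (H (wm_op etop (-1) x)) ; first exact: (raddf0 io).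
  have -> : io (wm_op etop (-1) x) = wm_op etop (-1) (iota i x) := hom i _ _ _.
  by have [_ Hu] := upI (iota i x) etop (-1) upper_etop; exact Hu.
(* The mode adds the charge a0, so it raises positive heights above height a0. *)
have uX (x : VP) : upper x -> supp (fun b => height a0 < height b.2) (fval (u x)).
  move=> xu; rewrite fvalE.
  apply: (@Y_supp R n L ep (fun _ c => height a0 < height c)) => b b' ub vb.
  have -> : b.2 = a0.
    apply/eqP/negPn/negP => ba; move: ub; rewrite coef_ket.
    by case: ((mset0, a0) =P b) => [bE|]; rewrite ?eqxx //; rewrite -bE eqxx in ba.
  by rewrite heightD ltrDl; apply: xu.
have : supp (fun b => height a0 < height b.2) (fval (u (vac VP))).
  rewrite vacE (lin_sum _ _ _ ul).
  elim/big_ind: _ => [|x y xs ys|i _]; first exact: supp0.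
    by rewrite -[x]scale1r fval_linear; apply: supp_lin.
  have [->|fu] := dich i; last exact: uX.
  exact: supp0.
(* The vacuum goes to e^a0, of height exactly height a0. *)
rewrite fvalE fval_vac Y_creates => /(_ (mset0, a0)).
by rewrite coef_ket eqxx oner_neq0 /= ltxx => /(_ isT).
Qed.

End HalfSpace.

(** The lattice spans E. *)
Lemma height_neq0 (R : realType) (n : nat) (L : even_lattice R n) (g : 'rV[R]_n) :
  g <> 0 -> exists a : 'rV[int]_n, height L g a != 0.
Proof.
move=> g0; apply: contrapT => H; apply: g0.
have Lg : lbasis L *m g^T = 0.
  apply/colP => i; rewrite [RHS]mxE.
  have [//|gi] := eqVneq ((lbasis L *m g^T) i 0) 0; exfalso.
  apply: H; exists (delta_mx 0 i); rewrite /height.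
  have -> : dot g (lvec L (delta_mx 0 i)) = (lbasis L *m g^T) i 0; last exact: gi.
  rewrite /dot mxE; apply: eq_bigr => j _.
  by rewrite /lvec map_delta_mx -rowE !mxE mulrC.
have /(congr1 trmx) := mulKmx (lbasis_unit L) g^T.
by rewrite Lg mulmx0 trmx0 trmxK.
Qed.

Lemma sub_voa_halfspace (R : realType) (n : nat) (L : even_lattice R n)
    (ep : cocycle L) (B P : submonoid 'rV[int]_n) (g : 'rV[R]_n) :
  (forall a, B a \/ B (- a)) -> (forall a, B a -> P a) ->
  g <> 0 -> in_halfspace L P g ->
  ~ simple_voa (sub_voa ep P) /\ ~ rational_voa (sub_voa ep P).
Proof.
move=> BN BP g0 Pg; have [a ha] := height_neq0 L g0.
have pos c : P c -> height L g c != 0 -> 0 < height L g c.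
  by move=> /Pg c0 cn; rewrite lt_neqAle eq_sym cn; apply: c0.
have [c Pc hc] : exists2 c, P c & 0 < height L g c.
  case: (BN a) => /BP Pa; first by exists a => //; apply: pos.
  exists (- a) => //; apply: pos => //; apply: contra ha => /eqP ha.
  by have := heightD L g a (- a); rewrite subrr height0 ha addr0 => <-.
by split; [apply: VP_not_simple Pg c Pc hc | apply: VP_not_rational Pg c Pc hc].
Qed.

Theorem proposition4p5 (R : realType) (n : nat) (n_gt0 : (0 < n)%N)
    (L : even_lattice R n) (ep : cocycle L) :
  (forall (B P : submonoid 'rV[int]_n) (g : 'rV[R]_n),
     borel_type L B -> g <> 0 -> in_halfspace L B g ->
     parabolic_type L P -> (forall a, B a -> P a) -> in_halfspace L P g ->
     ~ simple_voa (sub_voa ep P) /\ ~ rational_voa (sub_voa ep P))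
  /\
  (forall B : submonoid 'rV[int]_n, borel_type L B ->
     ~ simple_voa (sub_voa ep B) /\ ~ rational_voa (sub_voa ep B)).
Proof.
split=> [B P g [BN _ _] g0 _ _ BP Pg | B [BN _ [g [g0 Bg]]]].
  exact: sub_voa_halfspace BN BP g0 Pg.
exact: sub_voa_halfspace BN (fun _ => id) g0 Bg.
Qed.
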